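(* The function $T=s^2/c^2$ satisfies the differential equation $\nabla\,(T')^2=4T(1+T)(1+\lambda^2T)$, and neither $T$ nor $t=s/c$ is elliptic (i.e. neither admits an extension from a small disc about $0$ to an elliptic function on $\mathbb{C}$).
   Context: Let $0<\kappa<1$ and $\lambda=\sqrt{1-\kappa^2}\in(0,1)$. Let $F(\tfrac16,\tfrac56;\tfrac12;\cdot)$ denote the Gauss hypergeometric function. Define $u$ as a function of $\phi$ near $0$ by $u=\int_0^{\sin\phi}F(\tfrac16,\tfrac56;\tfrac12;\kappa^2t^2)\,\frac{dt}{\sqrt{1-t^2}}$; near the origin (fixing $0$) this inverts to a holomorphic function $u\mapsto\phi(u)$ with $\phi(0)=0$. Let $\psi$ be the holomorphic function near $0$ with $\psi(0)=0$ and $\sin\psi=\kappa\sin\phi$. Set $s=\sin\phi$, $c=\cos\phi$, $\partial=\cos\tfrac23\psi$, $\nabla=\partial^2$, all as functions of $u$ on a small disc about $0$; primes denote $d/du$. *)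

(* Defs.v *)
From Stdlib Require Import Reals Factorial.
From Coquelicot Require Import Coquelicot.
Export Coquelicot.Complex.

Local Open Scope C_scope.

Definition Cseries (a : nat -> C) : C :=
  (Series (fun n => Re (a n)), Series (fun n => Im (a n))).

Definition Cexp (z : C) : C := Cseries (fun n => z ^ n / RtoC (INR (fact n))).
Definition Csin (z : C) : C := (Cexp (Ci * z) - Cexp (- (Ci * z))) / (2 * Ci).
Definition Ccos (z : C) : C := (Cexp (Ci * z) + Cexp (- (Ci * z))) / 2.

(** Principal branch of the complex square root. *)
Definition Csqrt (z : C) : C :=
  (sqrt ((Cmod z + Re z) / 2),
   ((if Rle_dec 0 (Im z) then 1 else -1) * sqrt ((Cmod z - Re z) / 2))%R).

Fixpoint poch (a : R) (n : nat) : R :=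
  match n with O => 1%R | S k => (poch a k * (a + INR k))%R end.

Definition hyp2F1 (a b c : R) (w : C) : C :=
  Cseries (fun n =>
    RtoC (poch a n * poch b n / (poch c n * INR (fact n)))%R * w ^ n).

(** Integral of f along the straight segment from 0 to x:
    int_0^x f(t) dt = int_0^1 f(s x) x ds. *)
Definition Cint0 (f : C -> C) (x : C) : C :=
  x * (RInt (fun s : R => Re (f (RtoC s * x))) 0 1,
       RInt (fun s : R => Im (f (RtoC s * x))) 0 1).

Definition u_of_phi (kappa : R) (phi : C) : C :=
  Cint0 (fun t => hyp2F1 (1/6) (5/6) (1/2) (RtoC kappa ^ 2 * t ^ 2)
                   / Csqrt (1 - t ^ 2)) (Csin phi).

Definition Cdiff (f : C -> C) (z : C) : Prop :=
  @ex_derive C_AbsRing C_NormedModule f z.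

Definition setting (kappa r : R) (phi psi : C -> C) : Prop :=
  phi 0 = 0 /\ psi 0 = 0 /\
  forall u : C, (Cmod u < r)%R ->
    Cdiff phi u /\ u_of_phi kappa (phi u) = u /\
    Cdiff psi u /\ Csin (psi u) = RtoC kappa * Csin (phi u).

Definition meromorphic (f : C -> C) (P : C -> Prop) : Prop :=
  (forall z, exists eps, (0 < eps)%R /\
      forall w, (0 < Cmod (w - z) < eps)%R -> ~ P w) /\
  (forall z, ~ P z -> Cdiff f z) /\
  (forall p, P p -> forall M : R, exists delta, (0 < delta)%R /\
      forall w, (0 < Cmod (w - p) < delta)%R -> (M < Cmod (f w))%R).

(** Elliptic function: meromorphic on C and doubly periodic with two
    R-linearly independent periods. *)
Definition elliptic (f : C -> C) (P : C -> Prop) : Prop :=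
  meromorphic f P /\
  exists w1 w2 : C, Im (Cconj w1 * w2) <> 0%R /\
    forall z, (P (z + w1) <-> P z) /\ (P (z + w2) <-> P z) /\
      (~ P z -> f (z + w1) = f z /\ f (z + w2) = f z).

Definition extends_to_elliptic (r : R) (g : C -> C) : Prop :=
  exists (E : C -> C) (P : C -> Prop) (rho : R),
    elliptic E P /\ (0 < rho <= r)%R /\
    forall u, (Cmod u < rho)%R -> ~ P u /\ E u = g u.

(* Main.v *)
(** The hypergeometric equation turns into y'' = - (4/9) y for y = cos psi F(sin^2 psi), so
    F(1/6, 5/6; 1/2; sin^2 psi) = cos (2 psi / 3) / cos psi and hence phi' = cos psi / d with
    d = cos (2 psi / 3); this gives the differential equation for T.

    Suppose that E is elliptic and extends T.  Then G = E'^2 / (4 E (1 + E) (1 + lambda^2 E))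
    extends 1 / d^2.  From cos 2 psi = 4 d^3 - 3 d one gets the relation
    (4 - 3 G)^2 (1 + E)^2 = G^3 (1 + (1 - 2 kappa^2) E)^2 near 0, hence everywhere by analytic
    continuation.  It bounds G near each pole of E and each zero of E (1 + E) (1 + lambda^2 E),
    so G extends to a doubly periodic entire function, which is constant by Liouville.  As
    G = 1 at 0, the relation makes E constant: a contradiction.  For t, apply this to t^2.

    Liouville's theorem, removable singularities and the identity theorem come from Goursat's
    lemma for triangles, through Cauchy's formula on circles and Taylor expansion. *)
Require Import Defs.
From Stdlib Require Import Reals Lra Lia ZArith IndefiniteDescription Classical.
From Coquelicot Require Import Coquelicot.
Import Coquelicot.Complex.
Local Open Scope C_scope.

(** * Complex derivatives *)

(** Squaring is what makes the continuation possible: d itself need not continue to a single-valued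
    function, while G is a quotient formed from E and E'. With k = kappa^2, sin^2 phi = T / (1 + T)
    gives cos 2 psi = (1 + (1 - 2k) T) / (1 + T), and the square of d (4 d^2 - 3) contains only even
    powers of d; this is how a relation between G and E alone arises. As G has degree 3 on one side
    and 2 on the other, G can be infinite only where 1 + (1 - 2k) E vanishes, read projectively at
    poles. There E (1 + E) (1 + lambda^2 E) is finite and nonzero, except that for k = 1/2 these
    points are the poles of E and need their own estimate.

    [meromorphic] leaves the values of E on P arbitrary, and analytic continuation on the complement
    of P would require the connectedness of that set. The continuation therefore runs over all of C,
    by germs of G on full discs whose relations are imposed on the punctured discs only.

    In [setting], phi and psi are arbitrary differentiable solutions, not chosen branches; a
    continuity argument has to confine them to a small disc first. *)

Definition is_Cderive (f : C -> C) (z d : C) : Prop :=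
  @is_derive C_AbsRing C_NormedModule f z d.

(** [is_derive] speaks of every limit of the filter [locally z]; uniqueness of the limit leaves only
    [z]. Every derivative computed by hand below is proved in this form. *)
Lemma is_Cderive_iff (f : C -> C) (z d : C) :
  is_Cderive f z d <->
  forall eps, (0 < eps)%R -> exists del, (0 < del)%R /\
    forall w, (Cmod (w - z) < del)%R ->
      (Cmod (f w - f z - d * (w - z)) <= eps * Cmod (w - z))%R.
Proof.
  split.
  - intros [_ H] eps Heps.
    destruct (H z (fun P HP => HP) (mkposreal eps Heps)) as [del Hd].
    exists del; split; [apply cond_pos|].
    intros w Hw. rewrite (Cmult_comm d). exact (Hd w Hw).
  - intros H; split.
    + apply is_linear_scal_l.
    + intros x Hx eps.
      assert (E : z = x) by exact (@is_filter_lim_locally_unique C_AbsRing (AbsRing_NormedModule C_AbsRing) z x Hx).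
      subst x.
      destruct (H eps (cond_pos eps)) as [del [Hd K]].
      exists (mkposreal del Hd). intros w Hw.
      specialize (K w Hw). rewrite (Cmult_comm d) in K. exact K.
Qed.

(* Coquelicot gives C two normed module structures over itself, with different but
   equivalent uniformities; its product and chain rules concern the second one. *)
Lemma is_Cderive_AbsRing (f : C -> C) (z d : C) :
  is_Cderive f z d <-> @is_derive C_AbsRing (AbsRing_NormedModule C_AbsRing) f z d.
Proof.
  split; intros [_ H]; (split; [apply is_linear_scal_l|exact H]).
Qed.

Lemma is_Cderive_const (c z : C) : is_Cderive (fun _ => c) z 0.
Proof. exact (@is_derive_const C_AbsRing C_NormedModule c z). Qed.

Lemma is_Cderive_id (z : C) : is_Cderive (fun w => w) z 1.
Proof. apply is_Cderive_AbsRing. exact (@is_derive_id C_AbsRing z). Qed.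

Lemma is_Cderive_plus (f g : C -> C) (z a b : C) :
  is_Cderive f z a -> is_Cderive g z b -> is_Cderive (fun w => f w + g w) z (a + b).
Proof. exact (@is_derive_plus C_AbsRing C_NormedModule f g z a b). Qed.

Lemma is_Cderive_opp (f : C -> C) (z a : C) :
  is_Cderive f z a -> is_Cderive (fun w => - f w) z (- a).
Proof. exact (@is_derive_opp C_AbsRing C_NormedModule f z a). Qed.

Lemma is_Cderive_minus (f g : C -> C) (z a b : C) :
  is_Cderive f z a -> is_Cderive g z b -> is_Cderive (fun w => f w - g w) z (a - b).
Proof. exact (@is_derive_minus C_AbsRing C_NormedModule f g z a b). Qed.

Lemma is_Cderive_sub_const (c z : C) : is_Cderive (fun w => w - c) z 1.
Proof.
  replace (RtoC 1) with (1 - 0) by ring.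
  apply is_Cderive_minus; [apply is_Cderive_id|apply is_Cderive_const].
Qed.

Lemma is_Cderive_mult (f g : C -> C) (z a b : C) :
  is_Cderive f z a -> is_Cderive g z b ->
  is_Cderive (fun w => f w * g w) z (a * g z + f z * b).
Proof.
  rewrite !is_Cderive_AbsRing.
  intros Hf Hg. exact (@is_derive_mult C_AbsRing f g z a b Hf Hg Cmult_comm).
Qed.

Lemma is_Cderive_comp (f g : C -> C) (z a b : C) :
  is_Cderive f (g z) a -> is_Cderive g z b ->
  is_Cderive (fun w => f (g w)) z (a * b).
Proof.
  rewrite (is_Cderive_AbsRing g). intros Hf Hg. rewrite Cmult_comm.
  exact (@is_derive_comp C_AbsRing C_NormedModule f g z a b Hf Hg).
Qed.

Lemma is_Cderive_eq (f : C -> C) (z a b : C) :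
  is_Cderive f z a -> a = b -> is_Cderive f z b.
Proof. intros H E; rewrite <- E; exact H. Qed.

Lemma is_Cderive_scal (c : C) (f : C -> C) (z a : C) :
  is_Cderive f z a -> is_Cderive (fun w => c * f w) z (c * a).
Proof.
  intros H. eapply is_Cderive_eq.
  - apply is_Cderive_mult; [apply is_Cderive_const|exact H].
  - cbv beta; ring.
Qed.

Lemma is_Cderive_pow (f : C -> C) (n : nat) (z a : C) :
  is_Cderive f z a ->
  is_Cderive (fun w => f w ^ S n) z (RtoC (INR (S n)) * f z ^ n * a).
Proof.
  intros H. induction n as [|n IH].
  - eapply is_Cderive_eq.
    + apply is_Cderive_mult; [exact H|apply is_Cderive_const].
    + simpl; ring.
  - eapply is_Cderive_eq.
    + apply (is_Cderive_mult _ _ _ _ _ H IH).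
    + rewrite (S_INR (S n)), RtoC_plus. simpl Cpow; ring.
Qed.

Lemma is_Cderive_sqr (f : C -> C) (z a : C) :
  is_Cderive f z a -> is_Cderive (fun w => f w ^ 2) z (2 * f z * a).
Proof.
  intros H. eapply is_Cderive_eq; [exact (is_Cderive_pow f 1 z a H)|].
  replace (INR 2) with 2%R by (simpl; ring). simpl; ring.
Qed.

Lemma Cmod_center (p : C) : Cmod (p - p) = 0%R.
Proof. replace (p - p) with (RtoC 0) by ring. apply Cmod_0. Qed.

Lemma is_Cderive_ext_loc (f g : C -> C) (z a : C) (e : R) :
  (0 < e)%R -> (forall w, (Cmod (w - z) < e)%R -> f w = g w) ->
  is_Cderive f z a -> is_Cderive g z a.
Proof.
  intros He Hfg Hf. apply is_Cderive_iff. intros eps Heps.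
  destruct (proj1 (is_Cderive_iff f z a) Hf eps Heps) as [del [Hd K]].
  exists (Rmin del e). split; [apply Rmin_pos; assumption|].
  intros w Hw.
  rewrite <- !Hfg.
  - apply K. apply Rlt_le_trans with (1 := Hw), Rmin_l.
  - rewrite Cmod_center; exact He.
  - apply Rlt_le_trans with (1 := Hw), Rmin_r.
Qed.

(** Phrased through [Cmod], so that it does not depend on which uniformity of [C] is meant. *)
Definition Ccont (f : C -> C) (z : C) : Prop :=
  forall eps, (0 < eps)%R -> exists del, (0 < del)%R /\
    forall w, (Cmod (w - z) < del)%R -> (Cmod (f w - f z) < eps)%R.

Lemma Cmod_minus_sym (a b : C) : Cmod (a - b) = Cmod (b - a).
Proof. rewrite <- Cmod_opp. f_equal; ring. Qed.

Lemma Cmod_minus_triangle (a b c : C) : (Cmod (a - c) <= Cmod (a - b) + Cmod (b - c))%R.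
Proof.
  replace (a - c) with ((a - b) + (b - c)) by ring. apply Cmod_triangle.
Qed.

Lemma Cmod_triangle_inv (a b : C) : (Cmod a - Cmod b <= Cmod (a - b))%R.
Proof.
  assert (H := Cmod_triangle (a - b) b). replace (a - b + b) with a in H by ring. lra.
Qed.

Lemma is_Cderive_lipschitz (f : C -> C) (z d : C) :
  is_Cderive f z d -> exists del, (0 < del)%R /\
    forall w, (Cmod (w - z) < del)%R ->
      (Cmod (f w - f z) <= (Cmod d + 1) * Cmod (w - z))%R.
Proof.
  intros H. destruct (proj1 (is_Cderive_iff f z d) H 1%R Rlt_0_1) as [del [Hd K]].
  exists del; split; [exact Hd|]. intros w Hw. specialize (K w Hw).
  replace (f w - f z) with ((f w - f z - d * (w - z)) + d * (w - z)) by ring.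
  eapply Rle_trans; [apply Cmod_triangle|]. rewrite Cmod_mult. lra.
Qed.

Lemma is_Cderive_Ccont (f : C -> C) (z d : C) : is_Cderive f z d -> Ccont f z.
Proof.
  intros H eps Heps. destruct (is_Cderive_lipschitz f z d H) as [del [Hd K]].
  assert (Hm := Cmod_ge_0 d).
  exists (Rmin del (eps / (Cmod d + 1))). split.
  - apply Rmin_pos; [exact Hd|]. apply Rdiv_lt_0_compat; lra.
  - intros w Hw. eapply Rle_lt_trans.
    + apply K. eapply Rlt_le_trans; [exact Hw|apply Rmin_l].
    + assert (H1 : (Cmod (w - z) < eps / (Cmod d + 1))%R)
        by (eapply Rlt_le_trans; [exact Hw|apply Rmin_r]).
      apply Rlt_div_r in H1; lra.
Qed.

Lemma Cdiff_Ccont (f : C -> C) (z : C) : Cdiff f z -> Ccont f z.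
Proof. intros [d H]; exact (is_Cderive_Ccont f z d H). Qed.

Lemma Ccont_neq_0 (f : C -> C) (z : C) : Ccont f z -> f z <> 0 ->
  exists del, (0 < del)%R /\
    forall w, (Cmod (w - z) < del)%R -> (Cmod (f z) / 2 < Cmod (f w))%R /\ f w <> 0.
Proof.
  intros H Hz. apply Cmod_gt_0 in Hz.
  destruct (H (Cmod (f z) / 2)%R) as [del [Hd K]]; [lra|].
  exists del; split; [exact Hd|]. intros w Hw. specialize (K w Hw).
  rewrite Cmod_minus_sym in K. assert (H1 := Cmod_triangle_inv (f z) (f w)).
  split; [lra|]. apply Cmod_gt_0. lra.
Qed.

Lemma is_Cderive_inv (f : C -> C) (z a : C) :
  is_Cderive f z a -> f z <> 0 -> is_Cderive (fun w => / f w) z (- a / f z ^ 2).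
Proof.
  intros Hf Hz.
  (* By the chain rule only the inversion map at the point [f z] remains. *)
  enough (K : is_Cderive Cinv (f z) (- (1) / f z ^ 2)).
  { eapply is_Cderive_eq; [exact (is_Cderive_comp Cinv f z _ _ K Hf)|].
    field. exact Hz. }
  set (y := f z) in *. clearbody y. clear Hf.
  assert (Hy := proj1 (Cmod_gt_0 y) Hz).
  apply is_Cderive_iff. intros eps Heps.
  assert (Hc : (0 < eps * Cmod y ^ 3 / 2)%R).
  { apply Rdiv_lt_0_compat; [|lra]. apply Rmult_lt_0_compat; [exact Heps|].
    apply pow_lt; exact Hy. }
  (* The first bound keeps [Cmod w] above [Cmod y / 2]; the second then makes the factor
     [(w - y) / (w * y ^ 2)] of the remainder at most [eps]. *)
  exists (Rmin (Cmod y / 2) (eps * Cmod y ^ 3 / 2)). split.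
  { apply Rmin_pos; [lra|exact Hc]. }
  intros w Hw.
  assert (H1 := Rlt_le_trans _ _ _ Hw (Rmin_l _ _)).
  assert (H2 := Rlt_le_trans _ _ _ Hw (Rmin_r _ _)).
  assert (H3 : (Cmod y / 2 < Cmod w)%R).
  { rewrite Cmod_minus_sym in H1. assert (H3 := Cmod_triangle_inv y w). lra. }
  assert (Hw0 : w <> 0) by (apply Cmod_gt_0; lra).
  replace (/ w - / y - - (1) / y ^ 2 * (w - y)) with ((w - y) * ((w - y) / (w * y ^ 2)))
    by (field; split; assumption).
  rewrite Cmod_mult, Rmult_comm. apply Rmult_le_compat_r; [apply Cmod_ge_0|].
  rewrite Cmod_div by (apply Cmult_neq_0; [assumption|apply Cpow_nz; assumption]).
  rewrite Cmod_mult, Cmod_pow.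
  assert (Hyy : (0 < Cmod y ^ 2)%R) by (apply pow_lt; exact Hy).
  apply Rle_div_l.
  - apply Rmult_lt_0_compat; lra.
  - apply Rle_trans with (eps * (Cmod y / 2 * Cmod y ^ 2))%R.
    + replace (eps * (Cmod y / 2 * Cmod y ^ 2))%R with (eps * Cmod y ^ 3 / 2)%R by field. lra.
    + apply Rmult_le_compat_l; [lra|]. apply Rmult_le_compat_r; lra.
Qed.

Lemma is_Cderive_div (f g : C -> C) (z a b : C) :
  is_Cderive f z a -> is_Cderive g z b -> g z <> 0 ->
  is_Cderive (fun w => f w / g w) z ((a * g z - f z * b) / g z ^ 2).
Proof.
  intros Hf Hg Hz. eapply is_Cderive_eq.
  - apply (is_Cderive_mult f (fun w => / g w)); [exact Hf|].
    apply is_Cderive_inv; eassumption.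
  - field. exact Hz.
Qed.

Lemma is_Cderive_unique (f : C -> C) (z a b : C) :
  is_Cderive f z a -> is_Cderive f z b -> a = b.
Proof.
  intros Ha Hb. apply is_C_derive_unique in Ha. apply is_C_derive_unique in Hb.
  congruence.
Qed.

Lemma Cdiff_const (c z : C) : Cdiff (fun _ => c) z.
Proof. exists (RtoC 0); apply is_Cderive_const. Qed.

Lemma Cdiff_id (z : C) : Cdiff (fun w => w) z.
Proof. exists (RtoC 1); apply is_Cderive_id. Qed.

Lemma Cdiff_plus (f g : C -> C) (z : C) : Cdiff f z -> Cdiff g z -> Cdiff (fun w => f w + g w) z.
Proof. intros [a Ha] [b Hb]. eexists; apply is_Cderive_plus; eassumption. Qed.

Lemma Cdiff_minus (f g : C -> C) (z : C) : Cdiff f z -> Cdiff g z -> Cdiff (fun w => f w - g w) z.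
Proof. intros [a Ha] [b Hb]. eexists; apply is_Cderive_minus; eassumption. Qed.

Lemma Cdiff_sub_const (c z : C) : Cdiff (fun w => w - c) z.
Proof. apply Cdiff_minus; [apply Cdiff_id|apply Cdiff_const]. Qed.

Lemma Cdiff_mult (f g : C -> C) (z : C) : Cdiff f z -> Cdiff g z -> Cdiff (fun w => f w * g w) z.
Proof. intros [a Ha] [b Hb]. eexists; apply is_Cderive_mult; eassumption. Qed.

Lemma Cdiff_div (f g : C -> C) (z : C) :
  Cdiff f z -> Cdiff g z -> g z <> 0 -> Cdiff (fun w => f w / g w) z.
Proof. intros [a Ha] [b Hb] Hz. eexists; apply is_Cderive_div; eassumption. Qed.

Lemma Cdiff_pow (f : C -> C) (n : nat) (z : C) : Cdiff f z -> Cdiff (fun w => f w ^ n) z.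
Proof.
  intros Hf. induction n as [|n IH]; simpl.
  - apply Cdiff_const.
  - apply (Cdiff_mult f (fun w => f w ^ n)); assumption.
Qed.

Lemma Cdiff_comp (f g : C -> C) (z : C) :
  Cdiff f (g z) -> Cdiff g z -> Cdiff (fun w => f (g w)) z.
Proof. intros [a Ha] [b Hb]. eexists; apply is_Cderive_comp; eassumption. Qed.

Lemma Cdiff_ext_loc (f g : C -> C) (z : C) (e : R) :
  (0 < e)%R -> (forall w, (Cmod (w - z) < e)%R -> f w = g w) -> Cdiff f z -> Cdiff g z.
Proof. intros He H [a Ha]. exists a. eapply is_Cderive_ext_loc; eassumption. Qed.

(** * Complex series *)

Lemma Re_plus (a b : C) : Re (a + b) = (Re a + Re b)%R.
Proof. reflexivity. Qed.

Lemma C_eq (a b : C) : Re a = Re b -> Im a = Im b -> a = b.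
Proof. destruct a, b; simpl; intros; congruence. Qed.

Lemma im_le_Cmod (c : C) : (Rabs (Im c) <= Cmod c)%R.
Proof. eapply Rle_trans; [apply Rmax_r|apply (Rmax_Cmod c)]. Qed.

Lemma Cmod_le_Re_Im (c : C) : (Cmod c <= Rabs (Re c) + Rabs (Im c))%R.
Proof.
  replace c with (RtoC (Re c) + Ci * RtoC (Im c)) at 1
    by (apply C_eq; simpl; ring).
  eapply Rle_trans; [apply Cmod_triangle|].
  rewrite Cmod_mult, Cmod_Ci, !Cmod_R. lra.
Qed.

(** The test value is [Cconj v], for which the product is the real number |v|^2. The lemma turns the
    estimate of a complex series or integral into estimates of real ones, without the loss of
    bounding the two components separately. *)
Lemma Cmod_le_of_Re (v : C) (M : R) :
  (forall c, Re (c * v) <= Cmod c * M)%R -> (Cmod v <= M)%R.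
Proof.
  intros H. destruct (Req_dec (Cmod v) 0) as [E|E].
  - rewrite E. specialize (H 1). rewrite (Cmod_eq_0 v E), Cmod_1, Cmult_0_r, re_RtoC in H. lra.
  - assert (Hv := Cmod_ge_0 v). specialize (H (Cconj v)). rewrite Cmod_conj in H.
    replace (Re (Cconj v * v)) with (Cmod v * Cmod v)%R in H.
    + apply Rmult_le_reg_l with (Cmod v); lra.
    + assert (K := Cmod2_alt v). unfold Re, Im in *; simpl in *. lra.
Qed.

Lemma Re_le_Cmod (c : C) : (Re c <= Cmod c)%R.
Proof. eapply Rle_trans; [apply Rle_abs|apply re_le_Cmod]. Qed.

Definition Csummable (a : nat -> C) : Prop := ex_series (fun n => Cmod (a n)).

Lemma ex_series_dominated (a b : nat -> R) :
  (forall n, Rabs (a n) <= b n)%R -> ex_series b -> ex_series a.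
Proof. intros H. apply (@ex_series_le R_AbsRing R_CompleteNormedModule). exact H. Qed.

Lemma Csummable_Re (a : nat -> C) : Csummable a -> ex_series (fun n => Re (a n)).
Proof. apply ex_series_dominated. intro n; apply re_le_Cmod. Qed.

Lemma Csummable_Im (a : nat -> C) : Csummable a -> ex_series (fun n => Im (a n)).
Proof. apply ex_series_dominated. intro n; apply im_le_Cmod. Qed.

Lemma Csummable_le (a : nat -> C) (b : nat -> R) :
  (forall n, Cmod (a n) <= b n)%R -> ex_series b -> Csummable a.
Proof.
  intros H. apply ex_series_dominated. intro n.
  rewrite Rabs_pos_eq by apply Cmod_ge_0. apply H.
Qed.

Lemma Csummable_ext (a b : nat -> C) : (forall n, a n = b n) -> Csummable a -> Csummable b.
Proof. intros H. apply ex_series_ext. intro n. rewrite H. reflexivity. Qed.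

Lemma Csummable_scal (c : C) (a : nat -> C) : Csummable a -> Csummable (fun n => c * a n).
Proof.
  intros H. apply Csummable_le with (fun n => Cmod c * Cmod (a n))%R.
  - intro n. rewrite Cmod_mult. apply Rle_refl.
  - exact (@ex_series_scal_l R_AbsRing R_NormedModule (Cmod c) _ H).
Qed.

Lemma Csummable_plus (a b : nat -> C) :
  Csummable a -> Csummable b -> Csummable (fun n => a n + b n).
Proof.
  intros Ha Hb. apply Csummable_le with (fun n => Cmod (a n) + Cmod (b n))%R.
  - intro n. apply Cmod_triangle.
  - exact (@ex_series_plus R_AbsRing R_NormedModule _ _ Ha Hb).
Qed.

Lemma Csummable_S (a : nat -> C) : Csummable a <-> Csummable (fun n => a (S n)).
Proof. exact (@ex_series_incr_1 R_AbsRing R_NormedModule (fun n => Cmod (a n))). Qed.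

Lemma Cseries_ext (a b : nat -> C) : (forall n, a n = b n) -> Cseries a = Cseries b.
Proof. intros H. apply C_eq; simpl; apply Series_ext; intro n; rewrite H; reflexivity. Qed.

Lemma Cseries_plus (a b : nat -> C) : Csummable a -> Csummable b ->
  Cseries (fun n => a n + b n) = Cseries a + Cseries b.
Proof.
  intros Ha Hb.
  apply C_eq; simpl; rewrite <- Series_plus; auto using Csummable_Re, Csummable_Im.
Qed.

Lemma Cseries_scal (c : C) (a : nat -> C) : Csummable a ->
  Cseries (fun n => c * a n) = c * Cseries a.
Proof.
  intros Ha. assert (H1 := Csummable_Re _ Ha). assert (H2 := Csummable_Im _ Ha).
  assert (K : forall x b, ex_series b -> ex_series (fun n => x * b n)%R)
    by (intros x b; exact (@ex_series_scal_l R_AbsRing R_NormedModule x b)).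
  apply C_eq; simpl.
  - rewrite <- !Series_scal_l, <- Series_minus by (apply K; assumption). reflexivity.
  - rewrite <- !Series_scal_l, <- Series_plus by (apply K; assumption). reflexivity.
Qed.

Lemma Cseries_minus (a b : nat -> C) : Csummable a -> Csummable b ->
  Cseries (fun n => a n - b n) = Cseries a - Cseries b.
Proof.
  intros Ha Hb.
  rewrite (Cseries_ext _ (fun n => a n + (- (1)) * b n)) by (intro n; ring).
  rewrite Cseries_plus by (try apply Csummable_scal; assumption).
  rewrite Cseries_scal by assumption. ring.
Qed.

Lemma Cseries_S (a : nat -> C) : Csummable a -> Cseries a = a O + Cseries (fun n => a (S n)).
Proof.
  intros Ha. apply C_eq; simpl; rewrite Series_incr_1; auto using Csummable_Re, Csummable_Im.
Qed.

(** By [Cmod_le_of_Re] it is enough to bound the real series of [Re (c * a n)], whose terms are at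
    most [Cmod c * b n]. *)
Lemma Cmod_Cseries_le (a : nat -> C) (b : nat -> R) :
  (forall n, Cmod (a n) <= b n)%R -> ex_series b -> (Cmod (Cseries a) <= Series b)%R.
Proof.
  intros H Hb. assert (Ha := Csummable_le a b H Hb).
  apply Cmod_le_of_Re. intro c. rewrite <- Cseries_scal by assumption. simpl.
  rewrite <- Series_scal_l.
  eapply Rle_trans; [apply Rle_abs|].
  eapply Rle_trans; [apply Series_Rabs|apply Series_le].
  - apply ex_series_dominated with (fun n => Cmod c * b n)%R.
    + intro n. rewrite Rabs_Rabsolu. eapply Rle_trans; [exact (re_le_Cmod (c * a n))|].
      rewrite Cmod_mult. apply Rmult_le_compat_l; [apply Cmod_ge_0|apply H].
    + exact (@ex_series_scal_l R_AbsRing R_NormedModule (Cmod c) _ Hb).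
  - intro n. split; [apply Rabs_pos|].
    eapply Rle_trans; [exact (re_le_Cmod (c * a n))|].
    rewrite Cmod_mult. apply Rmult_le_compat_l; [apply Cmod_ge_0|apply H].
  - exact (@ex_series_scal_l R_AbsRing R_NormedModule (Cmod c) _ Hb).
Qed.

(** * Complex power series and their termwise derivative *)

Definition Cpseries (a : nat -> C) (z : C) : C := Cseries (fun n => a n * z ^ n).

(** The radius depends only on the moduli of the coefficients, so the real theory can be reused. *)
Definition Cradius (a : nat -> C) : Rbar := CV_radius (fun n => Cmod (a n)).

Definition Cpderiv (a : nat -> C) (n : nat) : C := RtoC (INR (S n)) * a (S n).

Lemma Cmod_Cpderiv (a : nat -> C) (n : nat) :
  Cmod (Cpderiv a n) = PS_derive (fun n => Cmod (a n)) n.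
Proof.
  unfold Cpderiv, PS_derive. rewrite Cmod_mult, Cmod_R, Rabs_pos_eq; [reflexivity|apply pos_INR].
Qed.

Lemma Cradius_Cpderiv (a : nat -> C) : Cradius (Cpderiv a) = Cradius a.
Proof.
  unfold Cradius. rewrite (CV_radius_ext _ _ (Cmod_Cpderiv a)). apply CV_radius_derive.
Qed.

Lemma Cradius_bound (a : nat -> C) (r M : R) :
  (0 <= r)%R -> (forall n, Cmod (a n) * r ^ n <= M)%R -> Rbar_le r (Cradius a).
Proof.
  intros Hr H. apply (proj1 (CV_radius_bounded (fun n => Cmod (a n)))).
  exists M. intro n. rewrite Rabs_pos_eq; [apply H|].
  apply Rmult_le_pos; [apply Cmod_ge_0|apply pow_le; exact Hr].
Qed.

Lemma ex_series_Cradius (a : nat -> C) (r : R) :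
  (0 <= r)%R -> Rbar_lt r (Cradius a) -> ex_series (fun n => Cmod (a n) * r ^ n)%R.
Proof.
  intros Hr H. assert (K := CV_disk_inside (fun n => Cmod (a n)) r).
  rewrite (Rabs_pos_eq r Hr) in K. specialize (K H).
  revert K. apply ex_series_dominated. intro n. apply Rle_refl.
Qed.

Lemma Csummable_Cradius (a : nat -> C) (z : C) :
  Rbar_lt (Cmod z) (Cradius a) -> Csummable (fun n => a n * z ^ n).
Proof.
  intros H. apply Csummable_le with (fun n => Cmod (a n) * Cmod z ^ n)%R.
  - intro n. rewrite Cmod_mult, Cmod_pow. apply Rle_refl.
  - apply ex_series_Cradius; [apply Cmod_ge_0|exact H].
Qed.

(** Induction: the remainder for exponent m + 1 is [w] times the one for m plus m z^(m-1) (w - z)^2.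
    The factor [INR (S n) * INR (S (S n))] is the one produced by two formal differentiations, so
    the bounds sum to a series with a known radius. *)
Lemma Cpow_taylor_remainder (w z : C) (rho : R) (n : nat) :
  (0 <= rho)%R -> (Cmod w <= rho)%R -> (Cmod z <= rho)%R ->
  (Cmod (w ^ S (S n) - z ^ S (S n) - RtoC (INR (S (S n))) * z ^ S n * (w - z))
    <= INR (S n) * INR (S (S n)) * rho ^ n * Cmod (w - z) ^ 2)%R.
Proof.
  intros Hr Hw Hz. induction n as [|n IH].
  - replace (w ^ 2 - z ^ 2 - RtoC (INR 2) * z ^ 1 * (w - z)) with ((w - z) ^ 2).
    + rewrite Cmod_pow. simpl INR. assert (K := pow2_ge_0 (Cmod (w - z))). simpl in *. lra.
    + replace (INR 2) with 2%R by (simpl; ring). simpl; ring.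
  - set (m := S (S n)) in *.
    replace (w ^ S m - z ^ S m - RtoC (INR (S m)) * z ^ m * (w - z))
      with (w * (w ^ m - z ^ m - RtoC (INR m) * z ^ S n * (w - z))
            + RtoC (INR m) * z ^ S n * (w - z) ^ 2).
    + eapply Rle_trans; [apply Cmod_triangle|].
      rewrite !Cmod_mult, Cmod_R, !Cmod_pow, Rabs_pos_eq by apply pos_INR.
      set (D := (Cmod (w - z) ^ 2)%R) in *.
      assert (HD : (0 <= D)%R) by apply pow2_ge_0.
      assert (H1 : (Cmod w * Cmod (w ^ m - z ^ m - RtoC (INR m) * z ^ S n * (w - z))
               <= rho * (INR (S n) * INR m * rho ^ n * D))%R)
        by (apply Rmult_le_compat; auto using Cmod_ge_0).
      assert (H2 : (INR m * Cmod z ^ S n * D <= INR m * rho ^ S n * D)%R).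
      { apply Rmult_le_compat_r; [exact HD|]. apply Rmult_le_compat_l; [apply pos_INR|].
        apply pow_incr; split; [apply Cmod_ge_0|exact Hz]. }
      assert (H3 : (0 <= INR m * rho ^ S n * D)%R).
      { apply Rmult_le_pos; [|exact HD]. apply Rmult_le_pos; [apply pos_INR|].
        apply pow_le; exact Hr. }
      rewrite (S_INR m). unfold m in *. rewrite (S_INR (S n)) in *. simpl pow in *. nra.
    + rewrite (S_INR m), RtoC_plus. unfold m. simpl; ring.
Qed.

Lemma is_Cderive_Cpseries (a : nat -> C) (z : C) :
  Rbar_lt (Cmod z) (Cradius a) -> is_Cderive (Cpseries a) z (Cpseries (Cpderiv a) z).
Proof.
  intros Hz.
  (* Every [w] close to [z] stays below [rho], where the series of second derivatives still
     converges absolutely. *)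
  assert (Hrho : exists rho, (Cmod z < rho)%R /\ Rbar_lt rho (Cradius a)).
  { destruct (Cradius a) as [r| |]; simpl in Hz.
    - exists ((Cmod z + r) / 2)%R; simpl; lra.
    - exists (Cmod z + 1)%R; simpl; split; [lra|exact I].
    - contradiction. }
  destruct Hrho as [rho [Hzr Hr]].
  assert (Hr0 : (0 <= rho)%R) by (assert (H := Cmod_ge_0 z); lra).
  set (b n := (INR (S n) * INR (S (S n)) * Cmod (a (S (S n))) * rho ^ n)%R).
  assert (Hb : ex_series b).
  { assert (K := ex_series_Cradius (Cpderiv (Cpderiv a)) rho Hr0).
    rewrite !Cradius_Cpderiv in K. specialize (K Hr).
    revert K. apply ex_series_ext. intro n. rewrite Cmod_Cpderiv. unfold PS_derive.
    rewrite Cmod_Cpderiv. unfold PS_derive, b.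
    match goal with |- ?x = ?y => change (@eq R x y) end. ring. }
  assert (Hb0 : (0 <= Series b)%R).
  { eapply Rle_trans; [apply (Cmod_ge_0 (Cseries (fun n => RtoC (b n))))|].
    apply Cmod_Cseries_le; [|exact Hb]. intro n. rewrite Cmod_R, Rabs_pos_eq; [lra|].
    unfold b. repeat apply Rmult_le_pos; auto using pos_INR, Cmod_ge_0, pow_le. }
  apply is_Cderive_iff. intros eps Heps.
  exists (Rmin (rho - Cmod z) (eps / (Series b + 1))). split.
  { apply Rmin_pos; [lra|]. apply Rdiv_lt_0_compat; lra. }
  intros w Hw.
  assert (H1 := Rlt_le_trans _ _ _ Hw (Rmin_l _ _)).
  assert (H2 := Rlt_le_trans _ _ _ Hw (Rmin_r _ _)).
  assert (Hwr : (Cmod w < rho)%R) by (assert (K := Cmod_triangle_inv w z); lra).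
  assert (HwR : Rbar_lt (Cmod w) (Cradius a))
    by (apply Rbar_lt_trans with (2 := Hr); exact Hwr).
  assert (Sw := Csummable_Cradius a w HwR).
  assert (Sz := Csummable_Cradius a z Hz).
  assert (Sd : Csummable (fun n => Cpderiv a n * z ^ n))
    by (apply Csummable_Cradius; rewrite Cradius_Cpderiv; exact Hz).
  (* The terms of degree 0 and 1 cancel; the error starts at degree 2 and is quadratic in
     [w - z]. *)
  assert (E : Cpseries a w - Cpseries a z - Cpseries (Cpderiv a) z * (w - z) =
    Cseries (fun n => a (S (S n)) * (w ^ S (S n) - z ^ S (S n)
       - RtoC (INR (S (S n))) * z ^ S n * (w - z)))).
  { unfold Cpseries. rewrite (Cseries_S _ Sw), (Cseries_S _ Sz), (Cseries_S _ Sd).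
    apply Csummable_S in Sw; apply Csummable_S in Sz; apply Csummable_S in Sd.
    rewrite (Cseries_S _ Sw), (Cseries_S _ Sz).
    apply Csummable_S in Sw; apply Csummable_S in Sz.
    rewrite (Cseries_ext (fun n => a (S (S n)) * (w ^ S (S n) - z ^ S (S n)
        - RtoC (INR (S (S n))) * z ^ S n * (w - z)))
      (fun n => (a (S (S n)) * w ^ S (S n) - a (S (S n)) * z ^ S (S n))
         + - (w - z) * (Cpderiv a (S n) * z ^ S n)))
      by (intro n; unfold Cpderiv; ring).
    assert (Sd' := Csummable_scal (- (w - z)) _ Sd).
    assert (Sz' := Csummable_scal (- (1)) _ Sz). cbv beta in Sd', Sz'.
    rewrite Cseries_plus; [|apply Csummable_ext with
      (2 := Csummable_plus _ _ Sw Sz'); intro n; simpl; ring|exact Sd'].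
    rewrite Cseries_scal by exact Sd. rewrite Cseries_minus by assumption.
    unfold Cpderiv. simpl. ring. }
  rewrite E.
  apply Rle_trans with (Series (fun n => Cmod (w - z) ^ 2 * b n)%R).
  - apply Cmod_Cseries_le.
    + intro n. rewrite Cmod_mult.
      apply Rle_trans with (Cmod (a (S (S n))) *
        (INR (S n) * INR (S (S n)) * rho ^ n * Cmod (w - z) ^ 2))%R.
      * apply Rmult_le_compat_l; [apply Cmod_ge_0|].
        apply Cpow_taylor_remainder; lra.
      * unfold b. apply Req_le; ring.
    + exact (@ex_series_scal_l R_AbsRing R_NormedModule _ _ Hb).
  - rewrite Series_scal_l. assert (Hm := Cmod_ge_0 (w - z)).
    apply Rlt_div_r in H2; [|lra].
    simpl. nra.
Qed.

Lemma Cpseries_0 (a : nat -> C) : Cpseries a 0 = a O.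
Proof.
  assert (K : Csummable (fun n => a n * 0 ^ n)).
  { apply Csummable_S. apply Csummable_le with (fun n : nat => 0%R).
    - intro n. simpl. rewrite Cmult_0_l, Cmult_0_r, Cmod_0. lra.
    - exists 0%R. apply is_series_ext with (fun n => scal 0 1)%R.
      + intro n. apply (@scal_zero_l R_AbsRing R_NormedModule).
      + unfold is_series. apply filterlim_ext with (fun _ : nat => 0%R).
        * intro n. symmetry. rewrite sum_n_const. rewrite (@scal_zero_l R_AbsRing R_NormedModule).
          unfold zero; simpl; ring.
        * apply filterlim_const. }
  unfold Cpseries. rewrite (Cseries_S _ K).
  rewrite (Cseries_ext _ (fun n => 0 * (a (S n) * 0 ^ S n))) by (intro n; simpl; ring).
  rewrite Cseries_scal by exact (proj1 (Csummable_S _) K). simpl; ring.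
Qed.

(** * Path integrals *)

Lemma is_derive_R_iff (h : R -> R) (t l : R) :
  is_derive h t l <->
  forall eps, (0 < eps)%R -> exists del, (0 < del)%R /\
    forall s, (Rabs (s - t) < del)%R ->
      (Rabs (h s - h t - (s - t) * l) <= eps * Rabs (s - t))%R.
Proof.
  split.
  - intros [_ H] eps Heps.
    destruct (H t (fun P HP => HP) (mkposreal eps Heps)) as [del Hd].
    exists del; split; [apply cond_pos|]. exact Hd.
  - intros H; split.
    + apply is_linear_scal_l.
    + intros x Hx eps.
      assert (E : t = x) by exact (is_filter_lim_locally_unique t x Hx).
      subst x.
      destruct (H eps (cond_pos eps)) as [del [Hd K]].
      exists (mkposreal del Hd). exact K.
Qed.

(** Componentwise, so that the real fundamental theorem of calculus applies to each part;
    [Pderive_iff] recovers the form with [Cmod]. *)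
Definition Pderive (g : R -> C) (t : R) (d : C) : Prop :=
  is_derive (fun s => Re (g s)) t (Re d) /\ is_derive (fun s => Im (g s)) t (Im d).

Lemma Pderive_iff (g : R -> C) (t : R) (d : C) :
  Pderive g t d <->
  forall eps, (0 < eps)%R -> exists del, (0 < del)%R /\
    forall s, (Rabs (s - t) < del)%R ->
      (Cmod (g s - g t - RtoC (s - t) * d) <= eps * Rabs (s - t))%R.
Proof.
  assert (E1 : forall s, Re (g s - g t - RtoC (s - t) * d)
            = (Re (g s) - Re (g t) - (s - t) * Re d)%R) by (intro; unfold Re, Im; simpl; ring).
  assert (E2 : forall s, Im (g s - g t - RtoC (s - t) * d)
            = (Im (g s) - Im (g t) - (s - t) * Im d)%R) by (intro; unfold Re, Im; simpl; ring).
  split.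
  - intros [H1 H2] eps Heps. rewrite is_derive_R_iff in H1, H2.
    destruct (H1 (eps / 2)%R) as [d1 [Hd1 K1]]; [lra|].
    destruct (H2 (eps / 2)%R) as [d2 [Hd2 K2]]; [lra|].
    exists (Rmin d1 d2); split; [apply Rmin_pos; assumption|]. intros s Hs.
    specialize (K1 s (Rlt_le_trans _ _ _ Hs (Rmin_l _ _))).
    specialize (K2 s (Rlt_le_trans _ _ _ Hs (Rmin_r _ _))).
    eapply Rle_trans; [apply Cmod_le_Re_Im|]. rewrite E1, E2. lra.
  - intros H. split; apply is_derive_R_iff; intros eps Heps;
      destruct (H eps Heps) as [del [Hd K]]; exists del; (split; [exact Hd|]);
      intros s Hs; specialize (K s Hs).
    + rewrite <- E1. eapply Rle_trans; [apply re_le_Cmod|exact K].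
    + rewrite <- E2. eapply Rle_trans; [apply im_le_Cmod|exact K].
Qed.

Lemma Pderive_lipschitz (g : R -> C) (t : R) (d : C) : Pderive g t d ->
  exists del, (0 < del)%R /\ forall s, (Rabs (s - t) < del)%R ->
    (Cmod (g s - g t) <= (Cmod d + 1) * Rabs (s - t))%R.
Proof.
  intros H. destruct (proj1 (Pderive_iff g t d) H 1%R Rlt_0_1) as [del [Hd K]].
  exists del; split; [exact Hd|]. intros s Hs. specialize (K s Hs).
  replace (g s - g t) with ((g s - g t - RtoC (s - t) * d) + RtoC (s - t) * d) by ring.
  eapply Rle_trans; [apply Cmod_triangle|]. rewrite Cmod_mult, Cmod_R. lra.
Qed.

Lemma Pderive_comp (f : C -> C) (g : R -> C) (t : R) (d e : C) :
  is_Cderive f (g t) e -> Pderive g t d -> Pderive (fun s => f (g s)) t (e * d).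
Proof.
  intros Hf Hg. apply Pderive_iff. intros eps Heps.
  destruct (Pderive_lipschitz g t d Hg) as [d1 [Hd1 K1]].
  assert (Md := Cmod_ge_0 d). assert (Me := Cmod_ge_0 e).
  (* The error of the composite is the error of [f] at [g s] plus [e] times the error of [g]. Each
     receives [eps / 2]; the added 1 avoids a division by zero. *)
  destruct (proj1 (is_Cderive_iff _ _ _) Hf (eps / 2 / (Cmod d + 1))%R)
    as [d2 [Hd2 K2]]; [repeat apply Rdiv_lt_0_compat; lra|].
  destruct (proj1 (Pderive_iff _ _ _) Hg (eps / 2 / (Cmod e + 1))%R)
    as [d3 [Hd3 K3]]; [repeat apply Rdiv_lt_0_compat; lra|].
  exists (Rmin (Rmin d1 d3) (d2 / (Cmod d + 1))). split.
  { repeat apply Rmin_pos; try assumption. apply Rdiv_lt_0_compat; lra. }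
  intros s Hs.
  assert (H1 := Rlt_le_trans _ _ _ Hs (Rle_trans _ _ _ (Rmin_l _ _) (Rmin_l _ _))).
  assert (H3 := Rlt_le_trans _ _ _ Hs (Rle_trans _ _ _ (Rmin_l _ _) (Rmin_r _ _))).
  assert (H2 := Rlt_le_trans _ _ _ Hs (Rmin_r _ _)).
  specialize (K1 s H1). specialize (K3 s H3). assert (Ms := Rabs_pos (s - t)).
  assert (K2' : (Cmod (g s - g t) < d2)%R).
  { eapply Rle_lt_trans; [exact K1|].
    apply Rlt_div_r in H2; lra. }
  specialize (K2 _ K2').
  replace (f (g s) - f (g t) - RtoC (s - t) * (e * d))
    with ((f (g s) - f (g t) - e * (g s - g t)) + e * (g s - g t - RtoC (s - t) * d)) by ring.
  eapply Rle_trans; [apply Cmod_triangle|]. rewrite Cmod_mult.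
  assert (Q1 : (Cmod (f (g s) - f (g t) - e * (g s - g t)) <= eps / 2 * Rabs (s - t))%R).
  { eapply Rle_trans; [exact K2|].
    replace (eps / 2 * Rabs (s - t))%R
      with (eps / 2 / (Cmod d + 1) * ((Cmod d + 1) * Rabs (s - t)))%R by (field; lra).
    apply Rmult_le_compat_l; [|exact K1].
    apply Rlt_le; repeat apply Rdiv_lt_0_compat; lra. }
  assert (Q2 : (Cmod e * Cmod (g s - g t - RtoC (s - t) * d) <= eps / 2 * Rabs (s - t))%R).
  { apply Rle_trans with ((Cmod e + 1) * (eps / 2 / (Cmod e + 1) * Rabs (s - t)))%R.
    - apply Rmult_le_compat; try lra. apply Cmod_ge_0.
    - apply Req_le; field; lra. }
  lra.
Qed.

Definition Pcont (g : R -> C) (t : R) : Prop :=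
  continuous (fun s => Re (g s)) t /\ continuous (fun s => Im (g s)) t.

Lemma continuous_of_eps (h : R -> R) (t : R) :
  (forall eps, (0 < eps)%R -> exists del, (0 < del)%R /\
     forall s, (Rabs (s - t) < del)%R -> (Rabs (h s - h t) < eps)%R) -> continuous h t.
Proof.
  intros H. apply filterlim_locally. intro eps.
  destruct (H eps (cond_pos eps)) as [del [Hd K]].
  exists (mkposreal del Hd). intros s Hs. apply K. exact Hs.
Qed.

Lemma Pcont_comp (f : C -> C) (g : R -> C) (t : R) (d : C) :
  Ccont f (g t) -> Pderive g t d -> Pcont (fun s => f (g s)) t.
Proof.
  intros Hf Hg. destruct (Pderive_lipschitz g t d Hg) as [d1 [Hd1 K1]].
  assert (Md := Cmod_ge_0 d).
  assert (H : forall eps, (0 < eps)%R -> exists del, (0 < del)%R /\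
     forall s, (Rabs (s - t) < del)%R -> (Cmod (f (g s) - f (g t)) < eps)%R).
  { intros eps Heps. destruct (Hf eps Heps) as [d2 [Hd2 K2]].
    exists (Rmin d1 (d2 / (Cmod d + 1))). split.
    { apply Rmin_pos; [exact Hd1|]. apply Rdiv_lt_0_compat; lra. }
    intros s Hs. apply K2.
    assert (H2 := Rlt_le_trans _ _ _ Hs (Rmin_r _ _)).
    eapply Rle_lt_trans; [apply K1; exact (Rlt_le_trans _ _ _ Hs (Rmin_l _ _))|].
    apply Rlt_div_r in H2; lra. }
  split; apply continuous_of_eps; intros eps Heps; destruct (H eps Heps) as [del [Hd K]];
    exists del; (split; [exact Hd|]); intros s Hs; specialize (K s Hs).
  - eapply Rle_lt_trans; [exact (re_le_Cmod (f (g s) - f (g t)))|exact K].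
  - eapply Rle_lt_trans; [exact (im_le_Cmod (f (g s) - f (g t)))|exact K].
Qed.

Lemma Pcont_const (c : C) (t : R) : Pcont (fun _ => c) t.
Proof. split; apply continuous_const. Qed.

Lemma Pcont_mult (f g : R -> C) (t : R) :
  Pcont f t -> Pcont g t -> Pcont (fun s => f s * g s) t.
Proof.
  intros [F1 F2] [G1 G2]. split.
  - apply (continuous_minus (fun s => Re (f s) * Re (g s))%R (fun s => Im (f s) * Im (g s))%R);
      apply @continuous_mult; assumption.
  - apply (continuous_plus (fun s => Re (f s) * Im (g s))%R (fun s => Im (f s) * Re (g s))%R);
      apply @continuous_mult; assumption.
Qed.

Definition CInt (g : R -> C) (a b : R) : C :=
  (RInt (fun t => Re (g t)) a b, RInt (fun t => Im (g t)) a b).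

Definition ex_CInt (g : R -> C) (a b : R) : Prop :=
  ex_RInt (fun t => Re (g t)) a b /\ ex_RInt (fun t => Im (g t)) a b.

Lemma ex_CInt_Pcont (g : R -> C) (a b : R) : (a <= b)%R ->
  (forall t, (a <= t <= b)%R -> Pcont g t) -> ex_CInt g a b.
Proof.
  intros Hab H. split; apply (ex_RInt_continuous (V := R_CompleteNormedModule));
  rewrite (Rmin_left a b Hab), (Rmax_right a b Hab); intros z Hz; apply H; exact Hz.
Qed.

Lemma CInt_ext (f g : R -> C) (a b : R) : (a <= b)%R ->
  (forall t, (a <= t <= b)%R -> f t = g t) -> CInt f a b = CInt g a b.
Proof.
  intros Hab H. apply C_eq; apply (RInt_ext (V := R_CompleteNormedModule));
  rewrite (Rmin_left a b Hab), (Rmax_right a b Hab); intros x Hx; rewrite H; (reflexivity || lra).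
Qed.

Lemma CInt_minus (f g : R -> C) (a b : R) : ex_CInt f a b -> ex_CInt g a b ->
  CInt (fun t => f t - g t) a b = CInt f a b - CInt g a b.
Proof.
  intros [F1 F2] [G1 G2]. apply C_eq.
  - exact (RInt_minus (fun t => Re (f t)) (fun t => Re (g t)) a b F1 G1).
  - exact (RInt_minus (fun t => Im (f t)) (fun t => Im (g t)) a b F2 G2).
Qed.

Lemma ex_CInt_scal (c : C) (g : R -> C) (a b : R) :
  ex_CInt g a b -> ex_CInt (fun t => c * g t) a b.
Proof.
  intros [G1 G2]. split.
  - exact (ex_RInt_minus _ _ a b (ex_RInt_scal _ a b (Re c) G1) (ex_RInt_scal _ a b (Im c) G2)).
  - exact (ex_RInt_plus _ _ a b (ex_RInt_scal _ a b (Re c) G2) (ex_RInt_scal _ a b (Im c) G1)).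
Qed.

Lemma CInt_scal (c : C) (g : R -> C) (a b : R) : ex_CInt g a b ->
  CInt (fun t => c * g t) a b = c * CInt g a b.
Proof.
  intros [G1 G2]. 
  assert (S : forall x h, ex_RInt h a b ->
    RInt (fun t => x * h t)%R a b = (x * RInt h a b)%R)
    by (intros x h Hh; exact (RInt_scal h a b x Hh)).
  apply C_eq; simpl.
  - rewrite <- !S by assumption.
    exact (RInt_minus _ _ a b (ex_RInt_scal _ a b (Re c) G1) (ex_RInt_scal _ a b (Im c) G2)).
  - rewrite <- !S by assumption.
    exact (RInt_plus _ _ a b (ex_RInt_scal _ a b (Re c) G2) (ex_RInt_scal _ a b (Im c) G1)).
Qed.

Lemma CInt_const (c : C) (a b : R) : CInt (fun _ => c) a b = RtoC (b - a) * c.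
Proof.
  apply C_eq; simpl; rewrite (RInt_const (V := R_CompleteNormedModule));
    unfold scal; simpl; unfold mult, Re, Im; simpl; ring.
Qed.

Lemma Cmod_CInt_le (g : R -> C) (a b M : R) : (a <= b)%R -> ex_CInt g a b ->
  (forall t, (a <= t <= b)%R -> Cmod (g t) <= M)%R -> (Cmod (CInt g a b) <= (b - a) * M)%R.
Proof.
  intros Hab Hg HM. apply Cmod_le_of_Re. intro c.
  rewrite <- CInt_scal by exact Hg. destruct (ex_CInt_scal c g a b Hg) as [S1 _].
  apply Rle_trans with (RInt (fun _ => Cmod c * M)%R a b).
  - apply RInt_le; [exact Hab|exact S1|apply ex_RInt_const|].
    intros x Hx. eapply Rle_trans; [exact (Re_le_Cmod (c * g x))|].
    rewrite Cmod_mult. apply Rmult_le_compat_l; [apply Cmod_ge_0|apply HM; lra].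
  - rewrite RInt_const. apply Req_le. unfold scal; simpl; unfold mult; simpl; ring.
Qed.

Lemma CInt_Chasles (g : R -> C) (a b c : R) : ex_CInt g a b -> ex_CInt g b c ->
  CInt g a b + CInt g b c = CInt g a c.
Proof.
  intros [F1 F2] [G1 G2].
  apply C_eq; apply (RInt_Chasles (V := R_CompleteNormedModule)); assumption.
Qed.

Lemma CInt_comp_lin (g : R -> C) (u v a b : R) : ex_CInt g (u * a + v)%R (u * b + v)%R ->
  CInt (fun t => RtoC u * g (u * t + v)%R) a b = CInt g (u * a + v)%R (u * b + v)%R.
Proof.
  intros [G1 G2]. apply C_eq; simpl.
  - rewrite <- (RInt_comp_lin (fun t => Re (g t))) by exact G1.
    apply (RInt_ext (V := R_CompleteNormedModule)); intros x _.
    match goal with |- ?x = ?y => change (@eq R x y) end.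
    unfold scal; simpl; unfold mult, Re, Im; simpl; ring.
  - rewrite <- (RInt_comp_lin (fun t => Im (g t))) by exact G2.
    apply (RInt_ext (V := R_CompleteNormedModule)); intros x _.
    match goal with |- ?x = ?y => change (@eq R x y) end.
    unfold scal; simpl; unfold mult, Re, Im; simpl; ring.
Qed.

Lemma CInt_derive (G g : R -> C) (a b : R) : (a <= b)%R ->
  (forall t, (a <= t <= b)%R -> Pderive G t (g t)) ->
  (forall t, (a <= t <= b)%R -> Pcont g t) -> CInt g a b = G b - G a.
Proof.
  intros Hab HG Hg.
  apply C_eq; apply is_RInt_unique.
  - apply (is_RInt_derive (V := R_CompleteNormedModule) (fun t => Re (G t)) (fun t => Re (g t)));
      rewrite (Rmin_left a b Hab), (Rmax_right a b Hab); intros x Hx;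
      [apply (HG x Hx)|apply (Hg x Hx)].
  - apply (is_RInt_derive (V := R_CompleteNormedModule) (fun t => Im (G t)) (fun t => Im (g t)));
      rewrite (Rmin_left a b Hab), (Rmax_right a b Hab); intros x Hx;
      [apply (HG x Hx)|apply (Hg x Hx)].
Qed.

(** * Segments and integrals along them *)

Definition seg (a b : C) (t : R) : C := a + RtoC t * (b - a).

Lemma Pderive_seg (a b : C) (t : R) : Pderive (seg a b) t (b - a).
Proof.
  apply Pderive_iff. intros eps Heps. exists 1%R; split; [lra|]. intros s _.
  replace (seg a b s - seg a b t - RtoC (s - t) * (b - a)) with (RtoC 0)
    by (unfold seg; rewrite RtoC_minus; ring).
  rewrite Cmod_0. apply Rmult_le_pos; [lra|apply Rabs_pos].
Qed.

(** The mean value theorem fails for complex values, so it is applied to the real function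
    [Re (c * f)] along the segment, for each [c] separately. *)
Lemma Cmod_le_of_derive (f : C -> C) (a b : C) (M : R) :
  (forall t, (0 <= t <= 1)%R ->
     exists d, is_Cderive f (seg a b t) d /\ (Cmod d <= M)%R) ->
  (Cmod (f b - f a) <= M * Cmod (b - a))%R.
Proof.
  intros H. apply Cmod_le_of_Re. intro c.
  set (h t := Re (c * f (seg a b t))).
  set (dh t := Re (c * C_derive f (seg a b t) * (b - a))).
  assert (Hd : forall t, (0 <= t <= 1)%R -> is_derive h t (dh t)).
  { intros t Ht. destruct (H t Ht) as [d [Hd _]].
    unfold dh. rewrite (is_C_derive_unique _ _ _ Hd).
    exact (proj1 (Pderive_comp (fun z => c * f z) (seg a b) t (b - a) (c * d)
      (is_Cderive_scal c f _ _ Hd) (Pderive_seg a b t))). }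
  destruct (MVT_gen h 0 1 dh) as [t [Ht E]].
  - rewrite Rmin_left, Rmax_right by lra. intros x Hx; apply Hd; lra.
  - rewrite Rmin_left, Rmax_right by lra. intros x Hx.
    apply continuity_pt_filterlim. apply @ex_derive_continuous.
    exists (dh x); apply Hd; exact Hx.
  - rewrite Rmin_left, Rmax_right in Ht by lra.
    replace (Re (c * (f b - f a))) with (h 1 - h 0)%R.
    + rewrite E. destruct (H t Ht) as [d [Hd1 Hd2]].
      unfold dh. rewrite (is_C_derive_unique _ _ _ Hd1).
      rewrite Rminus_0_r, Rmult_1_r.
      eapply Rle_trans; [apply Re_le_Cmod|]. rewrite !Cmod_mult, Rmult_assoc.
      apply Rmult_le_compat_l; [apply Cmod_ge_0|].
      apply Rmult_le_compat_r; [apply Cmod_ge_0|exact Hd2].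
    + unfold h. replace (seg a b 1) with b by (unfold seg; ring).
      replace (seg a b 0) with a by (unfold seg; ring). unfold Re, Im; simpl; ring.
Qed.

Definition SInt (f : C -> C) (a b : C) : C := (b - a) * CInt (fun t => f (seg a b t)) 0 1.

Lemma Pcont_seg (f : C -> C) (a b : C) (t : R) :
  Ccont f (seg a b t) -> Pcont (fun s => f (seg a b s)) t.
Proof. intros H. exact (Pcont_comp f (seg a b) t (b - a) H (Pderive_seg a b t)). Qed.

Lemma ex_CInt_seg (f : C -> C) (a b : C) (x y : R) : (x <= y)%R ->
  (forall t, (x <= t <= y)%R -> Ccont f (seg a b t)) ->
  ex_CInt (fun t => f (seg a b t)) x y.
Proof.
  intros Hxy H. apply ex_CInt_Pcont; [exact Hxy|]. intros t Ht.
  apply Pcont_seg. apply H; exact Ht.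
Qed.

Lemma SInt_derive (F f : C -> C) (a b : C) :
  (forall t, (0 <= t <= 1)%R -> is_Cderive F (seg a b t) (f (seg a b t))) ->
  (forall t, (0 <= t <= 1)%R -> Ccont f (seg a b t)) -> SInt f a b = F b - F a.
Proof.
  intros HF Hf. unfold SInt.
  assert (He : ex_CInt (fun t => f (seg a b t)) 0 1) by (apply ex_CInt_seg; [lra|exact Hf]).
  rewrite <- CInt_scal by exact He.
  rewrite (CInt_derive (fun t => F (seg a b t))).
  - f_equal; [f_equal; unfold seg; ring|f_equal; f_equal; unfold seg; ring].
  - lra.
  - intros t Ht. rewrite Cmult_comm. apply Pderive_comp; [apply HF; exact Ht|apply Pderive_seg].
  - intros t Ht. apply Pcont_mult; [apply Pcont_const|apply Pcont_seg; apply Hf; exact Ht].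
Qed.

Lemma Cmod_SInt_le (f : C -> C) (a b : C) (M : R) :
  (forall t, (0 <= t <= 1)%R -> Ccont f (seg a b t)) ->
  (forall t, (0 <= t <= 1)%R -> Cmod (f (seg a b t)) <= M)%R ->
  (Cmod (SInt f a b) <= M * Cmod (b - a))%R.
Proof.
  intros Hf HM. unfold SInt. rewrite Cmod_mult, Rmult_comm.
  apply Rmult_le_compat_r; [apply Cmod_ge_0|].
  assert (K := Cmod_CInt_le (fun t => f (seg a b t)) 0 1 M Rle_0_1
    (ex_CInt_seg f a b 0 1 Rle_0_1 Hf) HM). lra.
Qed.

Lemma SInt_minus (f g : C -> C) (a b : C) :
  (forall t, (0 <= t <= 1)%R -> Ccont f (seg a b t)) ->
  (forall t, (0 <= t <= 1)%R -> Ccont g (seg a b t)) ->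
  SInt (fun z => f z - g z) a b = SInt f a b - SInt g a b.
Proof.
  intros Hf Hg. unfold SInt.
  rewrite (CInt_minus (fun t => f (seg a b t)) (fun t => g (seg a b t)))
    by (apply ex_CInt_seg; [lra|assumption]). ring.
Qed.

Lemma SInt_sym (f : C -> C) (a b : C) :
  (forall t, (0 <= t <= 1)%R -> Ccont f (seg a b t)) -> SInt f b a = - SInt f a b.
Proof.
  intros Hf. unfold SInt.
  assert (He := ex_CInt_seg f a b 0 1 Rle_0_1 Hf).
  (* The substitution t -> 1 - t, which exchanges the ends of the segment. *)
  assert (K : CInt (fun t => RtoC (-1) * f (seg a b (-1 * t + 1))) 0 1
     = CInt (fun t => f (seg a b t)) (-1 * 0 + 1) (-1 * 1 + 1)).
  { apply (CInt_comp_lin (fun t => f (seg a b t))).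
    replace (-1 * 0 + 1)%R with 1%R by ring. replace (-1 * 1 + 1)%R with 0%R by ring.
    destruct He; split; apply ex_RInt_swap; assumption. }
  replace (-1 * 0 + 1)%R with 1%R in K by ring. replace (-1 * 1 + 1)%R with 0%R in K by ring.
  assert (Em1 : RtoC (-1) = - (1)) by (apply C_eq; simpl; ring).
  assert (K2 : CInt (fun t => f (seg a b t)) 1 0 = - CInt (fun t => f (seg a b t)) 0 1).
  { apply C_eq; simpl; symmetry; apply (opp_RInt_swap (V := R_CompleteNormedModule));
      apply He. }
  rewrite K2 in K.
  rewrite (CInt_ext _ (fun t => RtoC (-1) * f (seg b a t))) in K; [|lra|].
  - rewrite CInt_scal in K.
    + transitivity ((b - a) * (RtoC (-1) * CInt (fun t => f (seg b a t)) 0 1)).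
      * rewrite Em1. ring.
      * rewrite K; ring.
    + apply ex_CInt_seg; [lra|]. intros t Ht.
      replace (seg b a t) with (seg a b (1 - t)) by (unfold seg; rewrite RtoC_minus; ring).
      apply Hf; lra.
  - intros t Ht. f_equal. f_equal. unfold seg. rewrite RtoC_plus, RtoC_mult, Em1. ring.
Qed.

Lemma SInt_Chasles (f : C -> C) (a b : C) (s : R) : (0 <= s <= 1)%R ->
  (forall t, (0 <= t <= 1)%R -> Ccont f (seg a b t)) ->
  SInt f a b = SInt f a (seg a b s) + SInt f (seg a b s) b.
Proof.
  intros Hs Hf. unfold SInt.
  assert (E1 : ex_CInt (fun t => f (seg a b t)) 0 s)
    by (apply ex_CInt_seg; [lra|]; intros t Ht; apply Hf; lra).
  assert (E2 : ex_CInt (fun t => f (seg a b t)) s 1)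
    by (apply ex_CInt_seg; [lra|]; intros t Ht; apply Hf; lra).
  rewrite <- (CInt_Chasles _ 0 s 1 E1 E2).
  (* Affine maps bring both halves back to the parameter interval [0, 1]. *)
  assert (K1 := CInt_comp_lin (fun t => f (seg a b t)) s 0 0 1).
  replace (s * 0 + 0)%R with 0%R in K1 by ring. replace (s * 1 + 0)%R with s in K1 by ring.
  assert (K2 := CInt_comp_lin (fun t => f (seg a b t)) (1 - s) s 0 1).
  replace ((1 - s) * 0 + s)%R with s in K2 by ring.
  replace ((1 - s) * 1 + s)%R with 1%R in K2 by ring.
  rewrite <- (K1 E1), <- (K2 E2).
  rewrite (CInt_ext (fun t => RtoC s * f (seg a b (s * t + 0)))
    (fun t => RtoC s * f (seg a (seg a b s) t))); [|lra|].
  2:{ intros t Ht. f_equal. f_equal. unfold seg. rewrite RtoC_plus, RtoC_mult. ring. }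
  rewrite (CInt_ext (fun t => RtoC (1 - s) * f (seg a b ((1 - s) * t + s)))
    (fun t => RtoC (1 - s) * f (seg (seg a b s) b t))); [|lra|].
  2:{ intros t Ht. f_equal. f_equal. unfold seg. rewrite RtoC_plus, RtoC_mult, RtoC_minus. ring. }
  rewrite !CInt_scal.
  - unfold seg. rewrite RtoC_minus. ring.
  - apply ex_CInt_seg; [lra|]. intros t Ht.
    replace (seg (seg a b s) b t) with (seg a b ((1 - s) * t + s))
      by (unfold seg; rewrite RtoC_plus, RtoC_mult, RtoC_minus; ring).
    apply Hf; nra.
  - apply ex_CInt_seg; [lra|]. intros t Ht.
    replace (seg a (seg a b s) t) with (seg a b (s * t))
      by (unfold seg; rewrite RtoC_mult; ring).
    apply Hf; nra.
Qed.

(** * Goursat's lemma *)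

Lemma is_series_geom_scal (K q : R) : (0 <= q < 1)%R ->
  is_series (fun n => K * q ^ n)%R (K / (1 - q))%R.
Proof.
  intros Hq. apply (is_series_scal_l K (fun n => q ^ n)%R (/ (1 - q))%R).
  apply is_series_geom. rewrite Rabs_pos_eq; lra.
Qed.

(** The limit is [x O] plus the series of increments, dominated by a geometric series; the error
    after [n] steps is the geometric tail. *)
Lemma geometric_limit (x : nat -> C) (K q : R) : (0 <= q < 1)%R ->
  (forall n, Cmod (x (S n) - x n) <= K * q ^ n)%R ->
  exists z, forall n, (Cmod (z - x n) <= K * q ^ n / (1 - q))%R.
Proof.
  intros Hq H. set (d k := x (S k) - x k).
  assert (Hd : forall n k, (Cmod (d (n + k)%nat) <= K * q ^ n * q ^ k)%R).
  { intros n k. rewrite Rmult_assoc, <- pow_add. apply H. }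
  assert (Hs : forall n, Csummable (fun k => d (n + k)%nat)).
  { intro n. apply (Csummable_le _ (fun k => K * q ^ n * q ^ k)%R (Hd n)).
    eexists; apply is_series_geom_scal; exact Hq. }
  assert (E : forall n, x O + Cseries d = x n + Cseries (fun k => d (n + k)%nat)).
  { induction n as [|n IH]; [reflexivity|].
    rewrite IH, (Cseries_S _ (Hs n)).
    rewrite (Cseries_ext (fun k => d (n + S k)%nat) (fun k => d (S n + k)%nat))
      by (intro k; f_equal; lia).
    rewrite Nat.add_0_r. unfold d at 1. ring. }
  exists (x O + Cseries d). intro n. rewrite (E n).
  replace (x n + Cseries (fun k => d (n + k)%nat) - x n)
    with (Cseries (fun k => d (n + k)%nat)) by ring.
  rewrite <- (is_series_unique _ _ (is_series_geom_scal (K * q ^ n) q Hq)).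
  apply Cmod_Cseries_le; [apply Hd|]. eexists; apply is_series_geom_scal; exact Hq.
Qed.

Lemma geometric_small (L e q : R) : (0 <= q < 1)%R -> (0 < e)%R ->
  exists n, (L * q ^ n < e)%R.
Proof.
  intros Hq He. destruct (Rle_dec L 0) as [HL|HL].
  - exists O. simpl. lra.
  - destruct (pow_lt_1_zero q) with (y := (e / L)%R) as [n Hn].
    + rewrite Rabs_pos_eq; lra.
    + apply Rdiv_lt_0_compat; lra.
    + exists n. specialize (Hn n (Nat.le_refl n)).
      rewrite Rabs_pos_eq in Hn by (apply pow_le; lra).
      apply Rlt_div_r in Hn; [|lra]. lra.
Qed.

Lemma eq_0_of_Cmod_small (z : C) : (forall e, (0 < e)%R -> (Cmod z <= e)%R) -> z = 0.
Proof.
  intros H. apply Cmod_eq_0. apply Rle_antisym; [|apply Cmod_ge_0].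
  apply le_epsilon. intros e He. rewrite Rplus_0_l. apply H, He.
Qed.

Lemma Cmod_seg_le (a b c : C) (t M : R) : (0 <= t <= 1)%R ->
  (Cmod (a - c) <= M)%R -> (Cmod (b - c) <= M)%R -> (Cmod (seg a b t - c) <= M)%R.
Proof.
  intros Ht Ha Hb.
  replace (seg a b t - c) with (RtoC (1 - t) * (a - c) + RtoC t * (b - c))
    by (unfold seg; rewrite RtoC_minus; ring).
  eapply Rle_trans; [apply Cmod_triangle|].
  rewrite !Cmod_mult, !Cmod_R, !Rabs_pos_eq by lra. nra.
Qed.

Definition TInt (f : C -> C) (a b c : C) : C := SInt f a b + SInt f b c + SInt f c a.

Definition perimeter (a b c : C) : R := (Cmod (b - a) + Cmod (c - b) + Cmod (a - c))%R.

Lemma perimeter_ge_0 (a b c : C) : (0 <= perimeter a b c)%R.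
Proof. unfold perimeter. repeat apply Rplus_le_le_0_compat; apply Cmod_ge_0. Qed.

Lemma Cmod_half (z : C) : Cmod (RtoC (1 / 2) * z) = (Cmod z / 2)%R.
Proof. rewrite Cmod_mult, Cmod_R, Rabs_pos_eq by lra. field. Qed.

Lemma RtoC_half : RtoC (1 / 2) = / 2.
Proof. unfold Rdiv. rewrite Rmult_1_l. apply RtoC_inv. lra. Qed.

Lemma C2_neq_0 : RtoC 2 <> 0.
Proof. intro H. apply RtoC_inj in H. lra. Qed.

Local Ltac halve := unfold seg; rewrite RtoC_half; field; exact C2_neq_0.

(** The midpoints cut the triangle into four. Inner edges are traversed twice in opposite
    directions, so the four integrals add up to the given one and some piece carries at least a
    quarter of it. The bound on [a' - a] later makes the first vertices of nested triangles
    converge. *)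
Lemma TInt_subdivide (f : C -> C) (D : C -> Prop) (a b c : C) :
  (forall x y t, D x -> D y -> (0 <= t <= 1)%R -> D (seg x y t)) ->
  (forall z, D z -> Ccont f z) -> D a -> D b -> D c ->
  exists a' b' c', D a' /\ D b' /\ D c' /\
    (Cmod (TInt f a b c) <= 4 * Cmod (TInt f a' b' c'))%R /\
    (perimeter a' b' c' <= perimeter a b c / 2)%R /\
    (Cmod (a' - a) <= perimeter a b c)%R.
Proof.
  intros Hconv Hf Ha Hb Hc.
  set (p := seg a b (1 / 2)). set (q := seg b c (1 / 2)). set (r := seg c a (1 / 2)).
  assert (Hh : (0 <= 1 / 2 <= 1)%R) by lra.
  assert (Hp : D p) by (apply Hconv; assumption).
  assert (Hq : D q) by (apply Hconv; assumption).
  assert (Hr : D r) by (apply Hconv; assumption).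
  assert (Hs : forall x y, D x -> D y -> forall t, (0 <= t <= 1)%R -> Ccont f (seg x y t))
    by (intros; apply Hf; apply Hconv; assumption).
  assert (E : TInt f a b c = TInt f a p r + TInt f p b q + TInt f r q c + TInt f p q r).
  { unfold TInt.
    rewrite (SInt_Chasles f a b (1 / 2) Hh (Hs _ _ Ha Hb)).
    rewrite (SInt_Chasles f b c (1 / 2) Hh (Hs _ _ Hb Hc)).
    rewrite (SInt_Chasles f c a (1 / 2) Hh (Hs _ _ Hc Ha)).
    fold p q r.
    rewrite (SInt_sym f p r (Hs _ _ Hp Hr)), (SInt_sym f q p (Hs _ _ Hq Hp)),
      (SInt_sym f r q (Hs _ _ Hr Hq)). ring. }
  assert (Pa : (perimeter a p r <= perimeter a b c / 2)%R).
  { unfold perimeter.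
    replace (p - a) with (RtoC (1 / 2) * (b - a)) by (unfold p, seg; ring).
    replace (r - p) with (RtoC (1 / 2) * (c - b)) by (unfold r, p; halve).
    replace (a - r) with (RtoC (1 / 2) * (a - c)) by (unfold r; halve).
    rewrite !Cmod_half. lra. }
  assert (Pb : (perimeter p b q <= perimeter a b c / 2)%R).
  { unfold perimeter.
    replace (b - p) with (RtoC (1 / 2) * (b - a)) by (unfold p; halve).
    replace (q - b) with (RtoC (1 / 2) * (c - b)) by (unfold q, seg; ring).
    replace (p - q) with (RtoC (1 / 2) * (a - c)) by (unfold q, p; halve).
    rewrite !Cmod_half. lra. }
  assert (Pc : (perimeter r q c <= perimeter a b c / 2)%R).
  { unfold perimeter.
    replace (q - r) with (RtoC (1 / 2) * (b - a)) by (unfold q, r; halve).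
    replace (c - q) with (RtoC (1 / 2) * (c - b)) by (unfold q; halve).
    replace (r - c) with (RtoC (1 / 2) * (a - c)) by (unfold r, seg; ring).
    rewrite !Cmod_half. lra. }
  assert (Pm : (perimeter p q r <= perimeter a b c / 2)%R).
  { unfold perimeter.
    replace (q - p) with (RtoC (1 / 2) * (c - a)) by (unfold q, p; halve).
    replace (r - q) with (RtoC (1 / 2) * (a - b)) by (unfold q, r; halve).
    replace (p - r) with (RtoC (1 / 2) * (b - c)) by (unfold r, p; halve).
    rewrite !Cmod_half, (Cmod_minus_sym c a), (Cmod_minus_sym a b), (Cmod_minus_sym b c). lra. }
  assert (N1 := Cmod_ge_0 (b - a)). assert (N2 := Cmod_ge_0 (c - b)).
  assert (N3 := Cmod_ge_0 (a - c)).
  assert (Dp : (Cmod (p - a) <= perimeter a b c)%R).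
  { replace (p - a) with (RtoC (1 / 2) * (b - a)) by (unfold p, seg; ring).
    rewrite Cmod_half. unfold perimeter. lra. }
  assert (Dr : (Cmod (r - a) <= perimeter a b c)%R).
  { replace (r - a) with (RtoC (1 / 2) * (c - a)) by (unfold r; halve).
    rewrite Cmod_half, (Cmod_minus_sym c a). unfold perimeter. lra. }
  assert (Da : (Cmod (a - a) <= perimeter a b c)%R).
  { rewrite Cmod_center. apply perimeter_ge_0. }
  (* If no corner triangle carries a quarter, the triangle inequality forces the middle one to. *)
  set (I := Cmod (TInt f a b c)).
  destruct (Rle_dec I (4 * Cmod (TInt f a p r))) as [L1|L1];
    [exists a, p, r; repeat split; assumption|].
  destruct (Rle_dec I (4 * Cmod (TInt f p b q))) as [L2|L2];
    [exists p, b, q; repeat split; assumption|].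
  destruct (Rle_dec I (4 * Cmod (TInt f r q c))) as [L3|L3];
    [exists r, q, c; repeat split; assumption|].
  exists p, q, r; repeat split; try assumption.
  assert (T : (I <= Cmod (TInt f a p r) + Cmod (TInt f p b q) + Cmod (TInt f r q c)
               + Cmod (TInt f p q r))%R).
  { unfold I; rewrite E. eapply Rle_trans; [apply Cmod_triangle|].
    apply Rplus_le_compat_r. eapply Rle_trans; [apply Cmod_triangle|].
    apply Rplus_le_compat_r. apply Cmod_triangle. }
  lra.
Qed.

Lemma Cmod_TInt_le (f : C -> C) (a b c : C) (M : R) :
  (forall x y t, (x = a /\ y = b \/ x = b /\ y = c \/ x = c /\ y = a) -> (0 <= t <= 1)%R ->
     Ccont f (seg x y t) /\ (Cmod (f (seg x y t)) <= M)%R) ->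
  (Cmod (TInt f a b c) <= M * perimeter a b c)%R.
Proof.
  intros H. unfold TInt, perimeter.
  assert (K : forall x y, (x = a /\ y = b \/ x = b /\ y = c \/ x = c /\ y = a) ->
    (Cmod (SInt f x y) <= M * Cmod (y - x))%R)
    by (intros x y Hxy; apply Cmod_SInt_le; intros t Ht; apply (H x y t Hxy Ht)).
  assert (K1 := K a b ltac:(tauto)). assert (K2 := K b c ltac:(tauto)).
  assert (K3 := K c a ltac:(tauto)).
  eapply Rle_trans; [apply Cmod_triangle|].
  eapply Rle_trans; [apply Rplus_le_compat_r, Cmod_triangle|]. lra.
Qed.

Lemma is_Cderive_affine (c d z0 z : C) : is_Cderive (fun w => c + d * (w - z0)) z d.
Proof.
  eapply is_Cderive_eq.
  - apply is_Cderive_plus; [apply is_Cderive_const|].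
    apply is_Cderive_scal. apply is_Cderive_sub_const.
  - ring.
Qed.

(** An affine function has a quadratic primitive. Hence the first-order part of [f] can be
    subtracted from the integrand at no cost. *)
Lemma TInt_affine (c d z0 x y z : C) : TInt (fun w => c + d * (w - z0)) x y z = 0.
Proof.
  set (F w := c * (w - z0) + d / 2 * (w - z0) ^ 2).
  assert (HF : forall w, is_Cderive F w (c + d * (w - z0))).
  { intro w. assert (K := is_Cderive_minus _ _ w _ _ (is_Cderive_id w) (is_Cderive_const z0 w)).
    eapply is_Cderive_eq.
    - apply is_Cderive_plus; apply is_Cderive_scal; [exact K|apply is_Cderive_sqr; exact K].
    - cbv beta. field. }
  assert (K : forall x y, SInt (fun w => c + d * (w - z0)) x y = F y - F x).
  { intros u v. apply SInt_derive.
    - intros t _. apply HF.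
    - intros t _. eapply is_Cderive_Ccont, is_Cderive_affine. }
  unfold TInt. rewrite !K. ring.
Qed.

(** Convexity of [D] keeps the midpoints inside, closedness the common limit point of the nested
    triangles. Differentiability at that point gives integrals of size o(4^(-n)), which beats the
    factor [4 ^ n] lost in [n] subdivisions. *)
Theorem goursat_triangle (f : C -> C) (D : C -> Prop) :
  (forall x y t, D x -> D y -> (0 <= t <= 1)%R -> D (seg x y t)) ->
  (forall z, (forall e, (0 < e)%R -> exists w, D w /\ (Cmod (w - z) < e)%R) -> D z) ->
  (forall z, D z -> Cdiff f z) ->
  forall a b c, D a -> D b -> D c -> TInt f a b c = 0.
Proof.
  intros Hconv Hclosed Hf a b c Ha Hb Hc.
  assert (Hcont : forall z, D z -> Ccont f z) by (intros; apply Cdiff_Ccont, Hf; assumption).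
  set (V (T : C * C * C) := D (fst (fst T)) /\ D (snd (fst T)) /\ D (snd T)).
  set (I (T : C * C * C) := Cmod (TInt f (fst (fst T)) (snd (fst T)) (snd T))).
  set (P (T : C * C * C) := perimeter (fst (fst T)) (snd (fst T)) (snd T)).
  (* To be iterated, the step must be a total function on triples; its properties are only asked for
     triangles in [D]. *)
  destruct (functional_choice (fun T T' => V T -> V T' /\ (I T <= 4 * I T')%R /\
    (P T' <= P T / 2)%R /\ (Cmod (fst (fst T') - fst (fst T)) <= P T)%R)) as [next Hnext].
  { intro T. destruct (Classical_Prop.classic (V T)) as [HT|HT].
    - destruct HT as [H1 [H2 H3]].
      destruct (TInt_subdivide f D _ _ _ Hconv Hcont H1 H2 H3)
        as [a' [b' [c' [K1 [K2 [K3 [K4 [K5 K6]]]]]]]].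
      exists (a', b', c'). intros _. repeat split; assumption.
    - exists T. intro; contradiction. }
  set (T n := Nat.iter n next (a, b, c)).
  set (L := perimeter a b c).
  assert (VT : forall n, V (T n)).
  { induction n as [|n IH]; [repeat split; assumption|]. apply Hnext. exact IH. }
  assert (PT : forall n, (P (T n) <= L * (1 / 2) ^ n)%R).
  { induction n as [|n IH]; [simpl; unfold P, L; simpl; lra|].
    destruct (Hnext (T n) (VT n)) as [_ [_ [H _]]]. simpl in *. fold (T n) in H. 
    change (nat_rect (fun _ => (C * C * C)%type) (a, b, c) (fun _ => next) n) with (T n).
    lra. }
  assert (IT : forall n, (I (T O) <= 4 ^ n * I (T n))%R).
  { induction n as [|n IH]; [simpl; lra|].
    destruct (Hnext (T n) (VT n)) as [_ [H _]].
    change (T (S n)) with (next (T n)). assert (Hp := pow_lt 4 n ltac:(lra)).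
    eapply Rle_trans; [exact IH|]. rewrite <- tech_pow_Rmult.
    apply (Rmult_le_compat_l (4 ^ n)) in H; lra. }
  destruct (geometric_limit (fun n => fst (fst (T n))) L (1 / 2)) as [z Hz]; [lra| |].
  { intro n. destruct (Hnext (T n) (VT n)) as [_ [_ [_ H]]].
    eapply Rle_trans; [exact H|apply PT]. }
  assert (HL : (0 <= L)%R) by apply perimeter_ge_0.
  assert (Dz : D z).
  { apply Hclosed. intros e He.
    destruct (geometric_small (2 * L) e (1 / 2) ltac:(lra) He) as [n Hn].
    exists (fst (fst (T n))). split; [apply VT|].
    rewrite Cmod_minus_sym. eapply Rle_lt_trans; [apply Hz|]. lra. }
  destruct (Hf z Dz) as [d Hd].
  apply eq_0_of_Cmod_small. intros e He.
  (* The final bound is [4 ^ n] times the error bound eps 3L 2^(-n) times the perimeter bound L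
     2^(-n), that is eps 3 L^2. *)
  set (eps := (e / (3 * L * L + 1))%R).
  assert (HLL : (0 <= L * L)%R) by (apply Rmult_le_pos; exact HL).
  assert (Heps : (0 < eps)%R) by (apply Rdiv_lt_0_compat; lra).
  destruct (proj1 (is_Cderive_iff f z d) Hd eps Heps) as [del [Hdel K]].
  destruct (geometric_small (3 * L) del (1 / 2) ltac:(lra) Hdel) as [n Hn].
  assert (HIn : (I (T n) <= eps * (3 * L * (1 / 2) ^ n) * (L * (1 / 2) ^ n))%R).
  { destruct (VT n) as [V1 [V2 V3]]. assert (Pn := PT n). specialize (Hz n).
    unfold I, P in *. destruct (T n) as [[x y] w]. simpl in *.
    assert (E : TInt f x y w = TInt (fun u => f u - (f z + d * (u - z))) x y w).
    { unfold TInt. rewrite !SInt_minus;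
      try (intros t Ht; apply Hcont, Hconv; assumption);
      try (intros t Ht; eapply is_Cderive_Ccont, is_Cderive_affine).
      assert (K2 := TInt_affine (f z) d z x y w). unfold TInt in K2.
      transitivity (SInt f x y + SInt f y w + SInt f w x - 0); [ring|]. rewrite <- K2; ring. }
    rewrite E.
    assert (N1 := Cmod_ge_0 (y - x)). assert (N2 := Cmod_ge_0 (w - y)).
    assert (N3 := Cmod_ge_0 (x - w)). unfold perimeter in Pn.
    (* The vertex [x] is itself within 2L 2^(-n) of the limit [z]. *)
    assert (Q : forall u, (Cmod (u - x) <= L * (1 / 2) ^ n)%R ->
      (Cmod (u - z) <= 3 * L * (1 / 2) ^ n)%R).
    { intros u Hu. eapply Rle_trans; [apply (Cmod_minus_triangle u x z)|].
      rewrite (Cmod_minus_sym x z). lra. }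
    assert (N4 : (0 <= (1 / 2) ^ n)%R) by (apply pow_le; lra).
    eapply Rle_trans; [apply Cmod_TInt_le with (M := (eps * (3 * L * (1 / 2) ^ n))%R)|].
    - assert (B : forall p, (p = x \/ p = y \/ p = w) -> D p /\ (Cmod (p - x) <= L * (1 / 2) ^ n)%R).
      { intros p [Hp|[Hp|Hp]]; subst p; (split; [assumption|]); try lra.
        - rewrite Cmod_center. lra.
        - rewrite Cmod_minus_sym. lra. }
      intros p q t Hpq Ht.
      destruct (B p ltac:(tauto)) as [D1 B1]. destruct (B q ltac:(tauto)) as [D2 B2].
      assert (Hu := Q _ (Cmod_seg_le p q x t _ Ht B1 B2)).
      split.
      + apply Cdiff_Ccont, Cdiff_minus; [apply Hf, Hconv; assumption|].
        exists d. apply is_Cderive_affine.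
      + specialize (K (seg p q t) (Rle_lt_trans _ _ _ Hu Hn)).
        replace (f (seg p q t) - (f z + d * (seg p q t - z)))
          with (f (seg p q t) - f z - d * (seg p q t - z)) by ring.
        eapply Rle_trans; [exact K|]. apply Rmult_le_compat_l; lra.
    - apply Rmult_le_compat_l; [|exact Pn].
      apply Rmult_le_pos; [lra|]. apply Rmult_le_pos; lra. }
  specialize (IT n).
  assert (E4 : (4 ^ n * ((1 / 2) ^ n * (1 / 2) ^ n) = 1)%R).
  { rewrite <- !Rpow_mult_distr. replace (4 * (1 / 2 * (1 / 2)))%R with 1%R by field.
    apply pow1. }
  assert (H4 := pow_lt 4 n ltac:(lra)).
  apply Rle_trans with (4 ^ n * (eps * (3 * L * (1 / 2) ^ n) * (L * (1 / 2) ^ n)))%R.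
  - eapply Rle_trans; [exact IT|]. apply Rmult_le_compat_l; [lra|exact HIn].
  - replace (4 ^ n * (eps * (3 * L * (1 / 2) ^ n) * (L * (1 / 2) ^ n)))%R
      with (eps * (3 * L * L) * (4 ^ n * ((1 / 2) ^ n * (1 / 2) ^ n)))%R by ring.
    rewrite E4, Rmult_1_r.
    replace e with (eps * (3 * L * L + 1))%R at 1 by (unfold eps; field; lra).
    apply Rmult_le_compat_l; lra.
Qed.

Lemma SInt_const (c a b : C) : SInt (fun _ => c) a b = c * (b - a).
Proof. unfold SInt. rewrite CInt_const, RtoC_minus. ring. Qed.

Lemma Cmod_seg_lt (a b : C) (t R0 : R) : (0 <= t <= 1)%R ->
  (Cmod a < R0)%R -> (Cmod b < R0)%R -> (Cmod (seg a b t) < R0)%R.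
Proof.
  intros Ht Ha Hb.
  assert (K := Cmod_seg_le a b 0 t (Rmax (Cmod a) (Cmod b)) Ht).
  replace (a - 0) with a in K by ring. replace (b - 0) with b in K by ring.
  replace (seg a b t - 0) with (seg a b t) in K by ring.
  apply Rle_lt_trans with (Rmax (Cmod a) (Cmod b)).
  - apply K; [apply Rmax_l|apply Rmax_r].
  - apply Rmax_lub_lt; assumption.
Qed.

(** A closed disc cut by a half-plane at positive distance from [p] is convex, closed and avoids
    [p], so Goursat's lemma applies to functions that are only differentiable off [p]. *)
Lemma goursat_cut_disc (f : C -> C) (R0 r del : R) (p v : C) : (r < R0)%R -> (0 < del)%R ->
  (forall z, (Cmod z < R0)%R -> z <> p -> Cdiff f z) ->
  let D z := (Cmod z <= r)%R /\ (del <= Re ((z - p) * Cconj v))%R in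
  forall a b c, D a -> D b -> D c -> TInt f a b c = 0.
Proof.
  intros Hr Hdel Hf D.
  assert (Mv := Cmod_ge_0 v).
  apply goursat_triangle.
  - intros x y t [X1 X2] [Y1 Y2] Ht. split.
    + assert (K := Cmod_seg_le x y 0 t r Ht).
      replace (x - 0) with x in K by ring. replace (y - 0) with y in K by ring.
      replace (seg x y t - 0) with (seg x y t) in K by ring. auto.
    + replace ((seg x y t - p) * Cconj v)
        with (RtoC (1 - t) * ((x - p) * Cconj v) + RtoC t * ((y - p) * Cconj v))
        by (unfold seg; rewrite RtoC_minus; ring).
      rewrite Re_plus, !re_scal_l. nra.
  - intros z Hz. split.
    + apply le_epsilon. intros e He. destruct (Hz e He) as [w [[W1 _] W2]].
      rewrite Cmod_minus_sym in W2. assert (K := Cmod_triangle_inv z w). lra.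
    + apply le_epsilon. intros e He.
      destruct (Hz (e / (Cmod v + 1))%R) as [w [[_ W1] W2]]; [apply Rdiv_lt_0_compat; lra|].
      replace ((z - p) * Cconj v) with ((w - p) * Cconj v - (w - z) * Cconj v) by ring.
      assert (K := Re_le_Cmod ((w - z) * Cconj v)). rewrite Cmod_mult, Cmod_conj in K.
      assert (K2 : (Cmod (w - z) * Cmod v <= e)%R).
      { apply Rle_trans with (e / (Cmod v + 1) * (Cmod v + 1))%R.
        - apply Rmult_le_compat; try lra. apply Cmod_ge_0.
        - apply Req_le; field; lra. }
      change (Re ((w - p) * Cconj v - (w - z) * Cconj v))
        with (Re ((w - p) * Cconj v) - Re ((w - z) * Cconj v))%R. lra.
  - intros z [Z1 Z2]. apply Hf; [lra|]. intro E. subst z.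
    replace ((p - p) * Cconj v) with (RtoC 0) in Z2 by ring. rewrite re_RtoC in Z2. lra.
Qed.


(** A similar triangle of ratio [e] is cut off at the apex [p]. The remaining quadrilateral lies in
    a cut disc and contributes nothing, while continuity at [p] bounds the small integral by a
    multiple of [e]. The closeness of [x] to [w] places both beyond one line perpendicular to
    [w - p]. *)
Lemma TInt_apex (f : C -> C) (R0 : R) (p w x : C) :
  (forall z, (Cmod z < R0)%R -> Ccont f z) ->
  (forall z, (Cmod z < R0)%R -> z <> p -> Cdiff f z) ->
  (Cmod p < R0)%R -> (Cmod w < R0)%R -> (Cmod x < R0)%R ->
  (Cmod (x - w) < Cmod (w - p) / 2)%R -> TInt f p w x = 0.
Proof.
  intros Hc Hf Hp Hw Hx Hxw. set (v := w - p) in *.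
  assert (Hv : (0 < Cmod v)%R) by (assert (K := Cmod_ge_0 (x - w)); lra).
  assert (Hs : forall a b, (Cmod a < R0)%R -> (Cmod b < R0)%R ->
     forall t, (0 <= t <= 1)%R -> Ccont f (seg a b t))
    by (intros; apply Hc, Cmod_seg_lt; assumption).
  assert (L1 : Re ((w - p) * Cconj v) = (Cmod v * Cmod v)%R).
  { fold v. assert (K := Cmod2_alt v). unfold Re, Im in *; simpl in *. lra. }
  assert (L2 : (Cmod v * Cmod v / 2 <= Re ((x - p) * Cconj v))%R).
  { replace ((x - p) * Cconj v) with ((w - p) * Cconj v - (w - x) * Cconj v) by ring.
    change (Re ((w - p) * Cconj v - (w - x) * Cconj v))
        with (Re ((w - p) * Cconj v) - Re ((w - x) * Cconj v))%R.
    rewrite L1. assert (K := Re_le_Cmod ((w - x) * Cconj v)).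
    rewrite Cmod_mult, Cmod_conj, (Cmod_minus_sym w x) in K. nra. }
  destruct (Hc p Hp 1%R Rlt_0_1) as [eta [Heta Hbd]].
  set (M := (Cmod (f p) + 1)%R).
  assert (HM : (0 < M)%R) by (assert (K := Cmod_ge_0 (f p)); unfold M; lra).
  set (Q := (perimeter p w x)%R).
  assert (N1 := Cmod_ge_0 (w - p)). assert (N2 := Cmod_ge_0 (x - w)).
  assert (N3 := Cmod_ge_0 (p - x)).
  assert (HQ : (0 <= Q)%R) by apply perimeter_ge_0.
  assert (Small : forall e, (0 < e <= 1)%R -> (e * Q < eta)%R ->
     (Cmod (TInt f p w x) <= M * (e * Q))%R).
  { intros e He HeQ. assert (He' : (0 <= e <= 1)%R) by lra.
    set (b := seg p w e). set (c := seg p x e).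
    assert (Hb : (Cmod b < R0)%R) by (apply Cmod_seg_lt; assumption).
    assert (Hcc : (Cmod c < R0)%R) by (apply Cmod_seg_lt; assumption).
    set (r := Rmax (Rmax (Cmod w) (Cmod x)) (Rmax (Cmod b) (Cmod c))).
    assert (Hr : (r < R0)%R) by (repeat apply Rmax_lub_lt; assumption).
    assert (R1 : (Cmod w <= r)%R) by (eapply Rle_trans; [|apply Rmax_l]; apply Rmax_l).
    assert (R2 : (Cmod x <= r)%R) by (eapply Rle_trans; [|apply Rmax_l]; apply Rmax_r).
    assert (R3 : (Cmod b <= r)%R) by (eapply Rle_trans; [|apply Rmax_r]; apply Rmax_l).
    assert (R4 : (Cmod c <= r)%R) by (eapply Rle_trans; [|apply Rmax_r]; apply Rmax_r).
    assert (Hvv : (0 < Cmod v * Cmod v)%R) by (apply Rmult_lt_0_compat; exact Hv).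
    assert (Lb : Re ((b - p) * Cconj v) = (e * Re ((w - p) * Cconj v))%R).
    { rewrite <- re_scal_l. f_equal. unfold b, seg. ring. }
    assert (Lc : Re ((c - p) * Cconj v) = (e * Re ((x - p) * Cconj v))%R).
    { rewrite <- re_scal_l. f_equal. unfold c, seg. ring. }
    assert (G := goursat_cut_disc f R0 r (e * (Cmod v * Cmod v / 2)) p v Hr).
    cbv zeta in G. specialize (G ltac:(apply Rmult_lt_0_compat; lra) Hf).
    assert (Dw : (Cmod w <= r)%R /\ (e * (Cmod v * Cmod v / 2) <= Re ((w - p) * Cconj v))%R)
      by (split; [exact R1|]; rewrite L1; nra).
    assert (Dx : (Cmod x <= r)%R /\ (e * (Cmod v * Cmod v / 2) <= Re ((x - p) * Cconj v))%R)
      by (split; [exact R2|]; nra).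
    assert (Db : (Cmod b <= r)%R /\ (e * (Cmod v * Cmod v / 2) <= Re ((b - p) * Cconj v))%R)
      by (split; [exact R3|]; rewrite Lb, L1; nra).
    assert (Dc : (Cmod c <= r)%R /\ (e * (Cmod v * Cmod v / 2) <= Re ((c - p) * Cconj v))%R)
      by (split; [exact R4|]; rewrite Lc; nra).
    (* The quadrilateral b, w, x, c is split along its diagonal from [b] to [x]. *)
    assert (G1 := G b w x Db Dw Dx). assert (G2 := G b x c Db Dx Dc).
    assert (E : TInt f p w x = TInt f p b c).
    { transitivity (TInt f p b c + TInt f b w x + TInt f b x c); [|rewrite G1, G2; ring].
      unfold TInt.
      rewrite (SInt_Chasles f p w e He' (Hs _ _ Hp Hw)). fold b.
      rewrite (SInt_sym f p x (Hs _ _ Hp Hx)), (SInt_Chasles f p x e He' (Hs _ _ Hp Hx)).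
      fold c. rewrite (SInt_sym f p c (Hs _ _ Hp Hcc)), (SInt_sym f c x (Hs _ _ Hcc Hx)),
       (SInt_sym f b x (Hs _ _ Hb Hx)), (SInt_sym f b c (Hs _ _ Hb Hcc)). ring. }
    rewrite E.
    assert (Eb : (Cmod (b - p) = e * Cmod (w - p))%R).
    { replace (b - p) with (RtoC e * (w - p)) by (unfold b, seg; ring).
      rewrite Cmod_mult, Cmod_R, Rabs_pos_eq; lra. }
    assert (Ec : (Cmod (c - p) = e * Cmod (p - x))%R).
    { replace (c - p) with (RtoC e * (x - p)) by (unfold c, seg; ring).
      rewrite Cmod_mult, Cmod_R, (Cmod_minus_sym x p), Rabs_pos_eq; lra. }
    assert (Ebc : (Cmod (c - b) = e * Cmod (x - w))%R).
    { replace (c - b) with (RtoC e * (x - w)) by (unfold c, b, seg; ring).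
      rewrite Cmod_mult, Cmod_R, Rabs_pos_eq; lra. }
    assert (Eper : perimeter p b c = (e * Q)%R).
    { unfold perimeter, Q, perimeter. rewrite Eb, Ebc, (Cmod_minus_sym p c), Ec. ring. }
    rewrite <- Eper. apply Cmod_TInt_le. intros y z t Hyz Ht.
    assert (B : forall u, (u = p \/ u = b \/ u = c) -> (Cmod u < R0)%R /\ (Cmod (u - p) <= e * Q)%R).
    { intros u [Hu|[Hu|Hu]]; subst u; (split; [assumption|]).
      - rewrite Cmod_center. nra.
      - rewrite Eb. unfold Q, perimeter. nra.
      - rewrite Ec. unfold Q, perimeter. nra. }
    destruct (B y ltac:(tauto)) as [Y1 Y2]. destruct (B z ltac:(tauto)) as [Z1 Z2].
    split; [apply Hs; assumption|].
    assert (Hu := Cmod_seg_le y z p t _ Ht Y2 Z2).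
    specialize (Hbd _ (Rle_lt_trans _ _ _ Hu HeQ)).
    assert (K := Cmod_triangle_inv (f (seg y z t)) (f p)). unfold M. lra. }
  apply eq_0_of_Cmod_small. intros e He.
  set (e1 := Rmin 1 (Rmin (eta / 2 / (Q + 1)) (e / M / (Q + 1)))).
  assert (P1 : (0 < eta / 2 / (Q + 1))%R) by (repeat apply Rdiv_lt_0_compat; lra).
  assert (P2 : (0 < e / M / (Q + 1))%R) by (repeat apply Rdiv_lt_0_compat; lra).
  assert (He1 : (0 < e1)%R) by (repeat apply Rmin_pos; lra).
  assert (E1 : (e1 <= 1)%R) by apply Rmin_l.
  assert (E2 : (e1 <= eta / 2 / (Q + 1))%R) by (eapply Rle_trans; [apply Rmin_r|apply Rmin_l]).
  assert (E3 : (e1 <= e / M / (Q + 1))%R) by (eapply Rle_trans; [apply Rmin_r|apply Rmin_r]).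
  apply Rle_div_r in E2; [|lra]. apply Rle_div_r in E3; [|lra].
  eapply Rle_trans; [apply (Small e1); lra|].
  apply Rle_trans with (M * (e / M))%R.
  - apply Rmult_le_compat_l; lra.
  - apply Req_le; field; lra.
Qed.

(** The primitive is based at the exceptional point itself, so only triangles with apex [p] occur.
    This serves divided differences, which at this stage are known to be continuous but not
    differentiable at their centre. *)
Theorem is_Cderive_SInt (f : C -> C) (R0 : R) (p z : C) :
  (forall z, (Cmod z < R0)%R -> Ccont f z) ->
  (forall z, (Cmod z < R0)%R -> z <> p -> Cdiff f z) ->
  (Cmod p < R0)%R -> (Cmod z < R0)%R -> is_Cderive (SInt f p) z (f z).
Proof.
  intros Hc Hf Hp Hz.
  assert (Hs : forall a b, (Cmod a < R0)%R -> (Cmod b < R0)%R ->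
     forall t, (0 <= t <= 1)%R -> Ccont f (seg a b t))
    by (intros; apply Hc, Cmod_seg_lt; assumption).
  assert (Hadd : exists e, (0 < e)%R /\ forall x, (Cmod x < R0)%R -> (Cmod (x - z) < e)%R ->
     SInt f p x - SInt f p z = SInt f z x).
  { destruct (Req_dec (Cmod (z - p)) 0) as [E|E].
    - exists 1%R. split; [lra|]. intros x _ _. apply Cmod_eq_0 in E.
      replace z with p by (transitivity (z - (z - p)); [ring|rewrite E; ring]).
      unfold SInt. ring.
    - exists (Cmod (z - p) / 2)%R. assert (K := Cmod_ge_0 (z - p)). split; [lra|].
      intros x Hx Hxz. assert (T := TInt_apex f R0 p z x Hc Hf Hp Hz Hx Hxz).
      unfold TInt in T. rewrite (SInt_sym f p x (Hs _ _ Hp Hx)) in T.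
      transitivity (SInt f z x - (SInt f p z + SInt f z x + - SInt f p x)); [ring|].
      rewrite T. ring. }
  destruct Hadd as [e [He Hadd]].
  apply is_Cderive_iff. intros eps Heps.
  destruct (Hc z Hz eps Heps) as [del [Hdel K]].
  exists (Rmin (Rmin del e) (R0 - Cmod z)). split; [repeat apply Rmin_pos; lra|].
  intros x Hx.
  assert (X1 := Rlt_le_trans _ _ _ Hx (Rle_trans _ _ _ (Rmin_l _ _) (Rmin_l _ _))).
  assert (X2 := Rlt_le_trans _ _ _ Hx (Rle_trans _ _ _ (Rmin_l _ _) (Rmin_r _ _))).
  assert (X3 := Rlt_le_trans _ _ _ Hx (Rmin_r _ _)).
  assert (HxR : (Cmod x < R0)%R) by (assert (T := Cmod_triangle_inv x z); lra).
  rewrite (Hadd x HxR X2), <- (SInt_const (f z)).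
  rewrite <- (SInt_minus f (fun _ => f z)).
  - apply Cmod_SInt_le.
    + intros t Ht. intros e' He'. destruct (Hs z x Hz HxR t Ht e' He') as [d' [Hd' K']].
      exists d'; split; [exact Hd'|]. intros w Hw.
      replace (f w - f z - (f (seg z x t) - f z)) with (f w - f (seg z x t)) by ring.
      apply K'; exact Hw.
    + intros t Ht. apply Rlt_le, K.
      eapply Rle_lt_trans; [|exact X1].
      apply Cmod_seg_le; [exact Ht| |lra].
      rewrite Cmod_center. apply Cmod_ge_0.
  - intros t Ht; apply Hs; assumption.
  - intros t _. apply Cdiff_Ccont, Cdiff_const.
Qed.

(** * Cauchy's formula *)

Lemma Cmult_eq_0_l (a b : C) : a * b = 0 -> b <> 0 -> a = 0.
Proof. intros H Hb. transitivity (a * b / b); [field; exact Hb|rewrite H; field; exact Hb]. Qed.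

Definition circle (r t : R) : C := ((r * cos t)%R, (r * sin t)%R).

Lemma Pderive_circle (r t : R) : Pderive (circle r) t (Ci * circle r t).
Proof.
  split; unfold circle, Re, Im; simpl; auto_derive; trivial; ring.
Qed.

Lemma Cmod_circle (r t : R) : (0 <= r)%R -> Cmod (circle r t) = r.
Proof.
  intros Hr. unfold Cmod, circle; simpl fst; simpl snd.
  replace ((r * cos t) ^ 2 + (r * sin t) ^ 2)%R with (r ^ 2)%R.
  - apply sqrt_pow2; exact Hr.
  - assert (K := sin2_cos2 t). unfold Rsqr in K. simpl. nra.
Qed.

Lemma circle_2PI (r : R) : circle r (2 * PI) = circle r 0.
Proof. unfold circle. rewrite cos_2PI, sin_2PI, cos_0, sin_0. reflexivity. Qed.

(** As dw = i w dt on the circle, this is the contour integral of g(w) / w divided by 2 pi i.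
    Cauchy's kernel 1 / (w - z) therefore appears below as [w / (w - z)]. *)
Definition circle_mean (r : R) (g : C -> C) : C :=
  RtoC (/ (2 * PI)) * CInt (fun t => g (circle r t)) 0 (2 * PI).

Definition Ccont_circle (r : R) (g : C -> C) : Prop := forall z, Cmod z = r -> Ccont g z.

Definition bounded_on_circle (r M : R) (g : C -> C) : Prop :=
  forall t, (0 <= t <= 2 * PI)%R -> (Cmod (g (circle r t)) <= M)%R.

Lemma two_PI_pos : (0 < 2 * PI)%R.
Proof. assert (K := PI_RGT_0). lra. Qed.

Lemma Pcont_circle (r t : R) (g : C -> C) : (0 <= r)%R ->
  Ccont_circle r g -> Pcont (fun s => g (circle r s)) t.
Proof.
  intros Hr Hg. apply (Pcont_comp g (circle r) t (Ci * circle r t)).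
  - apply Hg, Cmod_circle, Hr.
  - apply Pderive_circle.
Qed.

Lemma ex_CInt_circle (r : R) (g : C -> C) : (0 <= r)%R -> Ccont_circle r g ->
  ex_CInt (fun t => g (circle r t)) 0 (2 * PI).
Proof.
  intros Hr Hg. apply ex_CInt_Pcont; [apply Rlt_le, two_PI_pos|].
  intros t _. apply Pcont_circle; assumption.
Qed.

Lemma Cmod_circle_mean_le (r M : R) (g : C -> C) : (0 <= r)%R -> Ccont_circle r g ->
  bounded_on_circle r M g -> (Cmod (circle_mean r g) <= M)%R.
Proof.
  intros Hr Hg HM. assert (K := two_PI_pos). assert (K' := Rinv_0_lt_compat _ K).
  unfold circle_mean. rewrite Cmod_mult, Cmod_R, Rabs_pos_eq by lra.
  assert (H := Cmod_CInt_le (fun t => g (circle r t)) 0 (2 * PI) M (Rlt_le _ _ K)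
    (ex_CInt_circle r g Hr Hg) HM).
  apply (Rmult_le_compat_l (/ (2 * PI))) in H; [|lra].
  eapply Rle_trans; [exact H|]. apply Req_le. field. lra.
Qed.

Lemma circle_mean_ext (r : R) (f g : C -> C) : (0 <= r)%R ->
  (forall z, Cmod z = r -> f z = g z) -> circle_mean r f = circle_mean r g.
Proof.
  intros Hr H. unfold circle_mean. f_equal. apply CInt_ext; [apply Rlt_le, two_PI_pos|].
  intros t _. apply H, Cmod_circle, Hr.
Qed.

Lemma circle_mean_minus (r : R) (f g : C -> C) : (0 <= r)%R ->
  Ccont_circle r f -> Ccont_circle r g ->
  circle_mean r (fun z => f z - g z) = circle_mean r f - circle_mean r g.
Proof.
  intros Hr Hf Hg. unfold circle_mean.
  rewrite (CInt_minus (fun t => f (circle r t)) (fun t => g (circle r t)))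
    by (apply ex_CInt_circle; assumption). ring.
Qed.

Lemma circle_mean_scal (r : R) (c : C) (g : C -> C) : (0 <= r)%R ->
  Ccont_circle r g -> circle_mean r (fun z => c * g z) = c * circle_mean r g.
Proof.
  intros Hr Hg. unfold circle_mean.
  rewrite (CInt_scal c (fun t => g (circle r t))) by (apply ex_CInt_circle; assumption). ring.
Qed.

Lemma circle_mean_const (r : R) (c : C) : circle_mean r (fun _ => c) = c.
Proof.
  unfold circle_mean. rewrite CInt_const, Rminus_0_r. assert (K := two_PI_pos).
  rewrite Cmult_assoc, <- RtoC_mult, Rinv_l by lra. ring.
Qed.

(** The integral of a derivative along a closed path vanishes; the factor [z] comes from dw = i w
    dt. *)
Lemma circle_mean_derive (r : R) (F g : C -> C) : (0 <= r)%R ->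
  (forall z, Cmod z = r -> is_Cderive F z (g z)) -> Ccont_circle r g ->
  circle_mean r (fun z => g z * z) = 0.
Proof.
  intros Hr HF Hg.
  assert (Hc : forall t, Pcont (fun t => g (circle r t) * circle r t) t).
  { intro t. apply Pcont_mult; [apply Pcont_circle; assumption|].
    apply (Pcont_circle r t (fun z => z) Hr). intros z _. apply Cdiff_Ccont, Cdiff_id. }
  assert (Hgz : Ci * CInt (fun t => g (circle r t) * circle r t) 0 (2 * PI) = 0).
  { rewrite <- CInt_scal
      by (apply ex_CInt_Pcont; [apply Rlt_le, two_PI_pos|intros t _; apply Hc]).
    rewrite (CInt_derive (fun t => F (circle r t))).
    - rewrite circle_2PI. ring.
    - apply Rlt_le, two_PI_pos.
    - intros t _.
      replace (Ci * (g (circle r t) * circle r t)) with (g (circle r t) * (Ci * circle r t)) by ring.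
      apply Pderive_comp; [apply HF, Cmod_circle, Hr|apply Pderive_circle].
    - intros t _. apply Pcont_mult; [apply Pcont_const|apply Hc]. }
  unfold circle_mean.
  replace (CInt (fun t => g (circle r t) * circle r t) 0 (2 * PI)) with (RtoC 0); [ring|].
  symmetry. apply Cmult_eq_0_l with Ci; [|apply Ci_nz]. rewrite <- Hgz. ring.
Qed.

Lemma Ccont_circle_bounded (r : R) (g : C -> C) : (0 <= r)%R -> Ccont_circle r g ->
  exists M, bounded_on_circle r M g.
Proof.
  intros Hr Hg.
  assert (Hc : forall t, (0 <= t <= 2 * PI)%R -> continuity_pt
    (fun t => Rabs (Re (g (circle r t))) + Rabs (Im (g (circle r t))))%R t).
  { intros t _. destruct (Pcont_circle r t g Hr Hg) as [H1 H2].
    apply continuity_pt_filterlim in H1. apply continuity_pt_filterlim in H2.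
    apply continuity_pt_plus.
    - exact (continuity_pt_comp _ Rabs t H1 (Rcontinuity_abs _)).
    - exact (continuity_pt_comp _ Rabs t H2 (Rcontinuity_abs _)). }
  destruct (continuity_ab_maj _ 0 (2 * PI) (Rlt_le _ _ two_PI_pos) Hc) as [t0 [Hmax _]].
  eexists. intros t Ht. eapply Rle_trans; [apply Cmod_le_Re_Im|]. exact (Hmax t Ht).
Qed.

Definition C_eq_dec (a b : C) : {a = b} + {a <> b}.
Proof.
  destruct (Req_EM_T (Re a) (Re b)) as [H1|H1].
  - destruct (Req_EM_T (Im a) (Im b)) as [H2|H2].
    + left; apply C_eq; assumption.
    + right; congruence.
  - right; congruence.
Defined.

(** [d] is meant to be the derivative of [f] at [z], which makes the quotient continuous there. *)
Definition divdiff (f : C -> C) (z d w : C) : C :=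
  if C_eq_dec w z then d else (f w - f z) / (w - z).

Lemma divdiff_neq (f : C -> C) (z d w : C) : w <> z -> divdiff f z d w = (f w - f z) / (w - z).
Proof. intros H. unfold divdiff. destruct (C_eq_dec w z); [contradiction|reflexivity]. Qed.

Lemma divdiff_eq (f : C -> C) (z d : C) : divdiff f z d z = d.
Proof. unfold divdiff. destruct (C_eq_dec z z); [reflexivity|contradiction]. Qed.

Lemma Ccont_divdiff (f : C -> C) (z d : C) : is_Cderive f z d -> Ccont (divdiff f z d) z.
Proof.
  intros Hd eps Heps.
  destruct (proj1 (is_Cderive_iff f z d) Hd (eps / 2)%R) as [del [Hdel K]]; [lra|].
  exists del; split; [exact Hdel|]. intros w Hw. rewrite divdiff_eq.
  destruct (C_eq_dec w z) as [E|E].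
  - rewrite E, divdiff_eq. rewrite Cmod_center; exact Heps.
  - rewrite divdiff_neq by exact E. specialize (K w Hw).
    assert (E' := Cminus_eq_contra _ _ E). assert (P := proj1 (Cmod_gt_0 _) E').
    replace ((f w - f z) / (w - z) - d) with ((f w - f z - d * (w - z)) / (w - z))
      by (field; exact E').
    rewrite Cmod_div by exact E'. apply Rlt_div_l; [exact P|].
    eapply Rle_lt_trans; [exact K|]. apply Rmult_lt_compat_r; lra.
Qed.

Lemma Cdiff_divdiff (f : C -> C) (z d w : C) : w <> z -> Cdiff f w -> Cdiff (divdiff f z d) w.
Proof.
  intros Hw Hf.
  apply Cdiff_ext_loc with (f := fun x => (f x - f z) / (x - z)) (e := Cmod (w - z)).
  - apply Cmod_gt_0. apply Cminus_eq_contra; exact Hw.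
  - intros x Hx. symmetry; apply divdiff_neq. intro E; subst x.
    rewrite Cmod_minus_sym in Hx. lra.
  - apply Cdiff_div.
    + apply Cdiff_minus; [exact Hf|apply Cdiff_const].
    + apply Cdiff_sub_const.
    + apply Cminus_eq_contra; exact Hw.
Qed.

Definition holo (r : R) (f : C -> C) : Prop := forall z, (Cmod z < r)%R -> Cdiff f z.

(** The divided difference is differentiable off [z] and continuous at [z], hence has a primitive on
    the disc of radius [R0]. *)
Lemma circle_mean_divdiff (f : C -> C) (R0 r : R) (z d : C) :
  holo R0 f -> (0 <= r < R0)%R -> (Cmod z < R0)%R -> is_Cderive f z d ->
  circle_mean r (fun w => divdiff f z d w * w) = 0.
Proof.
  intros Hf Hr Hz Hd.
  assert (Hc : forall w, (Cmod w < R0)%R -> Ccont (divdiff f z d) w).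
  { intros w Hw. destruct (C_eq_dec w z) as [E|E].
    - subst w; apply Ccont_divdiff; exact Hd.
    - apply Cdiff_Ccont, Cdiff_divdiff; [exact E|apply Hf; exact Hw]. }
  apply circle_mean_derive with (SInt (divdiff f z d) z).
  - lra.
  - intros w Hw. apply is_Cderive_SInt with R0; try assumption.
    + intros x Hx E. apply Cdiff_divdiff; [exact E|apply Hf; exact Hx].
    + lra.
  - intros w Hw. apply Hc. lra.
Qed.

(** The contour integrand w^(-n-2) has the primitive -w^(-n-1) / (n + 1). For exponent 0 the mean is
    1, hence the [S n]. *)
Lemma circle_mean_inv_pow (r : R) (n : nat) : (0 < r)%R ->
  circle_mean r (fun w => (/ w) ^ S n) = 0.
Proof.
  intros Hr.
  assert (Hnz : forall w, Cmod w = r -> w <> 0) by (intros w Hw; apply Cmod_gt_0; lra).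
  assert (Hn : RtoC (INR (S n)) <> 0) by (intro E; apply RtoC_inj in E; revert E; apply not_0_INR; lia).
  rewrite (circle_mean_ext r _ (fun w => (/ w) ^ S (S n) * w)).
  - apply circle_mean_derive with (fun w => (- / RtoC (INR (S n))) * (/ w) ^ S n).
    + lra.
    + intros w Hw. specialize (Hnz w Hw). eapply is_Cderive_eq.
      * apply is_Cderive_scal. apply is_Cderive_pow. apply is_Cderive_inv; [apply is_Cderive_id|exact Hnz].
      * cbv beta. simpl Cpow. field. split; assumption.
    + intros w Hw. apply Cdiff_Ccont, Cdiff_pow.
      exists (- (1) / w ^ 2). apply (is_Cderive_inv (fun x => x)); [apply is_Cderive_id|apply Hnz; exact Hw].
  - lra.
  - intros w Hw. simpl. field. apply Hnz; exact Hw.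
Qed.

(** * Finite expansions with geometric remainder, Taylor coefficients *)

Fixpoint Csum (a : nat -> C) (n : nat) : C :=
  match n with O => 0 | S k => Csum a k + a k end.

Lemma Cseries_Csum (a : nat -> C) (n : nat) : Csummable a ->
  Cseries a = Csum a n + Cseries (fun k => a (n + k)%nat).
Proof.
  intros Ha. assert (Hs : forall n, Csummable (fun k => a (n + k)%nat)).
  { intro m. exact (proj1 (@ex_series_incr_n R_AbsRing R_NormedModule (fun k => Cmod (a k)) m) Ha). }
  induction n as [|n IH]; simpl.
  - rewrite (Cseries_ext (fun k => a k) a) by reflexivity. ring.
  - rewrite IH, (Cseries_S _ (Hs n)), Nat.add_0_r.
    rewrite (Cseries_ext (fun k => a (n + S k)%nat) (fun k => a (S (n + k))%nat))
      by (intro k; f_equal; lia). ring.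
Qed.

Lemma eq_of_geometric (a b : C) (K q : R) : (0 <= q < 1)%R ->
  (forall n, Cmod (a - b) <= K * q ^ n)%R -> a = b.
Proof.
  intros Hq H. apply Ceq_minus, eq_0_of_Cmod_small. intros e He.
  destruct (geometric_small K e q Hq He) as [n Hn]. specialize (H n). lra.
Qed.

Lemma Cseries_geometric (a : nat -> C) (s : C) (M K q : R) : (0 <= q < 1)%R ->
  (forall n, Cmod (a n) <= M * q ^ n)%R ->
  (forall n, Cmod (s - Csum a n) <= K * q ^ n)%R -> s = Cseries a.
Proof.
  intros Hq Ha Hs.
  assert (Sa : Csummable a).
  { apply (Csummable_le _ (fun n => M * q ^ n)%R Ha).
    eexists; apply is_series_geom_scal; exact Hq. }
  apply (eq_of_geometric _ _ (K + M / (1 - q)) q Hq). intro n.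
  rewrite (Cseries_Csum a n Sa).
  replace (s - (Csum a n + Cseries (fun k => a (n + k)%nat)))
    with ((s - Csum a n) + - Cseries (fun k => a (n + k)%nat)) by ring.
  eapply Rle_trans; [apply Cmod_triangle|]. rewrite Cmod_opp, Rmult_plus_distr_r.
  apply Rplus_le_compat; [apply Hs|].
  replace (M / (1 - q) * q ^ n)%R with (M * q ^ n / (1 - q))%R by (field; lra).
  rewrite <- (is_series_unique _ _ (is_series_geom_scal (M * q ^ n) q Hq)).
  apply Cmod_Cseries_le.
  - intro k. rewrite Rmult_assoc, <- pow_add. apply Ha.
  - eexists; apply is_series_geom_scal; exact Hq.
Qed.

(** Cauchy's integral of f(w) / w^(n+1), divided by 2 pi i. *)
Definition taylor_coef (f : C -> C) (r : R) (n : nat) : C :=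
  circle_mean r (fun w => f w * (/ w) ^ n).

Lemma Ccont_circle_Cdiff (r : R) (f : C -> C) :
  (forall z, Cmod z = r -> Cdiff f z) -> Ccont_circle r f.
Proof. intros H z Hz. apply Cdiff_Ccont, H, Hz. Qed.

Lemma Cdiff_inv_id (w : C) : w <> 0 -> Cdiff (fun x => / x) w.
Proof.
  intros H. exists (- (1) / w ^ 2). apply (is_Cderive_inv (fun x => x)); [apply is_Cderive_id|exact H].
Qed.

Lemma Cmod_taylor_coef_le (f : C -> C) (r M : R) (n : nat) : (0 < r)%R ->
  (forall z, Cmod z = r -> Cdiff f z) -> bounded_on_circle r M f ->
  (Cmod (taylor_coef f r n) <= M * (/ r) ^ n)%R.
Proof.
  intros Hr Hf HM. apply Cmod_circle_mean_le; [lra| |].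
  - apply Ccont_circle_Cdiff. intros z Hz. apply Cdiff_mult; [apply Hf, Hz|].
    apply Cdiff_pow, Cdiff_inv_id. apply Cmod_gt_0. lra.
  - intros t Ht. assert (Hz := Cmod_circle r t (Rlt_le _ _ Hr)).
    rewrite Cmod_mult, Cmod_pow, Cmod_inv, Hz by (apply Cmod_gt_0; lra).
    apply Rmult_le_compat_r; [|apply HM, Ht].
    apply pow_le. apply Rlt_le, Rinv_0_lt_compat; exact Hr.
Qed.

(** The finite geometric sum: w / (w - z) is the sum of (z/w)^k over k < n plus (z/w)^n w / (w - z).
    Only the circle enters, so one estimate serves the constant 1 in [circle_mean_kernel], the case
    n = 0 in [cauchy_bound] and the Taylor series. *)
Lemma cauchy_kernel_expansion (f : C -> C) (r M : R) (z : C) : (0 < r)%R -> (Cmod z < r)%R ->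
  (forall w, Cmod w = r -> Cdiff f w) -> bounded_on_circle r M f ->
  forall n,
  (Cmod (circle_mean r (fun w => f w * (w / (w - z)))%C
     - Csum (fun k => taylor_coef f r k * z ^ k)%C n)
   <= (M * r / (r - Cmod z)) * (Cmod z / r) ^ n)%R.
Proof.
  intros Hr Hz Hf HM n.
  assert (Hw0 : forall w, Cmod w = r -> w <> 0) by (intros w Hw; apply Cmod_gt_0; lra).
  assert (Hwz : forall w, Cmod w = r -> w - z <> 0).
  { intros w Hw E. apply Ceq_minus in E. subst w. lra. }
  assert (Hd : forall n w, Cmod w = r -> Cdiff (fun w => f w * ((z * / w) ^ n * (w / (w - z)))) w).
  { intros m w Hw. apply Cdiff_mult; [apply Hf, Hw|]. apply Cdiff_mult.
    - apply Cdiff_pow, Cdiff_mult; [apply Cdiff_const|apply Cdiff_inv_id, Hw0, Hw].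
    - apply Cdiff_div; [apply Cdiff_id| |apply Hwz, Hw].
      apply Cdiff_sub_const. }
  assert (E : circle_mean r (fun w => f w * (w / (w - z)))
     - Csum (fun k => taylor_coef f r k * z ^ k) n =
     circle_mean r (fun w => f w * ((z * / w) ^ n * (w / (w - z))))).
  { induction n as [|n IH].
    - simpl. rewrite (circle_mean_ext r (fun w => f w * (1 * (w / (w - z))))
       (fun w => f w * (w / (w - z)))) by (try lra; intros; ring). ring.
    - simpl Csum.
      transitivity (circle_mean r (fun w => f w * ((z * / w) ^ n * (w / (w - z))))
        - z ^ n * taylor_coef f r n); [rewrite <- IH; ring|].
      unfold taylor_coef. rewrite <- circle_mean_scal.
      + rewrite <- circle_mean_minus.
        * apply circle_mean_ext; [lra|]. intros w Hw.
          rewrite (Cpow_mult_l z (/ w) n), (Cpow_mult_l z (/ w) (S n)). simpl.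
          field. split; [apply Hwz, Hw|apply Hw0, Hw].
        * lra.
        * apply Ccont_circle_Cdiff. apply Hd.
        * apply Ccont_circle_Cdiff. intros w Hw. apply Cdiff_mult; [apply Cdiff_const|].
          apply Cdiff_mult; [apply Hf, Hw|apply Cdiff_pow, Cdiff_inv_id, Hw0, Hw].
      + lra.
      + apply Ccont_circle_Cdiff. intros w Hw.
        apply Cdiff_mult; [apply Hf, Hw|apply Cdiff_pow, Cdiff_inv_id, Hw0, Hw]. }
  rewrite E. apply Cmod_circle_mean_le; [lra|apply Ccont_circle_Cdiff, Hd|].
  intros t Ht. assert (Hw := Cmod_circle r t (Rlt_le _ _ Hr)).
  assert (HMt := HM t Ht). set (w := circle r t) in *.
  rewrite !Cmod_mult, Cmod_pow, Cmod_mult, Cmod_inv, Cmod_div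
    by (first [exact (Hw0 _ Hw)|exact (Hwz _ Hw)]). rewrite Hw.
  assert (K := Cmod_triangle_inv w z). rewrite Hw in K.
  assert (Mz := Cmod_ge_0 z).
  assert (M0 : (0 <= M)%R) by (eapply Rle_trans; [apply Cmod_ge_0|exact HMt]).
  assert (Hp : (0 <= (Cmod z * / r) ^ n)%R).
  { apply pow_le. apply Rmult_le_pos; [exact Mz|]. apply Rlt_le, Rinv_0_lt_compat; exact Hr. }
  replace (M * r / (r - Cmod z) * (Cmod z / r) ^ n)%R
    with (M * ((Cmod z * / r) ^ n * (r / (r - Cmod z))))%R by (unfold Rdiv; ring).
  apply Rmult_le_compat; [apply Cmod_ge_0| |exact HMt|].
  - apply Rmult_le_pos; [exact Hp|]. apply Rlt_le, Rdiv_lt_0_compat; lra.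
  - apply Rmult_le_compat_l; [exact Hp|]. apply Rmult_le_compat_l; [lra|].
    apply Rinv_le_contravar; lra.
Qed.

(** In place of a winding number, the kernel is expanded with f = 1: the Taylor coefficients are 1,
    0, 0, ... and the remainder tends to 0. *)
Lemma circle_mean_kernel (r : R) (z : C) : (0 < r)%R -> (Cmod z < r)%R ->
  circle_mean r (fun w => w / (w - z)) = 1.
Proof.
  intros Hr Hz.
  assert (K := cauchy_kernel_expansion (fun _ => 1) r 1 z Hr Hz).
  specialize (K ltac:(intros; apply Cdiff_const) ltac:(intros t _; rewrite Cmod_1; lra)).
  cbv beta in K.
  rewrite (circle_mean_ext r (fun w => 1 * (w / (w - z))) (fun w => w / (w - z))) in K
    by (try lra; intros; ring).
  assert (Mz := Cmod_ge_0 z).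
  assert (Hq : (0 <= Cmod z / r < 1)%R).
  { split; [apply Rmult_le_pos; [exact Mz|apply Rlt_le, Rinv_0_lt_compat; exact Hr]|].
    apply Rlt_div_l; lra. }
  (* An empty sum would miss the constant term 1, so the expansion is taken at [S n]; this accounts
     for the extra factor [Cmod z / r]. *)
  apply (eq_of_geometric _ _ (1 * r / (r - Cmod z) * (Cmod z / r)) _ Hq).
  intro n. specialize (K (S n)).
  replace (Csum (fun k => taylor_coef (fun _ => 1) r k * z ^ k) (S n)) with (RtoC 1) in K.
  - eapply Rle_trans; [exact K|]. apply Req_le. simpl. ring.
  - clear K. induction n as [|n IH].
    + simpl. unfold taylor_coef. rewrite (circle_mean_ext r _ (fun _ => 1)).
      * rewrite circle_mean_const. ring.
      * lra.
      * intros; simpl; ring.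
    + change (RtoC 1 = Csum (fun k => taylor_coef (fun _ => 1) r k * z ^ k) (S n)
        + taylor_coef (fun _ => 1) r (S n) * z ^ S n).
      rewrite <- IH. unfold taylor_coef.
      rewrite (circle_mean_ext r _ (fun w => (/ w) ^ S n)).
      * rewrite circle_mean_inv_pow by exact Hr. ring.
      * lra.
      * intros; simpl; ring.
Qed.

(** The mean of (f w - f z) w / (w - z) is 0 by [circle_mean_divdiff], and the kernel has mean 1. *)
Theorem cauchy_formula (f : C -> C) (R0 r : R) (z : C) : holo R0 f -> (0 < r < R0)%R ->
  (Cmod z < r)%R -> circle_mean r (fun w => f w * (w / (w - z))) = f z.
Proof.
  intros Hf Hr Hz. destruct (Hf z) as [d Hd]; [lra|].
  assert (Hwz : forall w, Cmod w = r -> w <> z) by (intros w Hw E; subst w; lra).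
  assert (K := circle_mean_divdiff f R0 r z d Hf ltac:(lra) ltac:(lra) Hd).
  assert (Hk : forall w, Cmod w = r -> Cdiff (fun w => w / (w - z)) w).
  { intros w Hw. apply Cdiff_div; [apply Cdiff_id| |].
    - apply Cdiff_sub_const.
    - apply Cminus_eq_contra, Hwz, Hw. }
  rewrite (circle_mean_ext r _ (fun w => f w * (w / (w - z)) - f z * (w / (w - z)))) in K.
  - rewrite circle_mean_minus, circle_mean_scal, circle_mean_kernel in K; try assumption; try lra.
    + apply Ceq_minus. rewrite <- K. ring.
    + apply Ccont_circle_Cdiff, Hk.
    + apply Ccont_circle_Cdiff. intros w Hw. apply Cdiff_mult; [apply Hf; lra|apply Hk, Hw].
    + apply Ccont_circle_Cdiff. intros w Hw. apply Cdiff_mult; [apply Cdiff_const|apply Hk, Hw].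
  - lra.
  - intros w Hw. rewrite divdiff_neq by (apply Hwz, Hw). field.
    apply Cminus_eq_contra, Hwz, Hw.
Qed.

(** * Zeros, removable singularities, Liouville's theorem *)

Lemma punctured_disc_open (p z : C) (e : R) : (0 < Cmod (z - p) < e)%R ->
  exists e', (0 < e')%R /\ forall w, (Cmod (w - z) < e')%R -> (0 < Cmod (w - p) < e)%R.
Proof.
  intros Hz. exists (Rmin (Cmod (z - p)) (e - Cmod (z - p))).
  split; [apply Rmin_pos; lra|]. intros w Hw.
  assert (L1 := Rmin_l (Cmod (z - p)) (e - Cmod (z - p))).
  assert (L2 := Rmin_r (Cmod (z - p)) (e - Cmod (z - p))).
  assert (T := Cmod_minus_triangle w z p).
  assert (T2 := Cmod_minus_triangle z w p). rewrite (Cmod_minus_sym z w) in T2. lra.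
Qed.

Definition holo_disc (p : C) (r : R) (f : C -> C) : Prop :=
  forall z, (Cmod (z - p) < r)%R -> Cdiff f z.

Lemma Cdiff_shift (f : C -> C) (p z : C) : Cdiff f (p + z) -> Cdiff (fun w => f (p + w)) z.
Proof.
  intros H. apply (Cdiff_comp f (fun w => p + w)); [exact H|].
  apply Cdiff_plus; [apply Cdiff_const|apply Cdiff_id].
Qed.

Lemma holo_shift (f : C -> C) (p : C) (r : R) :
  holo_disc p r f -> holo r (fun w => f (p + w)).
Proof.
  intros H z Hz. apply Cdiff_shift, H. replace (p + z - p) with z by ring. exact Hz.
Qed.

Lemma cauchy_bound (f : C -> C) (R0 r M : R) (z : C) : holo R0 f -> (0 < r < R0)%R ->
  (Cmod z < r)%R -> bounded_on_circle r M f -> (Cmod (f z) <= M * r / (r - Cmod z))%R.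
Proof.
  intros Hf Hr Hz HM.
  assert (K := cauchy_kernel_expansion f r M z ltac:(lra) Hz
    ltac:(intros w Hw; apply Hf; lra) HM 0).
  rewrite (cauchy_formula f R0 r z Hf Hr Hz) in K. simpl in K.
  replace (f z - 0) with (f z) in K by ring. lra.
Qed.

Lemma taylor_expansion (f : C -> C) (R0 r : R) : holo R0 f -> (0 < r < R0)%R ->
  exists c M, (forall n, Cmod (c n) * r ^ n <= M)%R /\
    forall z, (Cmod z < r)%R -> f z = Cpseries c z.
Proof.
  intros Hf Hr.
  assert (Hc : forall w, Cmod w = r -> Cdiff f w) by (intros w Hw; apply Hf; lra).
  destruct (Ccont_circle_bounded r f) as [M HM]; [lra|apply Ccont_circle_Cdiff, Hc|].
  assert (Hb : forall n, (Cmod (taylor_coef f r n) <= M * (/ r) ^ n)%R)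
    by (intro n; apply Cmod_taylor_coef_le; (lra || assumption)).
  exists (taylor_coef f r), M. split.
  - intro n. specialize (Hb n).
    assert (Hp : (0 < r ^ n)%R) by (apply pow_lt; lra).
    apply (Rmult_le_compat_r (r ^ n)) in Hb; [|lra].
    rewrite Rmult_assoc, <- Rpow_mult_distr, Rinv_l, pow1 in Hb by lra. lra.
  - intros z Hz. assert (Mz := Cmod_ge_0 z).
    apply Cseries_geometric with M (M * r / (r - Cmod z))%R (Cmod z / r)%R.
    + split; [apply Rmult_le_pos; [exact Mz|apply Rlt_le, Rinv_0_lt_compat; lra]|].
      apply Rlt_div_l; lra.
    + intro n. rewrite Cmod_mult, Cmod_pow. unfold Rdiv. rewrite Rpow_mult_distr.
      replace (M * (Cmod z ^ n * (/ r) ^ n))%R with (M * (/ r) ^ n * Cmod z ^ n)%R by ring.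
      apply Rmult_le_compat_r; [apply pow_le; exact Mz|apply Hb].
    + intro n. rewrite <- (cauchy_formula f R0 r z Hf Hr Hz).
      apply cauchy_kernel_expansion; (lra || assumption).
Qed.

Lemma Rbar_lt_Cradius (c : nat -> C) (r : R) (z : C) :
  Rbar_le r (Cradius c) -> (Cmod z < r)%R -> Rbar_lt (Cmod z) (Cradius c).
Proof. intros H Hz. apply Rbar_lt_le_trans with r; [exact Hz|exact H]. Qed.

(** On half the radius [f] is a power series, and formal differentiation keeps the radius of
    convergence. *)
Theorem Cdiff_C_derive (f : C -> C) (p : C) (r : R) : (0 < r)%R ->
  holo_disc p r f -> Cdiff (C_derive f) p.
Proof.
  intros Hr Hf.
  destruct (taylor_expansion _ r (r / 2) (holo_shift f p r Hf)) as [c [M [Hb Hs]]]; [lra|].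
  assert (Hc := Cradius_bound c (r / 2) M ltac:(lra) Hb).
  assert (H0 : forall z, (Cmod (z - p) < r / 2)%R ->
     C_derive f z = Cpseries (Cpderiv c) (z - p)).
  { intros z Hz. apply is_C_derive_unique.
    apply (is_Cderive_ext_loc (fun w => Cpseries c (w - p)) f z _ (r / 2 - Cmod (z - p))%R).
    - lra.
    - intros w Hw. rewrite <- Hs.
      + f_equal. ring.
      + assert (K := Cmod_minus_triangle w z p). lra.
    - eapply is_Cderive_eq.
      + apply (is_Cderive_comp (Cpseries c) (fun w => w - p)).
        * apply is_Cderive_Cpseries. apply Rbar_lt_Cradius with (1 := Hc). exact Hz.
        * apply is_Cderive_sub_const.
      + ring. }
  apply Cdiff_ext_loc with (f := fun z => Cpseries (Cpderiv c) (z - p)) (e := (r / 2)%R).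
  - lra.
  - intros w Hw. symmetry; apply H0, Hw.
  - apply (Cdiff_comp (Cpseries (Cpderiv c)) (fun w => w - p)).
    + eexists. apply is_Cderive_Cpseries. rewrite Cradius_Cpderiv.
      apply Rbar_lt_Cradius with (1 := Hc).
      rewrite Cmod_center. lra.
    + apply Cdiff_sub_const.
Qed.

(** Dividing the Taylor series of f z - f p by z - p shifts the coefficients, and the shifted series
    is differentiable at [p]. *)
Lemma Cdiff_divdiff_center (f : C -> C) (p d : C) (r : R) : (0 < r)%R ->
  holo_disc p r f -> is_Cderive f p d -> Cdiff (divdiff f p d) p.
Proof.
  intros Hr Hf Hd.
  destruct (taylor_expansion _ r (r / 2) (holo_shift f p r Hf)) as [c [M [Hb Hs]]]; [lra|].
  assert (Hc := Cradius_bound c (r / 2) M ltac:(lra) Hb).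
  set (g z := Cpseries (fun n => c (S n)) (z - p)).
  assert (Hc' : Rbar_le (r / 2)%R (Cradius (fun n => c (S n)))).
  { apply Cradius_bound with (M / (r / 2))%R; [lra|]. intro n.
    apply (proj1 (Rle_div_r _ _ (r / 2) ltac:(lra))).
    specialize (Hb (S n)). simpl in Hb. lra. }
  assert (Hg : Cdiff g p).
  { apply (Cdiff_comp (Cpseries (fun n => c (S n))) (fun w => w - p)).
    - eexists. apply is_Cderive_Cpseries. apply Rbar_lt_Cradius with (1 := Hc').
      rewrite Cmod_center. lra.
    - apply Cdiff_sub_const. }
  assert (E : forall z, (Cmod (z - p) < r / 2)%R -> f z - f p = (z - p) * g z).
  { intros z Hz. assert (H1 : f z = Cpseries c (z - p)).
    { rewrite <- Hs by lra. f_equal; ring. }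
    assert (H2 : f p = c O).
    { rewrite <- Cpseries_0, <- Hs; [f_equal; ring|rewrite Cmod_0; lra]. }
    rewrite H1, H2. unfold g, Cpseries.
    rewrite Cseries_S by (apply Csummable_Cradius, (Rbar_lt_Cradius _ _ _ Hc); lra).
    rewrite <- Cseries_scal by (apply Csummable_Cradius, (Rbar_lt_Cradius _ _ _ Hc'); lra).
    rewrite (Cseries_ext (fun n => (z - p) * (c (S n) * (z - p) ^ n))
      (fun n => c (S n) * (z - p) ^ S n)) by (intro n; simpl; ring).
    simpl. ring. }
  apply Cdiff_ext_loc with (f := g) (e := (r / 2)%R); [lra| |exact Hg].
  intros w Hw. destruct (C_eq_dec w p) as [Ew|Ew].
  - subst w. rewrite divdiff_eq. symmetry.
    (* At the centre, [d] and [g p] are both the derivative of this function. *)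
    apply (is_Cderive_unique (fun z => f p + (z - p) * g z) p).
    + apply is_Cderive_ext_loc with (f := f) (e := (r / 2)%R); [lra| |exact Hd].
      intros w Hw'. rewrite <- E by exact Hw'. ring.
    + destruct Hg as [b Hgb]. eapply is_Cderive_eq.
      * apply is_Cderive_plus; [apply is_Cderive_const|].
        apply is_Cderive_mult; [|exact Hgb].
        apply is_Cderive_sub_const.
      * cbv beta; ring.
  - rewrite divdiff_neq by exact Ew. rewrite E by exact Hw. field.
    apply Cminus_eq_contra; exact Ew.
Qed.

Lemma holo_disc_factor (f : C -> C) (p : C) (r : R) : (0 < r)%R ->
  holo_disc p r f -> f p = 0 ->
  exists g, holo_disc p r g /\ is_Cderive f p (g p) /\
    forall z, (Cmod (z - p) < r)%R -> f z = (z - p) * g z.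
Proof.
  intros Hr Hf H0.
  destruct (Hf p) as [d Hd]; [rewrite Cmod_center; lra|].
  exists (divdiff f p d). split; [|split].
  - intros z Hz. destruct (C_eq_dec z p) as [E|E].
    + subst z. apply (Cdiff_divdiff_center f p d r); assumption.
    + apply Cdiff_divdiff; [exact E|apply Hf, Hz].
  - rewrite divdiff_eq. exact Hd.
  - intros z Hz. destruct (C_eq_dec z p) as [E|E].
    + subst z. rewrite H0. ring.
    + rewrite divdiff_neq by exact E. rewrite H0. field. apply Cminus_eq_contra; exact E.
Qed.

(** Either some power of z - p splits off leaving a factor nonzero at [p], or every power splits
    off. In the second case Cauchy's bound gives |f z| <= C (|z - p| / s)^n for all n, so [f]
    vanishes on the whole disc at once, without a connectedness argument. *)
Theorem isolated_zeros (f : C -> C) (p : C) (r : R) : (0 < r)%R -> holo_disc p r f ->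
  (forall z, (Cmod (z - p) < r)%R -> f z = 0) \/
  exists e, (0 < e)%R /\ forall z, (0 < Cmod (z - p) < e)%R -> f z <> 0.
Proof.
  intros Hr Hf.
  destruct (classic (exists k g, holo_disc p r g /\ g p <> 0 /\
    forall z, (Cmod (z - p) < r)%R -> f z = (z - p) ^ k * g z)) as [[k [g [Hg [Hp E]]]]|Hno].
  - right.
    destruct (Ccont_neq_0 g p) as [e [He K]]; [|exact Hp|].
    { apply Cdiff_Ccont, Hg. rewrite Cmod_center. lra. }
    exists (Rmin e r). split; [apply Rmin_pos; assumption|]. intros z [Hz1 Hz2].
    rewrite E by (eapply Rlt_le_trans; [exact Hz2|apply Rmin_r]).
    apply Cmult_neq_0.
    + apply Cpow_nz, Cmod_gt_0. exact Hz1.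
    + apply K. eapply Rlt_le_trans; [exact Hz2|apply Rmin_l].
  - left.
    assert (Hall : forall n, exists g, holo_disc p r g /\
       forall z, (Cmod (z - p) < r)%R -> f z = (z - p) ^ n * g z).
    { induction n as [|n [g [Hg E]]].
      - exists f. split; [exact Hf|]. intros z _. simpl; ring.
      - destruct (C_eq_dec (g p) 0) as [Z|Z].
        + destruct (holo_disc_factor g p r Hr Hg Z) as [h [Hh [_ Eh]]].
          exists h. split; [exact Hh|]. intros z Hz. rewrite E, Eh by exact Hz. simpl; ring.
        + exfalso. apply Hno. exists n, g. auto. }
    intros z Hz. assert (Mz := Cmod_ge_0 (z - p)).
    set (s := ((Cmod (z - p) + r) / 2)%R).
    assert (Hs : (Cmod (z - p) < s < r)%R) by (unfold s; lra).
    assert (Hfs := holo_shift f p r Hf).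
    destruct (Ccont_circle_bounded s (fun w => f (p + w))) as [M HM]; [lra| |].
    { apply Ccont_circle_Cdiff. intros w Hw. apply Hfs. lra. }
    apply (eq_of_geometric _ _ (M * s / (s - Cmod (z - p))) (Cmod (z - p) / s)).
    { split; [apply Rmult_le_pos; [exact Mz|apply Rlt_le, Rinv_0_lt_compat; lra]|].
      apply Rlt_div_l; lra. }
    intro n. destruct (Hall n) as [g [Hg E]].
    replace (f z - 0) with (f z) by ring. rewrite E, Cmod_mult, Cmod_pow by exact Hz.
    assert (B := cauchy_bound _ r s (M * (/ s) ^ n) (z - p) (holo_shift g p r Hg)
       ltac:(lra) ltac:(lra)). cbv beta in B.
    replace (p + (z - p)) with z in B by ring.
    (* On the circle of radius [s] the cofactor is [f] divided by a number of modulus s^n. *)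
    assert (B' : bounded_on_circle s (M * (/ s) ^ n) (fun w => g (p + w))).
    { intros t Ht. specialize (HM t Ht). cbv beta in *.
      assert (Hc := Cmod_circle s t ltac:(lra)).
      rewrite E in HM by (replace (p + circle s t - p) with (circle s t) by ring; lra).
      replace (p + circle s t - p) with (circle s t) in HM by ring.
      rewrite Cmod_mult, Cmod_pow, Hc in HM.
      assert (Hp : (0 < (/ s) ^ n)%R) by (apply pow_lt, Rinv_0_lt_compat; lra).
      apply (Rmult_le_compat_r ((/ s) ^ n)) in HM; [|lra].
      assert (Q : (s ^ n * (/ s) ^ n = 1)%R)
        by (rewrite <- Rpow_mult_distr, Rinv_r, pow1 by lra; reflexivity).
      replace (s ^ n * Cmod (g (p + circle s t)%C) * (/ s) ^ n)%R
        with (s ^ n * (/ s) ^ n * Cmod (g (p + circle s t)%C))%R in HM by ring.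
      rewrite Q in HM. lra. }
    specialize (B B').
    apply (Rmult_le_compat_l (Cmod (z - p) ^ n)) in B; [|apply pow_le; exact Mz].
    eapply Rle_trans; [exact B|]. apply Req_le.
    unfold Rdiv. rewrite Rpow_mult_distr. ring.
Qed.

Theorem identity_disc (f : C -> C) (p : C) (r e : R) : (0 < r)%R -> (0 < e)%R ->
  holo_disc p r f -> (forall z, (0 < Cmod (z - p) < e)%R -> f z = 0) ->
  forall z, (Cmod (z - p) < r)%R -> f z = 0.
Proof.
  intros Hr He Hf H0.
  destruct (isolated_zeros f p r Hr Hf) as [H|[e' [He' H]]]; [exact H|].
  exfalso. set (x := (Rmin e e' / 2)%R).
  assert (Hx : (0 < Rmin e e')%R) by (apply Rmin_pos; assumption).
  assert (X1 := Rmin_l e e'). assert (X2 := Rmin_r e e').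
  assert (K : Cmod (p + RtoC x - p) = x).
  { replace (p + RtoC x - p) with (RtoC x) by ring.
    rewrite Cmod_R, Rabs_pos_eq; unfold x; lra. }
  apply (H (p + RtoC x)); [rewrite K; unfold x; lra|].
  apply H0. rewrite K; unfold x; lra.
Qed.

(** Riemann's argument: (z - p)^2 f, set to 0 at [p], is differentiable there with derivative 0
    because [f] is bounded. Hence z - p can be split off twice. *)
Theorem removable_singularity (f : C -> C) (p : C) (r M : R) : (0 < r)%R ->
  (forall z, (0 < Cmod (z - p) < r)%R -> Cdiff f z /\ (Cmod (f z) <= M)%R) ->
  exists g, holo_disc p r g /\ forall z, (0 < Cmod (z - p) < r)%R -> g z = f z.
Proof.
  intros Hr Hf.
  set (h z := if C_eq_dec z p then RtoC 0 else (z - p) ^ 2 * f z).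
  assert (Hn : forall z, z <> p -> (0 < Cmod (z - p))%R)
    by (intros z Hz; apply Cmod_gt_0, Cminus_eq_contra, Hz).
  assert (Hh0 : h p = 0) by (unfold h; destruct (C_eq_dec p p); [reflexivity|contradiction]).
  assert (Hh1 : forall z, z <> p -> h z = (z - p) ^ 2 * f z)
    by (intros z Hz; unfold h; destruct (C_eq_dec z p); [contradiction|reflexivity]).
  assert (Hd : is_Cderive h p 0).
  { apply is_Cderive_iff. intros eps Heps.
    assert (Mp := Rabs_pos M).
    exists (Rmin r (eps / (Rabs M + 1))). split.
    { apply Rmin_pos; [exact Hr|apply Rdiv_lt_0_compat; lra]. }
    intros w Hw.
    assert (W1 := Rlt_le_trans _ _ _ Hw (Rmin_l _ _)).
    assert (W2 := Rlt_le_trans _ _ _ Hw (Rmin_r _ _)).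
    rewrite Hh0. destruct (C_eq_dec w p) as [E|E].
    - subst w. rewrite Hh0. replace (0 - 0 - 0 * (p - p)) with (RtoC 0) by ring.
      rewrite Cmod_0. apply Rmult_le_pos; [lra|apply Cmod_ge_0].
    - rewrite Hh1 by exact E.
      replace ((w - p) ^ 2 * f w - 0 - 0 * (w - p)) with (((w - p) * f w) * (w - p)) by ring.
      rewrite Cmod_mult. apply Rmult_le_compat_r; [apply Cmod_ge_0|].
      destruct (Hf w (conj (Hn w E) W1)) as [_ B]. rewrite Cmod_mult.
      apply Rle_trans with (eps / (Rabs M + 1) * (Rabs M + 1))%R.
      + apply Rmult_le_compat; try apply Cmod_ge_0; [lra|]. assert (T := Rle_abs M). lra.
      + apply Req_le; field; lra. }
  assert (Hh : holo_disc p r h).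
  { intros z Hz. destruct (C_eq_dec z p) as [E|E]; [subst z; exists (RtoC 0); exact Hd|].
    apply Cdiff_ext_loc with (f := fun z => (z - p) ^ 2 * f z) (e := Cmod (z - p)).
    - apply Hn, E.
    - intros w Hw. symmetry; apply Hh1. intro E'; subst w. rewrite Cmod_minus_sym in Hw. lra.
    - apply Cdiff_mult; [|apply Hf; split; [apply Hn, E|exact Hz]].
      apply (Cdiff_pow (fun w => w - p)), Cdiff_sub_const. }
  destruct (holo_disc_factor h p r Hr Hh Hh0) as [g1 [Hg1 [Hd1 E1]]].
  assert (Z1 : g1 p = 0) by exact (is_Cderive_unique h p _ _ Hd1 Hd).
  destruct (holo_disc_factor g1 p r Hr Hg1 Z1) as [g2 [Hg2 [_ E2]]].
  exists g2. split; [exact Hg2|]. intros z [Hz1 Hz2].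
  assert (Ez : z <> p).
  { intro E; subst z. rewrite Cmod_center in Hz1. lra. }
  assert (E := E1 z Hz2). rewrite (E2 z Hz2), Hh1 in E by exact Ez.
  assert (Hnz := Cminus_eq_contra _ _ Ez).
  transitivity ((z - p) * ((z - p) * g2 z) / ((z - p) * (z - p))); [field; exact Hnz|].
  rewrite <- E. field. exact Hnz.
Qed.

(** Cauchy's bound is applied to the divided difference at 0, an entire function of modulus at most
    2M / r on the circle of radius r; as r grows it is forced to vanish. *)
Theorem liouville (f : C -> C) (M : R) : (forall z, Cdiff f z) ->
  (forall z, (Cmod (f z) <= M)%R) -> forall z, f z = f 0.
Proof.
  intros Hf HM z.
  destruct (Hf 0) as [d Hd].
  assert (Hg : forall w, Cdiff (divdiff f 0 d) w).
  { intro w. destruct (C_eq_dec w 0) as [E|E].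
    - subst w. apply (Cdiff_divdiff_center f 0 d 1); [lra|intros x _; apply Hf|exact Hd].
    - apply Cdiff_divdiff; [exact E|apply Hf]. }
  assert (Mz := Cmod_ge_0 z).
  assert (B : forall r, (Cmod z < r)%R -> (Cmod (divdiff f 0 d z) <= 2 * M / (r - Cmod z))%R).
  { intros r Hr.
    assert (K := cauchy_bound (divdiff f 0 d) (r + 1) r (2 * M / r) z).
    replace (2 * M / (r - Cmod z))%R with (2 * M / r * r / (r - Cmod z))%R by (field; lra).
    apply K; [intros w _; apply Hg|lra|exact Hr|].
    intros t _. assert (Hc := Cmod_circle r t ltac:(lra)).
    assert (Hc0 : circle r t - 0 <> 0).
    { replace (circle r t - 0) with (circle r t) by ring. apply Cmod_gt_0. lra. }
    rewrite divdiff_neq by (intro E; apply Hc0; rewrite E; ring).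
    rewrite Cmod_div by exact Hc0.
    replace (circle r t - 0) with (circle r t) by ring. rewrite Hc.
    apply Rmult_le_compat_r; [apply Rlt_le, Rinv_0_lt_compat; lra|].
    unfold Cminus. eapply Rle_trans; [apply Cmod_triangle|]. rewrite Cmod_opp.
    assert (H1 := HM (circle r t)). assert (H2 := HM 0). lra. }
  assert (H0 : divdiff f 0 d z = 0).
  { apply eq_0_of_Cmod_small. intros e He.
    assert (M0 : (0 <= M)%R) by (eapply Rle_trans; [apply Cmod_ge_0|apply (HM 0)]).
    (* This radius turns the bound into 2M e / (2M + 1); the added 1 keeps it above [Cmod z] when M
       = 0. *)
    eapply Rle_trans; [apply (B (Cmod z + (2 * M + 1) / e)%R)|].
    - assert (T : (0 < (2 * M + 1) / e)%R) by (apply Rdiv_lt_0_compat; lra). lra.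
    - replace (Cmod z + (2 * M + 1) / e - Cmod z)%R with ((2 * M + 1) / e)%R by ring.
      replace (2 * M / ((2 * M + 1) / e))%R with (2 * M / (2 * M + 1) * e)%R by (field; lra).
      rewrite <- (Rmult_1_l e) at 2. apply Rmult_le_compat_r; [lra|].
      apply Rle_div_l; lra. }
  destruct (C_eq_dec z 0) as [E|E]; [rewrite E; reflexivity|].
  rewrite divdiff_neq in H0 by exact E.
  apply Ceq_minus. assert (Hnz := Cminus_eq_contra _ _ E).
  transitivity ((f z - f 0) / (z - 0) * (z - 0)); [field; exact E|rewrite H0; ring].
Qed.

(** * Doubly periodic functions *)

(** A supremum argument giving connectedness and compactness of [0, 1] in one form. With [B a b] an
    implication from [a] to [b] a property propagates along a path; with [B a b] the existence of a
    bound on [a, b] local bounds become global. *)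
Lemma interval_induction (B : R -> R -> Prop) :
  (forall a b c, (a <= b <= c)%R -> B a b -> B b c -> B a c) ->
  (forall t, (0 <= t <= 1)%R -> exists del, (0 < del)%R /\
     forall a b, (0 <= a <= t)%R -> (t <= b <= 1)%R -> (t - del < a)%R -> (b < t + del)%R -> B a b) ->
  B 0%R 1%R.
Proof.
  intros Hcat Hloc.
  set (S t := (0 <= t <= 1)%R /\ B 0%R t).
  assert (S0 : S 0%R).
  { split; [lra|]. destruct (Hloc 0%R) as [del [Hd K]]; [lra|]. apply K; lra. }
  destruct (completeness S) as [t0 [Hub Hlub]].
  { exists 1%R. intros t [Ht _]; lra. }
  { exists 0%R; exact S0. }
  assert (T0 : (0 <= t0)%R) by (apply Hub; exact S0).
  assert (T1 : (t0 <= 1)%R) by (apply Hlub; intros t [Ht _]; lra).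
  destruct (Hloc t0) as [del [Hd K]]; [lra|].
  assert (Hs : exists s, S s /\ (t0 - del < s)%R).
  { apply NNPP. intro Hn. assert (t0 <= t0 - del)%R; [|lra].
    apply Hlub. intros s Hs. apply Rnot_lt_le. intro L. apply Hn. exists s; auto. }
  destruct Hs as [s [[Hs1 Hs2] Hs3]].
  assert (Hst : (s <= t0)%R) by (apply Hub; split; assumption).
  (* Since [b] cannot exceed the supremum [t0], the minimum has to be 1. *)
  set (b := Rmin 1 (t0 + del / 2)).
  assert (Hb : (t0 <= b)%R) by (unfold b; apply Rmin_glb; lra).
  assert (Hb1 : (b <= 1)%R) by apply Rmin_l.
  assert (Hb2 : (b <= t0 + del / 2)%R) by apply Rmin_r.
  assert (HB : B 0%R b).
  { apply Hcat with s; [lra|exact Hs2|]. apply K; lra. }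
  assert (Hbt : (b <= t0)%R) by (apply Hub; split; [lra|exact HB]).
  assert (E : b = 1%R).
  { unfold b in *. destruct (Rle_dec 1 (t0 + del / 2)) as [L|L].
    - apply Rmin_left; exact L.
    - rewrite Rmin_right in Hbt by lra. lra. }
  rewrite <- E. exact HB.
Qed.

Lemma Cmod_scal_close (s t : R) (p : C) (e : R) : (0 < e)%R ->
  (Rabs (s - t) < e / (Cmod p + 1))%R -> (Cmod (RtoC s * p - RtoC t * p) < e)%R.
Proof.
  intros He H. assert (Mp := Cmod_ge_0 p).
  replace (RtoC s * p - RtoC t * p) with (RtoC (s - t) * p) by (rewrite RtoC_minus; ring).
  rewrite Cmod_mult, Cmod_R. apply Rlt_div_r in H; [|lra].
  assert (K := Rabs_pos (s - t)). nra.
Qed.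

(** The property is carried along the segment from 0 to [p]. Near a point outside [A], closedness
    excludes all of [A], and the implication to be propagated is vacuous. *)
Lemma clopen_C (A : C -> Prop) : A 0 ->
  (forall a, A a -> exists e, (0 < e)%R /\ forall b, (Cmod (b - a) < e)%R -> A b) ->
  (forall p, (forall e, (0 < e)%R -> exists a, (Cmod (a - p) < e)%R /\ A a) -> A p) ->
  forall p, A p.
Proof.
  intros H0 Hopen Hclosed p.
  assert (K : A (RtoC 0 * p) -> A (RtoC 1 * p)).
  { apply (interval_induction (fun a b => A (RtoC a * p) -> A (RtoC b * p))).
    - tauto.
    - intros t Ht.
      assert (Mp := Cmod_ge_0 p).
      destruct (classic (A (RtoC t * p))) as [At|Nt].
      + destruct (Hopen _ At) as [e [He K]].
        exists (e / (Cmod p + 1))%R. split; [apply Rdiv_lt_0_compat; lra|].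
        intros a b Ha Hb H1 H2 _. apply K. apply Cmod_scal_close; [exact He|].
        apply Rabs_def1; lra.
      + assert (Hn : exists e, (0 < e)%R /\ forall a, (Cmod (a - RtoC t * p) < e)%R -> ~ A a).
        { apply NNPP. intro Hn. apply Nt, Hclosed. intros e He.
          apply NNPP. intro Hm. apply Hn. exists e. split; [exact He|].
          intros a Ha HA. apply Hm. exists a; auto. }
        destruct Hn as [e [He K]].
        exists (e / (Cmod p + 1))%R. split; [apply Rdiv_lt_0_compat; lra|].
        intros a b Ha Hb H1 H2 HA. exfalso. revert HA. apply K.
        apply Cmod_scal_close; [exact He|]. apply Rabs_def1; lra. }
  replace (RtoC 0 * p) with (RtoC 0) in K by ring.
  replace (RtoC 1 * p) with p in K by ring. auto.
Qed.

Lemma Ccont_bounded_near (f : C -> C) (p : C) : Ccont f p ->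
  exists e, (0 < e)%R /\ forall z, (Cmod (z - p) < e)%R -> (Cmod (f z) <= Cmod (f p) + 1)%R.
Proof.
  intros H. destruct (H 1%R Rlt_0_1) as [e [He K]]. exists e; split; [exact He|].
  intros z Hz. specialize (K z Hz). assert (T := Cmod_triangle_inv (f z) (f p)). lra.
Qed.

(** Compactness of the square by two interval inductions: in [y], uniformly for [x] near a fixed
    value, then in [x]. *)
Lemma bounded_parallelogram (f : C -> C) (w1 w2 : C) : (forall z, Ccont f z) ->
  exists M, forall x y, (0 <= x <= 1)%R -> (0 <= y <= 1)%R ->
    (Cmod (f (RtoC x * w1 + RtoC y * w2)%C) <= M)%R.
Proof.
  intros Hf. set (F x y := Cmod (f (RtoC x * w1 + RtoC y * w2))).
  assert (M1 := Cmod_ge_0 w1). assert (M2 := Cmod_ge_0 w2).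
  assert (Hloc : forall x y, exists del M, (0 < del)%R /\ forall x' y',
    (Rabs (x' - x) < del)%R -> (Rabs (y' - y) < del)%R -> (F x' y' <= M)%R).
  { intros x y. destruct (Ccont_bounded_near f _ (Hf (RtoC x * w1 + RtoC y * w2)))
      as [e [He K]].
    exists (Rmin (e / 2 / (Cmod w1 + 1)) (e / 2 / (Cmod w2 + 1))), (F x y + 1)%R. split.
    { apply Rmin_pos; repeat apply Rdiv_lt_0_compat; lra. }
    intros x' y' Hx Hy. apply K.
    assert (X := Cmod_scal_close x' x w1 (e / 2) ltac:(lra)
      (Rlt_le_trans _ _ _ Hx (Rmin_l _ _))).
    assert (Y := Cmod_scal_close y' y w2 (e / 2) ltac:(lra)
      (Rlt_le_trans _ _ _ Hy (Rmin_r _ _))).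
    replace (RtoC x' * w1 + RtoC y' * w2 - (RtoC x * w1 + RtoC y * w2))
      with ((RtoC x' * w1 - RtoC x * w1) + (RtoC y' * w2 - RtoC y * w2)) by ring.
    eapply Rle_lt_trans; [apply Cmod_triangle|]. lra. }
  assert (Hin : forall x, exists del M, (0 < del)%R /\ forall x' y,
    (Rabs (x' - x) < del)%R -> (0 <= y <= 1)%R -> (F x' y <= M)%R).
  { intro x. apply (interval_induction (fun a b => exists del M, (0 < del)%R /\ forall x' y,
      (Rabs (x' - x) < del)%R -> (a <= y <= b)%R -> (F x' y <= M)%R)).
    - intros a b c Habc [d1 [B1 [Hd1 K1]]] [d2 [B2 [Hd2 K2]]].
      exists (Rmin d1 d2), (Rmax B1 B2). split; [apply Rmin_pos; assumption|].
      intros x' y Hx Hy. destruct (Rle_dec y b) as [L|L].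
      + eapply Rle_trans; [apply K1; [|lra]|apply Rmax_l].
        eapply Rlt_le_trans; [exact Hx|apply Rmin_l].
      + eapply Rle_trans; [apply K2; [|lra]|apply Rmax_r].
        eapply Rlt_le_trans; [exact Hx|apply Rmin_r].
    - intros t Ht. destruct (Hloc x t) as [del [B [Hd K]]].
      exists del; split; [exact Hd|]. intros a b Ha Hb H1 H2.
      exists del, B. split; [exact Hd|]. intros x' y Hx Hy. apply K; [exact Hx|].
      apply Rabs_def1; lra. }
  apply (interval_induction (fun a b => exists M, forall x y, (a <= x <= b)%R ->
    (0 <= y <= 1)%R -> (F x y <= M)%R)).
  - intros a b c Habc [B1 K1] [B2 K2]. exists (Rmax B1 B2). intros x y Hx Hy.
    destruct (Rle_dec x b) as [L|L].
    + eapply Rle_trans; [apply K1; lra|apply Rmax_l].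
    + eapply Rle_trans; [apply K2; lra|apply Rmax_r].
  - intros t Ht. destruct (Hin t) as [del [B [Hd K]]].
    exists del; split; [exact Hd|]. intros a b Ha Hb H1 H2.
    exists B. intros x y Hx Hy. apply K; [|exact Hy]. apply Rabs_def1; lra.
Qed.

Lemma period_nat (f : C -> C) (w : C) : (forall z, f (z + w) = f z) ->
  forall (n : nat) z, f (z + RtoC (INR n) * w) = f z.
Proof.
  intros H n. induction n as [|n IH]; intro z.
  - simpl. f_equal. ring.
  - rewrite S_INR, RtoC_plus, <- (IH z), <- (H (z + RtoC (INR n) * w)). f_equal. ring.
Qed.

Lemma period_Z (f : C -> C) (w : C) : (forall z, f (z + w) = f z) ->
  forall (n : Z) z, f (z - RtoC (IZR n) * w) = f z.
Proof.
  intros H n z. destruct (Z.le_gt_cases 0 n) as [L|L].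
  - rewrite <- (Z2Nat.id n L), <- INR_IZR_INZ.
    rewrite <- (period_nat f w H (Z.to_nat n) (z - RtoC (INR (Z.to_nat n)) * w)).
    f_equal. ring.
  - replace n with (- Z.of_nat (Z.to_nat (- n)))%Z by lia.
    rewrite opp_IZR, <- INR_IZR_INZ, RtoC_opp.
    rewrite <- (period_nat f w H (Z.to_nat (- n)) z). f_equal. ring.
Qed.

(** Cramer's rule: the imaginary part of the product with [Cconj w1] kills the coordinate along
    [w1], and likewise for [w2]. *)
Lemma lattice_coordinates (w1 w2 z : C) : Im (Cconj w1 * w2) <> 0%R ->
  exists a b : R, z = RtoC a * w1 + RtoC b * w2.
Proof.
  intros H. set (D := Im (Cconj w1 * w2)) in *.
  exists (- Im (Cconj w2 * z) / D)%R, (Im (Cconj w1 * z) / D)%R.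
  destruct w1 as [a b], w2 as [c d], z as [x y]. unfold D, Im, Re in *; simpl in *.
  apply C_eq; unfold Re, Im; simpl; field; exact H.
Qed.

(** Subtracting the integer parts of the two coordinates moves any point into the period
    parallelogram, where [f] is bounded. *)
Theorem doubly_periodic_entire_constant (f : C -> C) (w1 w2 : C) :
  (forall z, Cdiff f z) -> Im (Cconj w1 * w2) <> 0%R ->
  (forall z, f (z + w1) = f z) -> (forall z, f (z + w2) = f z) -> forall z, f z = f 0.
Proof.
  intros Hf Hw H1 H2.
  destruct (bounded_parallelogram f w1 w2) as [M HM]; [intro; apply Cdiff_Ccont, Hf|].
  apply liouville with M; [exact Hf|]. intro z.
  destruct (lattice_coordinates w1 w2 z Hw) as [a [b E]]. rewrite E.
  rewrite <- (period_Z f w1 H1 (Int_part a)), <- (period_Z f w2 H2 (Int_part b)).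
  replace (RtoC a * w1 + RtoC b * w2 - RtoC (IZR (Int_part a)) * w1 - RtoC (IZR (Int_part b)) * w2)
    with (RtoC (a - IZR (Int_part a)) * w1 + RtoC (b - IZR (Int_part b)) * w2)
    by (rewrite !RtoC_minus; ring).
  assert (Ba := base_Int_part a). assert (Bb := base_Int_part b).
  apply HM; lra.
Qed.

(** Puts poles and regular points on the same footing. At a pole N = 1 and M extends 1 / E, which is
    bounded near [p]; elsewhere N = E and M = 1. The quotient is only claimed off [p], where [E] has
    a meaningful value. *)
Lemma elliptic_local_ratio (E : C -> C) (P : C -> Prop) (p : C) : meromorphic E P ->
  exists e N M, (0 < e)%R /\ holo_disc p e N /\ holo_disc p e M /\ (N p <> 0 \/ M p <> 0) /\
    forall z, (0 < Cmod (z - p) < e)%R -> ~ P z /\ M z <> 0 /\ E z = N z / M z.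
Proof.
  intros [Hiso [Hreg Hpole]].
  destruct (Hiso p) as [e [He K]].
  assert (H1 : RtoC 1 <> 0) by (intro H; apply RtoC_inj in H; lra).
  destruct (classic (P p)) as [Pp|Np].
  - destruct (Hpole p Pp 1%R) as [del [Hd Kd]].
    set (r := Rmin e del). assert (Hr : (0 < r)%R) by (apply Rmin_pos; assumption).
    assert (L1 : (r <= e)%R) by apply Rmin_l. assert (L2 : (r <= del)%R) by apply Rmin_r.
    assert (Hnz : forall z, (0 < Cmod (z - p) < r)%R -> E z <> 0).
    { intros z Hz. apply Cmod_gt_0. assert (T := Kd z ltac:(lra)). lra. }
    destruct (removable_singularity (fun z => 1 / E z) p r 1 Hr) as [M [HM EM]].
    { intros z Hz. assert (T := Kd z ltac:(lra)). split.
      - apply Cdiff_div; [apply Cdiff_const|apply Hreg, K; lra|apply Hnz, Hz].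
      - rewrite Cmod_div, Cmod_1 by apply Hnz, Hz. apply Rle_div_l; lra. }
    exists r, (fun _ => 1), M. split; [exact Hr|]. split; [intros z _; apply Cdiff_const|].
    split; [exact HM|]. split; [left; exact H1|].
    intros z Hz. rewrite (EM z Hz). assert (T := Hnz z Hz). repeat split.
    + apply K; lra.
    + intro Z. apply T. transitivity (E z * E z * (1 / E z)); [field; exact T|rewrite Z; ring].
    + field. exact T.
  - exists e, E, (fun _ => 1). split; [exact He|]. split.
    { intros z Hz. apply Hreg. destruct (C_eq_dec z p) as [Ez|Ez]; [subst z; exact Np|].
      apply K. split; [|exact Hz]. apply Cmod_gt_0, Cminus_eq_contra, Ez. }
    split; [intros z _; apply Cdiff_const|]. split; [right; exact H1|].
    intros z Hz. repeat split; [apply K, Hz|exact H1|field].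
Qed.

(** * Continuation of the differential equation *)

(** The right side of the differential equation, with k = kappa^2 and so 1 - k = lambda^2. *)
Definition jquart (k T : C) : C := 4 * T * (1 + T) * (1 + (1 - k) * T).

(* [g] is the value of [E'^2 / jquart k E] continued to [p]; on the initial disc it is
   [1 / cos^2 (2 psi / 3)]. *)
Definition germ (k : C) (E : C -> C) (P : C -> Prop) (p : C) (e : R) (g : C -> C) : Prop :=
  (0 < e)%R /\ holo_disc p e g /\
  forall z, (0 < Cmod (z - p) < e)%R ->
    ~ P z /\ jquart k (E z) <> 0 /\ C_derive E z ^ 2 = g z * jquart k (E z) /\
    (4 - 3 * g z) ^ 2 * (1 + E z) ^ 2 = g z ^ 3 * (1 + (1 - 2 * k) * E z) ^ 2.

Lemma Cmult_cancel_r (a b c : C) : c <> 0 -> a * c = b * c -> a = b.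
Proof.
  intros Hc H. apply Ceq_minus. apply Cmult_eq_0_l with c; [|exact Hc].
  apply Ceq_minus in H. rewrite <- H. ring.
Qed.

Lemma Cmult_neq_0_factors (a b : C) : a * b <> 0 -> a <> 0 /\ b <> 0.
Proof. intros H. split; intro Z; apply H; rewrite Z; ring. Qed.

Lemma germ_open (k : C) (E : C -> C) (P : C -> Prop) (p : C) (e : R) (g : C -> C) (z : C) :
  germ k E P p e g -> (0 < Cmod (z - p) < e)%R -> exists e', germ k E P z e' g.
Proof.
  intros [He [Hg K]] Hz. destruct (punctured_disc_open p z e Hz) as [e' [He' Hsub]].
  exists e'. split; [exact He'|]. split; intros w Hw; [apply Hg|apply K]; apply Hsub; lra.
Qed.

(** Off [p] both values are E'^2 / [jquart k E] with nonzero denominator; the identity theorem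
    carries the equality to [p]. *)
Lemma germ_unique (k : C) (E : C -> C) (P : C -> Prop) (p : C) (e e' : R) (g g' : C -> C) :
  germ k E P p e g -> germ k E P p e' g' -> g p = g' p.
Proof.
  intros [He [Hg K]] [He' [Hg' K']]. set (r := Rmin e e').
  assert (Hr : (0 < r)%R) by (apply Rmin_pos; assumption).
  assert (L1 : (r <= e)%R) by apply Rmin_l. assert (L2 : (r <= e')%R) by apply Rmin_r.
  apply Ceq_minus.
  apply (identity_disc (fun z => g z - g' z) p r r Hr Hr).
  - intros z Hz. apply Cdiff_minus; [apply Hg|apply Hg']; lra.
  - intros z Hz. destruct (K z ltac:(lra)) as [_ [Q [H1 _]]].
    destruct (K' z ltac:(lra)) as [_ [_ [H2 _]]].
    cbv beta. apply (proj1 (Ceq_minus _ _)). apply Cmult_cancel_r with (1 := Q).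
    rewrite <- H1. exact H2.
  - rewrite Cmod_center. exact Hr.
Qed.

Lemma Ccont_bounded_below (f : C -> C) (p : C) : Ccont f p -> f p <> 0 ->
  exists e c, (0 < e)%R /\ (0 < c)%R /\ forall z, (Cmod (z - p) < e)%R -> (c < Cmod (f z))%R.
Proof.
  intros Hf Hp. destruct (Ccont_neq_0 f p Hf Hp) as [e [He K]].
  exists e, (Cmod (f p) / 2)%R. assert (T := proj1 (Cmod_gt_0 _) Hp).
  repeat split; [exact He|lra|]. intros z Hz. apply K, Hz.
Qed.

(* For large [G] the relation makes [9 A^2] comparable to [G S^2]. *)
Lemma cubic_bound (G A S : C) (a s : R) : (4 - 3 * G) ^ 2 * A ^ 2 = G ^ 3 * S ^ 2 ->
  (Cmod A <= a)%R -> (0 < s < Cmod S)%R -> (Cmod G <= 1 + 49 * a ^ 2 / s ^ 2)%R.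
Proof.
  intros H HA HS.
  apply (f_equal Cmod) in H. rewrite !Cmod_mult, !Cmod_pow in H.
  assert (T : (Cmod (4 - 3 * G) <= 4 + 3 * Cmod G)%R).
  { unfold Cminus. eapply Rle_trans; [apply Cmod_triangle|].
    rewrite Cmod_opp, Cmod_mult, !Cmod_R, !Rabs_pos_eq by lra. lra. }
  set (x := Cmod G) in *. set (y := Cmod (4 - 3 * G)) in *.
  assert (Hx : (0 <= x)%R) by apply Cmod_ge_0. assert (Hy : (0 <= y)%R) by apply Cmod_ge_0.
  assert (Ha := Cmod_ge_0 A).
  assert (Hs2 : (0 < s ^ 2)%R) by (apply pow_lt; lra).
  assert (Q : (0 <= 49 * a ^ 2 / s ^ 2)%R).
  { apply Rmult_le_pos; [|apply Rlt_le, Rinv_0_lt_compat; exact Hs2].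
    apply Rmult_le_pos; [lra|apply pow2_ge_0]. }
  (* The summand 1 of the bound covers |G| <= 1. For larger |G| one has |4 - 3 G| <= 7 |G|, and 49
     is the square of 7. *)
  destruct (Rle_dec x 1) as [L|L]; [lra|].
  assert (Hy7 : (y ^ 2 <= (7 * x) ^ 2)%R) by (apply pow_incr; lra).
  assert (HA2 : (Cmod A ^ 2 <= a ^ 2)%R) by (apply pow_incr; lra).
  assert (HS2 : (s ^ 2 <= Cmod S ^ 2)%R) by (apply pow_incr; lra).
  assert (Hx3 : (0 < x ^ 3)%R) by (apply pow_lt; lra).
  assert (Hx2 : (0 < x ^ 2)%R) by (apply pow_lt; lra).
  assert (B1 : (x ^ 3 * s ^ 2 <= x ^ 3 * Cmod S ^ 2)%R) by (apply Rmult_le_compat_l; lra).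
  assert (B2 : (y ^ 2 * Cmod A ^ 2 <= (7 * x) ^ 2 * a ^ 2)%R)
    by (apply Rmult_le_compat; auto using pow2_ge_0).
  assert (B3 : (x * s ^ 2 <= 49 * a ^ 2)%R).
  { apply Rmult_le_reg_l with (x ^ 2)%R; [exact Hx2|].
    replace (x ^ 2 * (x * s ^ 2))%R with (x ^ 3 * s ^ 2)%R by ring.
    replace (x ^ 2 * (49 * a ^ 2))%R with ((7 * x) ^ 2 * a ^ 2)%R by ring. lra. }
  assert (B4 : (x <= 49 * a ^ 2 / s ^ 2)%R) by (apply (proj1 (Rle_div_r _ _ _ Hs2)); exact B3).
  lra.
Qed.

(** Serves where S may vanish but G S^2 is known to be small. If |G| > 4 then |4 - 3 G| >= 2 |G|, so
    the left side has modulus at least 4 |G|^2 a^2 and the right side at most |G|^2 a^2. *)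
Lemma cubic_bound_degenerate (G A S : C) (a : R) : (4 - 3 * G) ^ 2 * A ^ 2 = G ^ 3 * S ^ 2 ->
  (0 < a < Cmod A)%R -> (Cmod (G * S ^ 2) <= a ^ 2)%R -> (Cmod G <= 4)%R.
Proof.
  intros H HA HS. apply Rnot_lt_le. intro L.
  replace (G ^ 3 * S ^ 2) with (G ^ 2 * (G * S ^ 2)) in H by ring.
  apply (f_equal Cmod) in H. rewrite Cmod_mult, (Cmod_mult (G ^ 2)), !Cmod_pow in H.
  assert (T : (2 * Cmod G <= Cmod (4 - 3 * G))%R).
  { rewrite Cmod_minus_sym. assert (T := Cmod_triangle_inv (3 * G) 4).
    rewrite Cmod_mult, !Cmod_R, !Rabs_pos_eq in T by lra. lra. }
  assert (T2 : ((2 * Cmod G) ^ 2 <= Cmod (4 - 3 * G) ^ 2)%R) by (apply pow_incr; lra).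
  assert (Ha : (a ^ 2 <= Cmod A ^ 2)%R) by (apply pow_incr; lra).
  assert (Ha2 : (0 < a ^ 2)%R) by (apply pow_lt; lra).
  assert (Hg2 : (0 < Cmod G ^ 2)%R) by (apply pow_lt; lra).
  assert (B1 : ((2 * Cmod G) ^ 2 * a ^ 2 <= Cmod (4 - 3 * G) ^ 2 * Cmod A ^ 2)%R)
    by (apply Rmult_le_compat; try apply pow2_ge_0; lra).
  assert (B2 : (Cmod G ^ 2 * Cmod (G * S ^ 2) <= Cmod G ^ 2 * a ^ 2)%R)
    by (apply Rmult_le_compat_l; lra).
  assert (B3 : (0 < Cmod G ^ 2 * a ^ 2)%R) by (apply Rmult_lt_0_compat; assumption).
  replace ((2 * Cmod G) ^ 2 * a ^ 2)%R with (4 * (Cmod G ^ 2 * a ^ 2))%R in B1 by ring. lra.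
Qed.

(* [E = N / M] with [w] for [(N' M - N M')^2], so that [w / q] is [E'^2 / jquart k E]. *)
Lemma ratio_bounded (k : C) (N M w : C -> C) (p : C) (r : R) : k <> 0 -> (0 < r)%R ->
  Ccont w p -> Cdiff N p -> Cdiff M p -> (N p <> 0 \/ M p <> 0) ->
  let q z := 4 * N z * M z * (N z + M z) * (M z + (1 - k) * N z) in
  (forall z, (0 < Cmod (z - p) < r)%R -> q z <> 0 /\
     (4 - 3 * (w z / q z)) ^ 2 * (N z + M z) ^ 2
        = (w z / q z) ^ 3 * (M z + (1 - 2 * k) * N z) ^ 2) ->
  exists e B, (0 < e <= r)%R /\ forall z, (0 < Cmod (z - p) < e)%R -> (Cmod (w z / q z) <= B)%R.
Proof.
  intros Hk Hr Hw HN HM Hnm q Hrel.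
  assert (HA : Ccont (fun z => N z + M z) p) by (apply Cdiff_Ccont, Cdiff_plus; assumption).
  assert (HS : Cdiff (fun z => M z + (1 - 2 * k) * N z) p).
  { apply Cdiff_plus; [exact HM|]. apply Cdiff_mult; [apply Cdiff_const|exact HN]. }
  assert (HL : Cdiff (fun z => M z + (1 - k) * N z) p).
  { apply Cdiff_plus; [exact HM|]. apply Cdiff_mult; [apply Cdiff_const|exact HN]. }
  (* If this combination is nonzero at [p], the cubic relation alone bounds the ratio. *)
  destruct (C_eq_dec (M p + (1 - 2 * k) * N p) 0) as [ES|ES].
  2:{ destruct (Ccont_bounded_below _ p (Cdiff_Ccont _ _ HS) ES) as [e1 [s [He1 [Hs K1]]]].
    destruct (Ccont_bounded_near _ p HA) as [e2 [He2 K2]].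
    exists (Rmin r (Rmin e1 e2)), (1 + 49 * (Cmod (N p + M p) + 1) ^ 2 / s ^ 2)%R.
    assert (L0 := Rmin_l r (Rmin e1 e2)). assert (L1 := Rmin_r r (Rmin e1 e2)).
    assert (L2 := Rmin_l e1 e2). assert (L3 := Rmin_r e1 e2).
    split; [split; [repeat apply Rmin_pos; assumption|exact L0]|].
    intros z Hz. destruct (Hrel z ltac:(lra)) as [_ Hz'].
    eapply cubic_bound; [exact Hz'|apply K2; lra|split; [exact Hs|apply K1; lra]]. }
  (* In the remaining case the other factors of [q] are N, 2k N and k N at [p] up to constants,
     hence nonzero; only [M] can vanish. *)
  assert (EM : M p = - (1 - 2 * k) * N p).
  { transitivity (M p + (1 - 2 * k) * N p - (1 - 2 * k) * N p); [ring|rewrite ES; ring]. }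
  assert (Np : N p <> 0).
  { intro Z. destruct Hnm as [Hn|Hn]; [contradiction|]. apply Hn. rewrite EM, Z. ring. }
  assert (Ap : N p + M p <> 0).
  { replace (N p + M p) with (2 * k * N p) by (rewrite EM; ring).
    repeat apply Cmult_neq_0; try assumption. apply C2_neq_0. }
  assert (Lp : M p + (1 - k) * N p <> 0).
  { replace (M p + (1 - k) * N p) with (k * N p) by (rewrite EM; ring).
    apply Cmult_neq_0; assumption. }
  assert (C4 : RtoC 4 <> 0) by (intro Z; apply RtoC_inj in Z; lra).
  set (h z := 4 * N z * (N z + M z) * (M z + (1 - k) * N z)).
  assert (Hh : Cdiff h p).
  { unfold h. apply Cdiff_mult; [|exact HL].
    apply (Cdiff_mult (fun z => 4 * N z) (fun z => N z + M z)).
    - apply (Cdiff_mult (fun _ => RtoC 4) N); [apply Cdiff_const|exact HN].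
    - apply Cdiff_plus; assumption. }
  assert (Hhp : h p <> 0) by (unfold h; repeat apply Cmult_neq_0; assumption).
  assert (Eq : forall z, q z = h z * M z) by (intro z; unfold q, h; ring).
  destruct (Ccont_bounded_near w p Hw) as [e1 [He1 K1]].
  destruct (Ccont_bounded_below h p (Cdiff_Ccont _ _ Hh) Hhp) as [e2 [c [He2 [Hc K2]]]].
  set (W := (Cmod (w p) + 1)%R) in *.
  assert (HW : (0 < W)%R) by (assert (T := Cmod_ge_0 (w p)); unfold W; lra).
  (* M p = 0 forces k = 1/2. Then the combination is [M] itself and G S^2 = w M / h, which is small
     near [p]: the threshold a^2 c / W for [M] makes it at most a^2. *)
  destruct (C_eq_dec (M p) 0) as [Z|Z].
  - assert (Ek : 1 - 2 * k = 0).
    { apply Cmult_eq_0_l with (N p); [|exact Np].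
      transitivity (- (- (1 - 2 * k) * N p)); [ring|]. rewrite <- EM, Z. ring. }
    destruct (Ccont_bounded_below _ p HA Ap) as [e3 [a [He3 [Ha K3]]]].
    assert (Hap : (0 < a ^ 2)%R) by (apply pow_lt; exact Ha).
    destruct (Cdiff_Ccont M p HM (a ^ 2 * c / W)%R) as [e4 [He4 K4]].
    { apply Rdiv_lt_0_compat; [apply Rmult_lt_0_compat; assumption|exact HW]. }
    exists (Rmin (Rmin r e1) (Rmin (Rmin e2 e3) e4)), 4%R.
    assert (L0 := Rmin_l (Rmin r e1) (Rmin (Rmin e2 e3) e4)).
    assert (L1 := Rmin_r (Rmin r e1) (Rmin (Rmin e2 e3) e4)).
    assert (L2 := Rmin_l r e1). assert (L3 := Rmin_r r e1).
    assert (L4 := Rmin_l (Rmin e2 e3) e4). assert (L5 := Rmin_r (Rmin e2 e3) e4).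
    assert (L6 := Rmin_l e2 e3). assert (L7 := Rmin_r e2 e3).
    split; [split; [repeat apply Rmin_pos; assumption|lra]|].
    intros z Hz. destruct (Hrel z ltac:(lra)) as [Hq Hz'].
    apply (cubic_bound_degenerate _ _ _ a Hz').
    + split; [exact Ha|apply K3; lra].
    + rewrite Ek. replace (M z + 0 * N z) with (M z) by ring.
      rewrite Eq in *. destruct (Cmult_neq_0_factors _ _ Hq) as [Hhz HMz].
      replace (w z / (h z * M z) * M z ^ 2) with (w z * M z / h z) by (field; split; assumption).
      rewrite Cmod_div, Cmod_mult by exact Hhz.
      specialize (K1 z ltac:(lra)). specialize (K2 z ltac:(lra)). specialize (K4 z ltac:(lra)).
      rewrite Z in K4. replace (M z - 0) with (M z) in K4 by ring.
      assert (Hhz' := proj1 (Cmod_gt_0 _) Hhz).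
      apply (proj2 (Rle_div_l _ _ _ Hhz')).
      apply Rle_trans with (W * (a ^ 2 * c / W))%R.
      * apply Rmult_le_compat; try apply Cmod_ge_0; lra.
      * replace (W * (a ^ 2 * c / W))%R with (a ^ 2 * c)%R by (field; lra).
        apply Rmult_le_compat_l; lra.
  - destruct (Ccont_bounded_below M p (Cdiff_Ccont _ _ HM) Z) as [e3 [m [He3 [Hm K3]]]].
    exists (Rmin r (Rmin e1 (Rmin e2 e3))), (W / (c * m))%R.
    assert (L0 := Rmin_l r (Rmin e1 (Rmin e2 e3))).
    assert (L1 := Rmin_r r (Rmin e1 (Rmin e2 e3))).
    assert (L2 := Rmin_l e1 (Rmin e2 e3)). assert (L3 := Rmin_r e1 (Rmin e2 e3)).
    assert (L6 := Rmin_l e2 e3). assert (L7 := Rmin_r e2 e3).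
    split; [split; [repeat apply Rmin_pos; assumption|lra]|].
    intros z Hz. destruct (Hrel z ltac:(lra)) as [Hq _].
    rewrite Cmod_div by exact Hq. rewrite Eq, Cmod_mult.
    specialize (K1 z ltac:(lra)). specialize (K2 z ltac:(lra)). specialize (K3 z ltac:(lra)).
    assert (Hcm : (0 < c * m)%R) by (apply Rmult_lt_0_compat; assumption).
    unfold Rdiv. apply Rmult_le_compat; [apply Cmod_ge_0| |exact K1|].
    + apply Rlt_le, Rinv_0_lt_compat. apply Rmult_lt_0_compat; lra.
    + apply Rinv_le_contravar; [exact Hcm|]. apply Rmult_le_compat; lra.
Qed.

Lemma is_Cderive_C_derive (f : C -> C) (z : C) : Cdiff f z -> is_Cderive f z (C_derive f z).
Proof. intros [d Hd]. rewrite (is_C_derive_unique f z d Hd). exact Hd. Qed.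

Lemma C_derive_eq (f : C -> C) (z d : C) : is_Cderive f z d -> C_derive f z = d.
Proof. exact (is_C_derive_unique f z d). Qed.

Lemma holo_disc_C_derive (f : C -> C) (p : C) (r : R) :
  holo_disc p r f -> holo_disc p r (C_derive f).
Proof.
  intros Hf z Hz. apply Cdiff_C_derive with (r - Cmod (z - p))%R; [lra|].
  intros w Hw. apply Hf. assert (T := Cmod_minus_triangle w z p). lra.
Qed.

(** With E = N / M near [p], clearing denominators turns the relation into the vanishing of a
    function [F] that is holomorphic at [p] too. It vanishes near some nearby [a], hence around [p];
    the relation so obtained bounds the quotient for G, whose singularity at [p] is then
    removable. *)
Lemma germ_closed (k : C) (E : C -> C) (P : C -> Prop) (p : C) : k <> 0 -> meromorphic E P ->
  (forall e, (0 < e)%R -> exists a, (Cmod (a - p) < e)%R /\ exists e' g, germ k E P a e' g) ->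
  exists e g, germ k E P p e g.
Proof.
  intros Hk Hmer Hnear.
  destruct (elliptic_local_ratio E P p Hmer) as [e [N [M [He [HN [HM [Hnm Hloc]]]]]]].
  (* The disc of radius e/2 about [a] then contains that of radius e/4 about [p] and lies in the
     disc of radius e. *)
  destruct (Hnear (e / 4)%R ltac:(lra)) as [a [Ha [ea [ga Hga]]]].
  destruct (C_eq_dec a p) as [Eap|Nap]; [subst a; exists ea, ga; exact Hga|].
  assert (Hap : (0 < Cmod (a - p))%R) by (apply Cmod_gt_0, Cminus_eq_contra, Nap).
  (* [w] is M^2 E', [q] is M^4 times [jquart k E], and [F] is the relation for G = w^2 / q
     multiplied by q^3 M^2. *)
  set (w z := C_derive N z * M z - N z * C_derive M z).
  set (q z := 4 * N z * M z * (N z + M z) * (M z + (1 - k) * N z)).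
  set (F z := (4 * q z - 3 * w z ^ 2) ^ 2 * q z * (N z + M z) ^ 2
              - w z ^ 6 * (M z + (1 - 2 * k) * N z) ^ 2).
  assert (Hw : holo_disc p e w).
  { intros z Hz. assert (HN' := holo_disc_C_derive N p e HN z Hz).
    assert (HM' := holo_disc_C_derive M p e HM z Hz). specialize (HN z Hz). specialize (HM z Hz).
    apply Cdiff_minus; apply Cdiff_mult; assumption. }
  assert (Hq : holo_disc p e q).
  { intros z Hz. specialize (HN z Hz). specialize (HM z Hz). unfold q.
    apply Cdiff_mult; [apply Cdiff_mult; [apply Cdiff_mult|]|].
    - apply Cdiff_mult; [apply Cdiff_const|assumption].
    - assumption.
    - apply Cdiff_plus; assumption.
    - apply Cdiff_plus; [assumption|apply Cdiff_mult; [apply Cdiff_const|assumption]]. }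
  assert (HF : holo_disc p e F).
  { intros z Hz. assert (HN0 := HN z Hz). assert (HM0 := HM z Hz).
    assert (Hw0 := Hw z Hz). assert (Hq0 := Hq z Hz). unfold F.
    apply Cdiff_minus; apply Cdiff_mult.
    - apply Cdiff_mult; [|assumption].
      apply (Cdiff_pow (fun z => 4 * q z - 3 * w z ^ 2)). apply Cdiff_minus.
      + apply Cdiff_mult; [apply Cdiff_const|assumption].
      + apply Cdiff_mult; [apply Cdiff_const|apply Cdiff_pow; assumption].
    - apply (Cdiff_pow (fun z => N z + M z)), Cdiff_plus; assumption.
    - apply Cdiff_pow; assumption.
    - apply (Cdiff_pow (fun z => M z + (1 - 2 * k) * N z)), Cdiff_plus; [assumption|].
      apply Cdiff_mult; [apply Cdiff_const|assumption]. }
  assert (HE : forall z, (0 < Cmod (z - p) < e)%R ->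
    ~ P z /\ M z <> 0 /\ C_derive E z = w z / M z ^ 2 /\ jquart k (E z) = q z / M z ^ 4 /\
    (1 + E z) = (N z + M z) / M z /\ 1 + (1 - 2 * k) * E z = (M z + (1 - 2 * k) * N z) / M z).
  { intros z Hz. destruct (Hloc z Hz) as [HP [HMz Ez]].
    assert (Hz2 : (Cmod (z - p) < e)%R) by lra.
    repeat split; try assumption.
    - destruct (punctured_disc_open p z e Hz) as [e' [He' Hsub]]. apply C_derive_eq.
      apply (is_Cderive_ext_loc (fun z => N z / M z) E z _ e' He').
      + intros y Hy. symmetry. apply Hloc, Hsub, Hy.
      + apply is_Cderive_div; [| |exact HMz]; apply is_Cderive_C_derive;
          [apply HN|apply HM]; exact Hz2.
    - unfold jquart, q. rewrite Ez. field. exact HMz.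
    - rewrite Ez. field. exact HMz.
    - rewrite Ez. field. exact HMz. }
  destruct Hga as [Hea [_ Kga]].
  (* A radius at most |a - p| keeps [p] out of the disc about [a]. *)
  set (ra := Rmin ea (Rmin (Cmod (a - p)) (e / 4))).
  assert (Hra : (0 < ra)%R) by (repeat apply Rmin_pos; lra).
  assert (A1 : (ra <= ea)%R) by apply Rmin_l.
  assert (A2 : (ra <= Cmod (a - p))%R) by (eapply Rle_trans; [apply Rmin_r|apply Rmin_l]).
  assert (A3 : (ra <= e / 4)%R) by (eapply Rle_trans; [apply Rmin_r|apply Rmin_r]).
  assert (Hnear_a : forall z, (0 < Cmod (z - a) < ra)%R -> q z <> 0 /\ F z = 0).
  { intros z Hz. assert (T := Cmod_minus_triangle z a p).
    assert (T2 := Cmod_minus_triangle a z p). rewrite (Cmod_minus_sym a z) in T2.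
    destruct (HE z ltac:(lra)) as [_ [HMz [Ed [Ej [E1 E2]]]]].
    destruct (Kga z ltac:(lra)) as [_ [Q1 [Q2 Q3]]].
    rewrite Ed, Ej in *. rewrite E1, E2 in Q3.
    assert (Hqz : q z <> 0).
    { intro Z. apply Q1. rewrite Z. field. exact HMz. }
    split; [exact Hqz|].
    assert (Eg : ga z = w z ^ 2 / q z).
    { apply Cmult_cancel_r with (1 := Q1). rewrite <- Q2. field. split; assumption. }
    rewrite Eg in Q3.
    unfold F. apply Ceq_minus in Q3.
    transitivity (((4 - 3 * (w z ^ 2 / q z)) ^ 2 * ((N z + M z) / M z) ^ 2
      - (w z ^ 2 / q z) ^ 3 * ((M z + (1 - 2 * k) * N z) / M z) ^ 2) * (q z ^ 3 * M z ^ 2)).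
    - field. split; assumption.
    - rewrite Q3. ring. }
  assert (F0 : forall z, (Cmod (z - p) < e / 4)%R -> F z = 0).
  { intros z Hz. apply (identity_disc F a (e / 2) ra ltac:(lra) Hra).
    - intros y Hy. apply HF. assert (T := Cmod_minus_triangle y a p). lra.
    - intros y Hy. apply Hnear_a, Hy.
    - assert (T := Cmod_minus_triangle z p a). rewrite (Cmod_minus_sym p a) in T. lra. }
  (* [q] cannot vanish identically, since it is nonzero near [a]. *)
  destruct (isolated_zeros q p e He Hq) as [Q0|[e1 [He1 Q1]]].
  { exfalso. set (z := a + RtoC (ra / 2)).
    assert (Hz : Cmod (z - a) = (ra / 2)%R).
    { unfold z. replace (a + RtoC (ra / 2) - a) with (RtoC (ra / 2)) by ring.
      rewrite Cmod_R, Rabs_pos_eq; lra. }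
    apply (Hnear_a z); [lra|]. apply Q0. assert (T := Cmod_minus_triangle z a p). lra. }
  set (r := Rmin e1 (e / 4)).
  assert (Hr : (0 < r)%R) by (apply Rmin_pos; lra).
  assert (R1 : (r <= e1)%R) by apply Rmin_l. assert (R2 : (r <= e / 4)%R) by apply Rmin_r.
  assert (Hrel : forall z, (0 < Cmod (z - p) < r)%R -> q z <> 0 /\
     (4 - 3 * (w z ^ 2 / q z)) ^ 2 * (N z + M z) ^ 2
        = (w z ^ 2 / q z) ^ 3 * (M z + (1 - 2 * k) * N z) ^ 2).
  { intros z Hz. assert (Hqz := Q1 z ltac:(lra)). split; [exact Hqz|].
    assert (Hf := F0 z ltac:(lra)). apply Ceq_minus.
    transitivity (F z / q z ^ 3); [unfold F; field; exact Hqz|].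
    rewrite Hf. field. exact Hqz. }
  assert (Hp : (Cmod (p - p) < e)%R) by (rewrite Cmod_center; exact He).
  assert (Hw2 : holo_disc p e (fun z => w z ^ 2)) by (intros z Hz; apply Cdiff_pow, Hw, Hz).
  destruct (ratio_bounded k N M (fun z => w z ^ 2) p r Hk Hr
    (Cdiff_Ccont _ _ (Hw2 p Hp)) (HN p Hp) (HM p Hp) Hnm Hrel) as [e2 [B [[He2 He2r] HB]]].
  fold q in HB.
  destruct (removable_singularity (fun z => w z ^ 2 / q z) p e2 B He2) as [g [Hg Eg]].
  { intros z Hz. split; [|exact (HB z Hz)].
    apply Cdiff_div; [apply Hw2; lra|apply Hq; lra|apply Hrel; lra]. }
  exists e2, g. split; [exact He2|]. split; [exact Hg|].
  intros z Hz. destruct (HE z ltac:(lra)) as [HP [HMz [Ed [Ej [E1 E2]]]]].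
  destruct (Hrel z ltac:(lra)) as [Hqz Hr3].
  rewrite (Eg z Hz), Ed, Ej, E1, E2.
  assert (HM4 : M z ^ 4 <> 0) by (apply Cpow_nz, HMz).
  repeat split.
  - exact HP.
  - intro Z. apply Hqz. transitivity (q z / M z ^ 4 * M z ^ 4); [field; exact HMz|].
    rewrite Z; ring.
  - field. split; assumption.
  - transitivity ((4 - 3 * (w z ^ 2 / q z)) ^ 2 * (N z + M z) ^ 2 / M z ^ 2).
    + field. split; assumption.
    + rewrite Hr3. field. split; assumption.
Qed.

(** Off the poles a period changes neither E nor E', so the translated function satisfies the same
    relations. *)
Lemma germ_period (k : C) (E : C -> C) (P : C -> Prop) (p v : C) (e : R) (g : C -> C) :
  (forall z, ~ P z -> Cdiff E z) ->
  (forall z, (P (z + v) <-> P z) /\ (~ P z -> E (z + v) = E z)) ->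
  germ k E P p e g -> germ k E P (p + v) e (fun z => g (z - v)).
Proof.
  intros Hreg Hper [He [Hg K]]. split; [exact He|]. split.
  - intros z Hz. apply (Cdiff_comp g (fun z => z - v)).
    + apply Hg. replace (z - v - p) with (z - (p + v)) by ring. exact Hz.
    + apply Cdiff_sub_const.
  - intros z Hz.
    assert (Hy : (0 < Cmod (z - v - p) < e)%R)
      by (replace (z - v - p) with (z - (p + v)) by ring; exact Hz).
    destruct (K _ Hy) as [HP HK].
    assert (Hz' : z = z - v + v) by ring.
    assert (EE : E z = E (z - v)) by (rewrite Hz' at 1; apply Hper, HP).
    assert (ED : C_derive E z = C_derive E (z - v)).
    { apply C_derive_eq.
      destruct (punctured_disc_open p (z - v) e Hy) as [e' [He' Hsub]].
      apply (is_Cderive_ext_loc (fun x => E (x - v)) E z _ e' He').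
      - intros x Hx. replace (x - z) with (x - v - (z - v)) in Hx by ring.
        destruct (K (x - v) (Hsub _ Hx)) as [HPx _].
        assert (Hx' : x = x - v + v) by ring. rewrite Hx' at 2. symmetry. apply Hper, HPx.
      - eapply is_Cderive_eq.
        + apply (is_Cderive_comp E (fun x => x - v)).
          * apply is_Cderive_C_derive, Hreg, HP.
          * apply is_Cderive_sub_const.
        + ring. }
    rewrite EE, ED. split; [|exact HK].
    intro Hc. apply HP. apply (Hper (z - v)). rewrite <- Hz'. exact Hc.
Qed.

Theorem elliptic_germ_absurd (k : C) (E : C -> C) (P : C -> Prop) (rho : R) (g0 : C -> C) :
  k <> 0 -> elliptic E P -> germ k E P 0 rho g0 -> g0 0 = 1 -> False.
Proof.
  intros Hk [Hmer [w1 [w2 [Hw Hper]]]] Hg0 Hone.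
  assert (Hall : forall p, exists e g, germ k E P p e g).
  { apply clopen_C.
    - exists rho, g0. exact Hg0.
    - intros a [e [g Hg]]. exists e. split; [apply Hg|]. intros b Hb.
      destruct (C_eq_dec b a) as [Eb|Nb]; [subst b; exists e, g; exact Hg|].
      destruct (germ_open k E P a e g b Hg) as [e' He'].
      + split; [|exact Hb]. apply Cmod_gt_0, Cminus_eq_contra, Nb.
      + exists e', g. exact He'.
    - intros p. apply germ_closed; assumption. }
  (* [G] takes at each point the value of some germ there; by [germ_unique] it agrees with every
     germ on its whole disc, hence is entire and periodic. *)
  destruct (functional_choice (fun p v => exists e g, germ k E P p e g /\ g p = v)) as [G HG].
  { intro p. destruct (Hall p) as [e [g Hg]]. exists (g p), e, g. auto. }
  assert (Hloc : forall p e g, germ k E P p e g -> forall z, (Cmod (z - p) < e)%R -> G z = g z).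
  { intros p e g Hg z Hz.
    assert (Hgz : exists e', germ k E P z e' g).
    { destruct (C_eq_dec z p) as [Ez|Nz]; [subst z; exists e; exact Hg|].
      apply (germ_open k E P p e g z Hg). split; [|exact Hz].
      apply Cmod_gt_0, Cminus_eq_contra, Nz. }
    destruct Hgz as [e' Hgz]. destruct (HG z) as [e'' [g'' [Hg'' Ev]]].
    rewrite <- Ev. exact (germ_unique _ _ _ _ _ _ _ _ Hg'' Hgz). }
  assert (HGd : forall z, Cdiff G z).
  { intro p. destruct (Hall p) as [e [g Hg]].
    apply Cdiff_ext_loc with (f := g) (e := e).
    - apply Hg.
    - intros z Hz. symmetry. exact (Hloc p e g Hg z Hz).
    - apply Hg. rewrite Cmod_center. apply Hg. }
  assert (HGp : forall v, (forall z, (P (z + v) <-> P z) /\ (~ P z -> E (z + v) = E z)) ->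
     forall z, G (z + v) = G z).
  { intros v Hv p. destruct (HG p) as [e [g [Hg Ev]]].
    assert (Hg' := germ_period k E P p v e g (proj1 (proj2 Hmer)) Hv Hg).
    rewrite (Hloc _ _ _ Hg').
    - replace (p + v - v) with p by ring. exact Ev.
    - rewrite Cmod_center. apply Hg. }
  assert (Hconst := doubly_periodic_entire_constant G w1 w2 HGd Hw
    (HGp w1 ltac:(intro z; destruct (Hper z) as [H1 [H2 H3]]; split; [exact H1|];
       intro HP; apply H3, HP))
    (HGp w2 ltac:(intro z; destruct (Hper z) as [H1 [H2 H3]]; split; [exact H2|];
       intro HP; apply H3, HP))).
  assert (Hrho : (0 < rho)%R) by apply Hg0.
  assert (H0 : G 0 = 1) by (rewrite (Hloc 0 rho g0 Hg0); [exact Hone|rewrite Cmod_center; exact Hrho]).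
  set (z := RtoC (rho / 2)).
  assert (Hz : (0 < Cmod (z - 0) < rho)%R).
  { replace (z - 0) with z by ring. unfold z. rewrite Cmod_R, Rabs_pos_eq; lra. }
  destruct (proj2 (proj2 Hg0) z Hz) as [_ [Q [_ Hrel]]].
  assert (Hgz : g0 z = 1).
  { rewrite <- (Hloc 0 rho g0 Hg0) by apply Hz. rewrite (Hconst z). exact H0. }
  rewrite Hgz in Hrel. apply Q.
  (* For G = 1 the two sides differ by 4k E (1 + (1 - k) E). Multiplied by 1 + E this is k times
     [jquart k E], which is nonzero in a germ. *)
  apply Ceq_minus in Hrel. unfold jquart.
  apply Cmult_eq_0_l with k; [|exact Hk].
  transitivity ((1 + E z) * ((4 - 3 * 1) ^ 2 * (1 + E z) ^ 2 - 1 ^ 3 * (1 + (1 - 2 * k) * E z) ^ 2)).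
  - ring.
  - rewrite Hrel. ring.
Qed.

(** * Exponential, trigonometric functions, square root *)

Lemma constant_of_derive_0 (f : C -> C) (r : R) :
  (forall z, (Cmod z < r)%R -> is_Cderive f z 0) -> forall z, (Cmod z < r)%R -> f z = f 0.
Proof.
  intros H z Hz. apply Ceq_minus, Cmod_eq_0. apply Rle_antisym; [|apply Cmod_ge_0].
  apply Rle_trans with (0 * Cmod (z - 0))%R; [|apply Req_le; ring].
  apply Cmod_le_of_derive. intros t Ht. exists (RtoC 0). split; [|rewrite Cmod_0; lra].
  apply H. apply Cmod_seg_lt; [exact Ht| |exact Hz].
  rewrite Cmod_0. assert (K := Cmod_ge_0 z). lra.
Qed.

Definition exp_coef (n : nat) : C := / RtoC (INR (Factorial.fact n)).

Lemma INR_fact_C_neq_0 (n : nat) : RtoC (INR (Factorial.fact n)) <> 0.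
Proof. intro H. apply RtoC_inj in H. exact (INR_fact_neq_0 n H). Qed.

Lemma Cexp_Cpseries (z : C) : Cexp z = Cpseries exp_coef z.
Proof. apply Cseries_ext. intro n. unfold exp_coef, Cdiv. ring. Qed.

(** At |z| + 1 the terms of the real exponential series tend to 0, which is impossible beyond the
    radius of convergence. *)
Lemma Cradius_exp_coef (z : C) : Rbar_lt (Cmod z) (Cradius exp_coef).
Proof.
  apply Rbar_lt_le_trans with (Cmod z + 1)%R; [simpl; lra|].
  apply Rbar_not_lt_le. intro L.
  assert (Mz := Cmod_ge_0 z).
  apply (CV_disk_outside (fun n => Cmod (exp_coef n)) (Cmod z + 1)).
  - rewrite Rabs_pos_eq by lra. exact L.
  - apply (ex_series_lim_0 (fun n => Cmod (exp_coef n) * (Cmod z + 1) ^ n)%R).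
    exists (exp (Cmod z + 1)). assert (K := is_exp_Reals (Cmod z + 1)).
    revert K. apply is_series_ext. intro n.
    rewrite pow_n_pow. unfold exp_coef. rewrite Cmod_inv by apply INR_fact_C_neq_0.
    rewrite Cmod_R, Rabs_pos_eq by apply pos_INR. apply Rmult_comm.
Qed.

Lemma is_Cderive_Cexp (z : C) : is_Cderive Cexp z (Cexp z).
Proof.
  apply is_Cderive_ext_loc with (f := Cpseries exp_coef) (e := 1%R); [lra| |].
  - intros w _. symmetry; apply Cexp_Cpseries.
  - eapply is_Cderive_eq; [apply is_Cderive_Cpseries, Cradius_exp_coef|].
    rewrite Cexp_Cpseries. apply Cseries_ext. intro n. f_equal.
    unfold Cpderiv, exp_coef. rewrite fact_simpl, mult_INR, RtoC_mult.
    field. split; [apply INR_fact_C_neq_0|].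
    intro H. apply RtoC_inj in H. revert H. apply not_0_INR. lia.
Qed.

Lemma Cexp_0 : Cexp 0 = 1.
Proof. rewrite Cexp_Cpseries, Cpseries_0. unfold exp_coef. simpl. field. Qed.

(** The product of [Cexp z] and [Cexp (a + b - z)] has derivative 0; compare its values at [a] and
    0. *)
Lemma Cexp_plus (a b : C) : Cexp (a + b) = Cexp a * Cexp b.
Proof.
  set (h z := Cexp z * Cexp (a + b - z)).
  assert (Hd : forall z, is_Cderive h z 0).
  { intro z. eapply is_Cderive_eq.
    - apply is_Cderive_mult; [apply is_Cderive_Cexp|].
      apply (is_Cderive_comp Cexp (fun z => a + b - z)); [apply is_Cderive_Cexp|].
      apply is_Cderive_minus; [apply is_Cderive_const|apply is_Cderive_id].
    - cbv beta. ring. }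
  assert (K := constant_of_derive_0 h (Cmod a + 1) (fun z _ => Hd z) a ltac:(lra)).
  unfold h in K. rewrite Cexp_0 in K.
  replace (a + b - a) with b in K by ring. replace (a + b - 0) with (a + b) in K by ring.
  rewrite K. ring.
Qed.

Lemma Cexp_opp (a : C) : Cexp a * Cexp (- a) = 1.
Proof. rewrite <- Cexp_plus, <- Cexp_0. f_equal. ring. Qed.

Lemma is_Cderive_Cexp_lin (c z : C) : is_Cderive (fun w => Cexp (c * w)) z (c * Cexp (c * z)).
Proof.
  eapply is_Cderive_eq.
  - apply (is_Cderive_comp Cexp (fun w => c * w)); [apply is_Cderive_Cexp|].
    apply is_Cderive_scal, is_Cderive_id.
  - ring.
Qed.

Lemma Ci_sqr : Ci * Ci = - (1).
Proof. apply C_eq; simpl; ring. Qed.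

Lemma is_Cderive_Cexp_opp (z : C) :
  is_Cderive (fun w => Cexp (- (Ci * w))) z (- Ci * Cexp (- (Ci * z))).
Proof.
  eapply is_Cderive_eq.
  - apply (is_Cderive_comp Cexp (fun w => - (Ci * w))); [apply is_Cderive_Cexp|].
    apply is_Cderive_opp, is_Cderive_scal, is_Cderive_id.
  - ring.
Qed.

Lemma is_Cderive_Csin (z : C) : is_Cderive Csin z (Ccos z).
Proof.
  eapply is_Cderive_eq.
  - apply (is_Cderive_div (fun z => Cexp (Ci * z) - Cexp (- (Ci * z))) (fun _ => 2 * Ci)).
    + apply is_Cderive_minus; [apply is_Cderive_Cexp_lin|apply is_Cderive_Cexp_opp].
    + apply is_Cderive_const.
    + apply Cmult_neq_0; [apply C2_neq_0|apply Ci_nz].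
  - cbv beta. unfold Ccos. field. apply Ci_nz.
Qed.

Lemma is_Cderive_Ccos (z : C) : is_Cderive Ccos z (- Csin z).
Proof.
  eapply is_Cderive_eq.
  - apply (is_Cderive_div (fun z => Cexp (Ci * z) + Cexp (- (Ci * z))) (fun _ => RtoC 2)).
    + apply is_Cderive_plus; [apply is_Cderive_Cexp_lin|apply is_Cderive_Cexp_opp].
    + apply is_Cderive_const.
    + apply C2_neq_0.
  - cbv beta. unfold Csin.
    transitivity (- ((- (Ci * Ci)) * (Cexp (Ci * z) - Cexp (- (Ci * z))) / (2 * Ci))).
    + field. apply Ci_nz.
    + rewrite Ci_sqr. field. apply Ci_nz.
Qed.

Lemma Csin_0 : Csin 0 = 0.
Proof.
  unfold Csin. replace (- (Ci * 0)) with (Ci * 0) by ring. field. apply Ci_nz.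
Qed.

Lemma Ccos_0 : Ccos 0 = 1.
Proof.
  unfold Ccos. replace (- (Ci * 0)) with (RtoC 0) by ring.
  replace (Ci * 0) with (RtoC 0) by ring. rewrite Cexp_0. field.
Qed.

Lemma Csin2_Ccos2 (z : C) : Csin z ^ 2 + Ccos z ^ 2 = 1.
Proof.
  unfold Csin, Ccos. set (x := Cexp (Ci * z)). set (y := Cexp (- (Ci * z))).
  assert (H : x * y = 1) by apply Cexp_opp.
  transitivity ((x - y) ^ 2 / (4 * (Ci * Ci)) + (x + y) ^ 2 / 4); [field; apply Ci_nz|].
  rewrite Ci_sqr. transitivity (x * y); [field|exact H].
Qed.

Lemma Ccos_2 (z : C) : Ccos (2 * z) = 1 - 2 * Csin z ^ 2.
Proof.
  unfold Csin, Ccos.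
  replace (Ci * (2 * z)) with (Ci * z + Ci * z) by ring.
  replace (- (Ci * z + Ci * z)) with (- (Ci * z) + - (Ci * z)) by ring.
  rewrite !Cexp_plus. set (x := Cexp (Ci * z)). set (y := Cexp (- (Ci * z))).
  assert (H : x * y = 1) by apply Cexp_opp.
  transitivity (x * y - 2 * ((x - y) ^ 2 / (4 * (Ci * Ci)))).
  - rewrite Ci_sqr. field.
  - rewrite H. field. apply Ci_nz.
Qed.

Lemma Ccos_3 (z : C) : Ccos (3 * z) = 4 * Ccos z ^ 3 - 3 * Ccos z.
Proof.
  unfold Ccos.
  replace (Ci * (3 * z)) with (Ci * z + (Ci * z + Ci * z)) by ring.
  replace (- (Ci * z + (Ci * z + Ci * z))) with (- (Ci * z) + (- (Ci * z) + - (Ci * z))) by ring.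
  rewrite !Cexp_plus. set (x := Cexp (Ci * z)). set (y := Cexp (- (Ci * z))).
  assert (H : x * y = 1) by apply Cexp_opp.
  transitivity (4 * ((x + y) / 2) ^ 3 - 3 * (x * y) * ((x + y) / 2)); [field|].
  rewrite H. ring.
Qed.

Lemma Csqrt_Re_ge_0 (z : C) : (0 <= Re (Csqrt z))%R.
Proof. apply sqrt_pos. Qed.

Lemma Csqrt_sqr (z : C) : Csqrt z * Csqrt z = z.
Proof.
  assert (H1 := re_le_Cmod z). apply Rabs_le_between in H1.
  assert (H2 := Cmod2_alt z).
  set (x := sqrt ((Cmod z + Re z) / 2)). set (y := sqrt ((Cmod z - Re z) / 2)).
  assert (Hx : (x * x = (Cmod z + Re z) / 2)%R) by (apply sqrt_sqrt; lra).
  assert (Hy : (y * y = (Cmod z - Re z) / 2)%R) by (apply sqrt_sqrt; lra).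
  (* The sign in [Csqrt] then restores the sign of the imaginary part. *)
  assert (Hxy : (2 * (x * y) = Rabs (Im z))%R).
  { unfold x, y. rewrite <- sqrt_mult by lra. rewrite <- (sqrt_pow2 2) at 1 by lra.
    rewrite <- sqrt_mult by (simpl; nra).
    rewrite <- sqrt_Rsqr_abs. f_equal. unfold Rsqr.
    replace (2 ^ 2 * ((Cmod z + Re z) / 2 * ((Cmod z - Re z) / 2)))%R
      with (Cmod z ^ 2 - Re z ^ 2)%R by (simpl; field). rewrite H2. simpl; ring. }
  apply C_eq; unfold Csqrt; fold x y; destruct (Rle_dec 0 (Im z)) as [L|L].
  - change ((x * x - 1 * y * (1 * y))%R = Re z). lra.
  - change ((x * x - -1 * y * (-1 * y))%R = Re z). lra.
  - change ((x * (1 * y) + 1 * y * x)%R = Im z). rewrite Rabs_pos_eq in Hxy by exact L. lra.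
  - change ((x * (-1 * y) + -1 * y * x)%R = Im z). rewrite Rabs_left in Hxy by lra. lra.
Qed.

(** The other root is excluded because [Csqrt z + w] has positive real part. This identifies the
    principal root of 1 - sin^2 with cos. *)
Lemma Csqrt_unique (z w : C) : w * w = z -> (0 < Re w)%R -> Csqrt z = w.
Proof.
  intros Hw Hr. apply Ceq_minus. apply Cmult_eq_0_l with (Csqrt z + w).
  - transitivity (Csqrt z * Csqrt z - w * w); [ring|]. rewrite Csqrt_sqr, Hw. ring.
  - intro H. apply (f_equal Re) in H. rewrite Re_plus, re_RtoC in H.
    assert (K := Csqrt_Re_ge_0 z). lra.
Qed.

Lemma Csqrt_Re_pos (z : C) : (0 < Re z)%R -> (0 < Re (Csqrt z))%R.
Proof. intros H. apply sqrt_lt_R0. assert (K := Cmod_ge_0 z). lra. Qed.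

Lemma Csqrt_neq_0 (z : C) : (0 < Re z)%R -> Csqrt z <> 0.
Proof.
  intros H E. apply Csqrt_Re_pos in H. rewrite E, re_RtoC in H. lra.
Qed.

(** The error is -(S - s)^2 / (2s) with (S - s)(S + s) = w - z. Since Re S >= 0 for every [w], |S +
    s| >= Re s, so the cut of the principal branch causes no trouble. *)
Lemma Cdiff_Csqrt (z : C) : (0 < Re z)%R -> Cdiff Csqrt z.
Proof.
  intros Hz. exists (/ (2 * Csqrt z)). apply is_Cderive_iff. intros eps Heps.
  assert (Hs := Csqrt_Re_pos z Hz). assert (Hn := Csqrt_neq_0 z Hz).
  set (s := Csqrt z) in *. assert (Es : s * s = z) by apply Csqrt_sqr.
  assert (Ms : (0 < 2 * Cmod s)%R) by (assert (T := proj1 (Cmod_gt_0 _) Hn); lra).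
  assert (Q : (0 < Re s * Re s)%R) by (apply Rmult_lt_0_compat; exact Hs).
  exists (eps * (2 * Cmod s) * (Re s * Re s))%R. split.
  { repeat apply Rmult_lt_0_compat; lra. }
  intros w Hw. set (S := Csqrt w). assert (ES : S * S = w) by apply Csqrt_sqr.
  assert (HS : (Re s <= Cmod (S + s))%R).
  { eapply Rle_trans; [|apply Re_le_Cmod]. rewrite Re_plus.
    assert (K := Csqrt_Re_ge_0 w). fold S in K. lra. }
  assert (L : (Cmod (S - s) * Re s <= Cmod (w - z))%R).
  { replace (w - z) with ((S - s) * (S + s)) by (rewrite <- ES, <- Es; ring).
    rewrite Cmod_mult. apply Rmult_le_compat_l; [apply Cmod_ge_0|exact HS]. }
  replace (S - s - / (2 * s) * (w - z)) with (- ((S - s) * (S - s) / (2 * s)))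
    by (rewrite <- ES, <- Es; field; exact Hn).
  rewrite Cmod_opp, Cmod_div, !Cmod_mult by (apply Cmult_neq_0; [apply C2_neq_0|exact Hn]).
  rewrite (Cmod_R 2), Rabs_pos_eq by lra.
  apply (proj2 (Rle_div_l _ _ _ Ms)).
  assert (M1 := Cmod_ge_0 (S - s)). assert (M2 := Cmod_ge_0 (w - z)).
  apply Rmult_le_reg_r with (Re s * Re s)%R; [exact Q|].
  apply Rle_trans with (Cmod (w - z) * Cmod (w - z))%R.
  - replace (Cmod (S - s) * Cmod (S - s) * (Re s * Re s))%R
      with ((Cmod (S - s) * Re s) * (Cmod (S - s) * Re s))%R by ring.
    apply Rmult_le_compat; try exact L; apply Rmult_le_pos; lra.
  - apply Rle_trans with (Cmod (w - z) * (eps * (2 * Cmod s) * (Re s * Re s)))%R.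
    + apply Rmult_le_compat_l; lra.
    + apply Req_le; ring.
Qed.

(** * The hypergeometric function *)

Definition Cshift (a : nat -> C) (n : nat) : C := match n with O => 0 | S m => a m end.

Lemma Csummable_Cshift (a : nat -> C) (z : C) : Csummable (fun n => a n * z ^ n) ->
  Csummable (fun n => Cshift a n * z ^ n).
Proof.
  intros H. apply Csummable_S. apply Csummable_ext with (2 := Csummable_scal z _ H).
  intro n. simpl. ring.
Qed.

Lemma Cpseries_Cshift (a : nat -> C) (z : C) : Csummable (fun n => a n * z ^ n) ->
  z * Cpseries a z = Cpseries (Cshift a) z.
Proof.
  intros H. unfold Cpseries. rewrite (Cseries_S _ (Csummable_Cshift a z H)), <- Cseries_scal by exact H.
  simpl. rewrite Cmult_0_l, Cplus_0_l. apply Cseries_ext. intro n. ring.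
Qed.

Definition hcoef (n : nat) : C :=
  RtoC (poch (1 / 6) n * poch (5 / 6) n / (poch (1 / 2) n * INR (Factorial.fact n)))%R.

Lemma hyp2F1_Cpseries (w : C) : hyp2F1 (1 / 6) (5 / 6) (1 / 2) w = Cpseries hcoef w.
Proof. reflexivity. Qed.

Lemma poch_pos (a : R) (n : nat) : (0 < a)%R -> (0 < poch a n)%R.
Proof.
  intros Ha. induction n as [|n IH]; simpl; [lra|].
  apply Rmult_lt_0_compat; [exact IH|]. assert (K := pos_INR n). lra.
Qed.

Lemma hcoef_rec_R (n : nat) :
  (poch (1 / 6) (S n) * poch (5 / 6) (S n) / (poch (1 / 2) (S n) * INR (Factorial.fact (S n)))
   = poch (1 / 6) n * poch (5 / 6) n / (poch (1 / 2) n * INR (Factorial.fact n)) *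
     ((INR n + 1 / 6) * (INR n + 5 / 6) / ((INR n + 1) * (INR n + 1 / 2))))%R.
Proof.
  rewrite fact_simpl, mult_INR, S_INR. simpl poch.
  assert (K := pos_INR n). assert (F := INR_fact_neq_0 n).
  assert (P := poch_pos (1 / 2) n ltac:(lra)).
  field. repeat split; lra.
Qed.

Lemma hcoef_rec (n : nat) :
  (RtoC (INR n) + 1) * (RtoC (INR n) + / 2) * hcoef (S n) =
  (RtoC (INR n) + / 6) * (RtoC (INR n) + 5 / 6) * hcoef n.
Proof.
  unfold hcoef. rewrite hcoef_rec_R. set (x := (poch (1 / 6) n * _ / _)%R).
  assert (K := pos_INR n).
  rewrite <- (RtoC_inv 2), <- (RtoC_inv 6), <- (RtoC_div 5 6) by lra.
  rewrite <- !RtoC_plus, <- !RtoC_mult. f_equal. field. lra.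
Qed.

(** Consecutive quotients are at most 1, as (n + 1/6)(n + 5/6) <= (n + 1)(n + 1/2). This yields a
    radius of convergence of at least 1. *)
Lemma Cmod_hcoef_le_1 (n : nat) : (Cmod (hcoef n) <= 1)%R.
Proof.
  unfold hcoef. rewrite Cmod_R. induction n as [|n IH].
  - simpl. rewrite Rabs_pos_eq; [apply Req_le; field|lra].
  - rewrite hcoef_rec_R, Rabs_mult. apply Rle_trans with (1 * 1)%R; [|lra].
    apply Rmult_le_compat; try apply Rabs_pos; [exact IH|].
    assert (K := pos_INR n).
    assert (D : (0 < (INR n + 1) * (INR n + 1 / 2))%R) by (apply Rmult_lt_0_compat; lra).
    rewrite Rabs_pos_eq.
    + apply (proj2 (Rle_div_l _ _ _ D)). nra.
    + apply Rmult_le_pos; [apply Rmult_le_pos; lra|]. apply Rlt_le, Rinv_0_lt_compat, D.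
Qed.

Lemma Cradius_hcoef (w : C) : (Cmod w < 1)%R -> Rbar_lt (Cmod w) (Cradius hcoef).
Proof.
  intros H. apply Rbar_lt_le_trans with 1%R; [exact H|].
  apply Cradius_bound with 1%R; [lra|]. intro n. rewrite pow1, Rmult_1_r. apply Cmod_hcoef_le_1.
Qed.

(** For the parameters a = 1/6, b = 5/6, c = 1/2 one has a + b + 1 = 2 and ab = 5/36. All terms are
    collected in one series, whose coefficients vanish by [hcoef_rec]. *)
Lemma hypergeometric_ode (w : C) : (Cmod w < 1)%R ->
  w * (1 - w) * Cpseries (Cpderiv (Cpderiv hcoef)) w
  + (/ 2 - 2 * w) * Cpseries (Cpderiv hcoef) w - 5 / 36 * Cpseries hcoef w = 0.
Proof.
  intros Hw.
  assert (S0 : Csummable (fun n => hcoef n * w ^ n))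
    by (apply Csummable_Cradius, Cradius_hcoef, Hw).
  assert (S1 : Csummable (fun n => Cpderiv hcoef n * w ^ n))
    by (apply Csummable_Cradius; rewrite Cradius_Cpderiv; apply Cradius_hcoef, Hw).
  assert (S2 : Csummable (fun n => Cpderiv (Cpderiv hcoef) n * w ^ n))
    by (apply Csummable_Cradius; rewrite !Cradius_Cpderiv; apply Cradius_hcoef, Hw).
  assert (T1 := Csummable_Cshift _ _ S1). assert (T2 := Csummable_Cshift _ _ S2).
  assert (U2 := Csummable_Cshift _ _ T2).
  transitivity (Cpseries (Cshift (Cpderiv (Cpderiv hcoef))) w
    - Cpseries (Cshift (Cshift (Cpderiv (Cpderiv hcoef)))) w
    + / 2 * Cpseries (Cpderiv hcoef) w - 2 * Cpseries (Cshift (Cpderiv hcoef)) w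
    - 5 / 36 * Cpseries hcoef w).
  { rewrite <- (Cpseries_Cshift _ _ T2), <- (Cpseries_Cshift _ _ S2), <- (Cpseries_Cshift _ _ S1).
    ring. }
  assert (A1 := Csummable_scal (/ 2) _ S1). assert (A2 := Csummable_scal (- (2)) _ T1).
  assert (A3 := Csummable_scal (- (5 / 36)) _ S0). assert (A4 := Csummable_scal (- (1)) _ U2).
  cbv beta in *. unfold Cpseries.
  transitivity (Cseries (fun n => Cshift (Cpderiv (Cpderiv hcoef)) n * w ^ n
    + (- (1) * (Cshift (Cshift (Cpderiv (Cpderiv hcoef))) n * w ^ n)
    + (/ 2 * (Cpderiv hcoef n * w ^ n)
    + (- (2) * (Cshift (Cpderiv hcoef) n * w ^ n)
    + - (5 / 36) * (hcoef n * w ^ n)))))).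
  { assert (B1 := Csummable_plus _ _ A2 A3). assert (B2 := Csummable_plus _ _ A1 B1).
    assert (B3 := Csummable_plus _ _ A4 B2). cbv beta in *.
    rewrite (Cseries_plus _ _ T2 B3), (Cseries_plus _ _ A4 B2), (Cseries_plus _ _ A1 B1),
      (Cseries_plus _ _ A2 A3).
    rewrite !Cseries_scal by assumption. ring. }
  rewrite (Cseries_ext _ (fun n => 0 * (hcoef n * w ^ n))).
  { rewrite Cseries_scal by exact S0. ring. }
  intro n. transitivity ((Cshift (Cpderiv (Cpderiv hcoef)) n
    - Cshift (Cshift (Cpderiv (Cpderiv hcoef))) n + / 2 * Cpderiv hcoef n
    - 2 * Cshift (Cpderiv hcoef) n - 5 / 36 * hcoef n) * w ^ n); [ring|].
  transitivity (0 * w ^ n); [|ring]. f_equal.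
  transitivity ((RtoC (INR n) + 1) * (RtoC (INR n) + / 2) * hcoef (S n)
    - (RtoC (INR n) + / 6) * (RtoC (INR n) + 5 / 6) * hcoef n).
  (* The double shift makes the degrees 0 and 1 exceptional. *)
  - destruct n as [|[|n]]; unfold Cpderiv; cbn [Cshift];
      rewrite !S_INR, ?RtoC_plus; [simpl INR; field|simpl INR; field|field].
  - rewrite hcoef_rec. ring.
Qed.

Definition near0 (Q : C -> Prop) : Prop :=
  exists r, (0 < r)%R /\ forall z, (Cmod z < r)%R -> Q z.

Lemma near0_and (Q1 Q2 : C -> Prop) : near0 Q1 -> near0 Q2 -> near0 (fun z => Q1 z /\ Q2 z).
Proof.
  intros [r1 [H1 K1]] [r2 [H2 K2]]. exists (Rmin r1 r2).
  assert (L1 := Rmin_l r1 r2). assert (L2 := Rmin_r r1 r2).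
  split; [apply Rmin_pos; assumption|]. intros z Hz. split; [apply K1|apply K2]; lra.
Qed.

Lemma near0_Ccont (f : C -> C) (eps : R) : Ccont f 0 -> (0 < eps)%R ->
  near0 (fun z => Cmod (f z - f 0) < eps)%R.
Proof.
  intros Hf He. destruct (Hf eps He) as [r [Hr K]]. exists r. split; [exact Hr|].
  intros z Hz. apply K. replace (z - 0) with z by ring. exact Hz.
Qed.

Lemma Cdiff_Csin (z : C) : Cdiff Csin z.
Proof. exists (Ccos z). apply is_Cderive_Csin. Qed.

Lemma Cdiff_Ccos (z : C) : Cdiff Ccos z.
Proof. exists (- Csin z). apply is_Cderive_Ccos. Qed.

Definition hyp (w : C) : C := Cpseries hcoef w.

Lemma is_Cderive_hyp (w : C) : (Cmod w < 1)%R -> is_Cderive hyp w (Cpseries (Cpderiv hcoef) w).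
Proof. intros H. apply is_Cderive_Cpseries, Cradius_hcoef, H. Qed.

Lemma is_Cderive_hyp' (w : C) : (Cmod w < 1)%R ->
  is_Cderive (Cpseries (Cpderiv hcoef)) w (Cpseries (Cpderiv (Cpderiv hcoef)) w).
Proof.
  intros H. apply is_Cderive_Cpseries. rewrite Cradius_Cpderiv. apply Cradius_hcoef, H.
Qed.

Lemma hyp_0 : hyp 0 = 1.
Proof.
  unfold hyp. rewrite Cpseries_0. unfold hcoef. simpl. f_equal. field.
Qed.

Lemma Cmod_pow2_lt_1 (z : C) : (Cmod z < 1)%R -> (Cmod (z ^ 2) < 1)%R.
Proof.
  intros H. rewrite Cmod_pow. assert (K := Cmod_ge_0 z). simpl. nra.
Qed.

Lemma is_Cderive_cos_lin (a z : C) : is_Cderive (fun w => Ccos (a * w)) z (- a * Csin (a * z)).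
Proof.
  eapply is_Cderive_eq.
  - apply (is_Cderive_comp Ccos (fun w => a * w)); [apply is_Cderive_Ccos|].
    apply is_Cderive_scal, is_Cderive_id.
  - ring.
Qed.

Lemma is_Cderive_sin_lin (a z : C) : is_Cderive (fun w => Csin (a * w)) z (a * Ccos (a * z)).
Proof.
  eapply is_Cderive_eq.
  - apply (is_Cderive_comp Csin (fun w => a * w)); [apply is_Cderive_Csin|].
    apply is_Cderive_scal, is_Cderive_id.
  - ring.
Qed.

(** Uniqueness by two first integrals: y cos - (y'/a) sin and a y sin + y' cos are constant, and
    solving for y gives the cosine. *)
Lemma harmonic_oscillator (y y1 : C -> C) (a : C) (r : R) : a <> 0 ->
  (forall z, (Cmod z < r)%R -> is_Cderive y z (y1 z) /\ is_Cderive y1 z (- a ^ 2 * y z)) ->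
  y 0 = 1 -> y1 0 = 0 -> forall z, (Cmod z < r)%R -> y z = Ccos (a * z).
Proof.
  intros Ha Hy H0 H1 z Hz.
  assert (A : y z * Ccos (a * z) - / a * (y1 z * Csin (a * z)) = 1).
  { rewrite (constant_of_derive_0
      (fun w => y w * Ccos (a * w) - / a * (y1 w * Csin (a * w))) r) with (2 := Hz).
    - rewrite H0, H1, Cmult_0_r, Ccos_0. ring.
    - intros w Hw. destruct (Hy w Hw) as [D1 D2]. eapply is_Cderive_eq.
      + apply is_Cderive_minus; [|apply is_Cderive_scal]; apply is_Cderive_mult;
          [exact D1|apply is_Cderive_cos_lin|exact D2|apply is_Cderive_sin_lin].
      + cbv beta. field. exact Ha. }
  assert (B : a * (y z * Csin (a * z)) + y1 z * Ccos (a * z) = 0).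
  { rewrite (constant_of_derive_0
      (fun w => a * (y w * Csin (a * w)) + y1 w * Ccos (a * w)) r) with (2 := Hz).
    - rewrite H0, H1, Cmult_0_r, Csin_0. ring.
    - intros w Hw. destruct (Hy w Hw) as [D1 D2]. eapply is_Cderive_eq.
      + apply is_Cderive_plus; [apply is_Cderive_scal|]; apply is_Cderive_mult;
          [exact D1|apply is_Cderive_sin_lin|exact D2|apply is_Cderive_cos_lin].
      + cbv beta. ring. }
  assert (E := Csin2_Ccos2 (a * z)).
  transitivity (y z * (Csin (a * z) ^ 2 + Ccos (a * z) ^ 2)); [rewrite E; ring|].
  transitivity ((y z * Ccos (a * z) - / a * (y1 z * Csin (a * z))) * Ccos (a * z)
    + / a * (a * (y z * Csin (a * z)) + y1 z * Ccos (a * z)) * Csin (a * z)).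
  - field. exact Ha.
  - rewrite A, B. ring.
Qed.

Lemma RtoC_neq_0 (x : R) : x <> 0%R -> RtoC x <> 0.
Proof. intros H E. apply RtoC_inj in E. contradiction. Qed.

Lemma hyp_sin2 (r : R) (z : C) : (forall w, (Cmod w < r)%R -> (Cmod (Csin w) < 1)%R) ->
  (Cmod z < r)%R -> Ccos z * hyp (Csin z ^ 2) = Ccos (2 / 3 * z).
Proof.
  intros Hr Hz.
  set (h1 := Cpseries (Cpderiv hcoef)). set (h2 := Cpseries (Cpderiv (Cpderiv hcoef))).
  apply (harmonic_oscillator (fun z => Ccos z * hyp (Csin z ^ 2))
    (fun z => 2 * (Csin z * Ccos z ^ 2 * h1 (Csin z ^ 2)) - Csin z * hyp (Csin z ^ 2))
    (2 / 3) r).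
  - apply Cmult_neq_0; [apply C2_neq_0|]. intro E. 
    assert (K : 3 * / 3 = 1) by (apply Cinv_r, RtoC_neq_0; lra).
    rewrite E in K. apply C1_nz. rewrite <- K. ring.
  - intros w Hw. assert (Hs := Cmod_pow2_lt_1 _ (Hr w Hw)).
    assert (Ds := is_Cderive_Csin w). assert (Dc := is_Cderive_Ccos w).
    assert (Ds2 := is_Cderive_sqr _ _ _ Ds). assert (Dc2 := is_Cderive_sqr _ _ _ Dc).
    assert (Dh := is_Cderive_comp hyp (fun w => Csin w ^ 2) w _ _ (is_Cderive_hyp _ Hs) Ds2).
    assert (Dh1 := is_Cderive_comp h1 (fun w => Csin w ^ 2) w _ _ (is_Cderive_hyp' _ Hs) Ds2).
    fold h1 in Dh. fold h2 in Dh1. cbv beta in *.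
    assert (E := Csin2_Ccos2 w).
    split.
    + eapply is_Cderive_eq; [apply (is_Cderive_mult _ _ _ _ _ Dc Dh)|]. ring.
    + eapply is_Cderive_eq.
      * apply is_Cderive_minus; [apply is_Cderive_scal|].
        -- apply is_Cderive_mult; [apply is_Cderive_mult; [exact Ds|exact Dc2]|exact Dh1].
        -- apply is_Cderive_mult; [exact Ds|exact Dh].
      * cbv beta. assert (O := hypergeometric_ode _ Hs). fold h1 h2 in O.
        change (Cpseries hcoef (Csin w ^ 2)) with (hyp (Csin w ^ 2)) in O.
        set (s := Csin w) in *. set (c := Ccos w) in *.
        assert (Ec : c ^ 2 = 1 - s ^ 2) by (rewrite <- E; ring).
        (* The second derivative is 4c times the hypergeometric equation at s^2, plus -(4/9) c
           F(s^2), plus a multiple of c^2 - (1 - s^2). *)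
        transitivity (4 * c * (s ^ 2 * (1 - s ^ 2) * h2 (s ^ 2)
          + (/ 2 - 2 * s ^ 2) * h1 (s ^ 2) - 5 / 36 * hyp (s ^ 2))
          + - (2 / 3) ^ 2 * (c * hyp (s ^ 2))
          + (4 * c * s ^ 2 * h2 (s ^ 2) + 2 * c * h1 (s ^ 2)) * (c ^ 2 - (1 - s ^ 2))).
        -- field.
        -- rewrite O, Ec. ring.
  - rewrite Csin_0, Ccos_0. replace (0 ^ 2) with (RtoC 0) by (simpl; ring).
    rewrite hyp_0. ring.
  - rewrite Csin_0. ring.
  - exact Hz.
Qed.

Definition u_integrand (kappa : R) (t : C) : C :=
  hyp2F1 (1 / 6) (5 / 6) (1 / 2) (RtoC kappa ^ 2 * t ^ 2) / Csqrt (1 - t ^ 2).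

Lemma Cdiff_u_integrand (kappa : R) (t : C) : (0 < kappa < 1)%R -> (Cmod t < 1)%R ->
  Cdiff (u_integrand kappa) t.
Proof.
  intros Hk Ht.
  assert (H2 := Cmod_pow2_lt_1 t Ht).
  assert (Hre : (0 < Re (1 - t ^ 2))%R).
  { change (Re (1 - t ^ 2)) with (1 - Re (t ^ 2))%R. assert (K := Re_le_Cmod (t ^ 2)). lra. }
  assert (Hk2 : (Cmod (RtoC kappa ^ 2 * t ^ 2) < 1)%R).
  { replace (RtoC kappa ^ 2 * t ^ 2) with ((RtoC kappa * t) ^ 2) by ring.
    apply Cmod_pow2_lt_1. rewrite Cmod_mult, Cmod_R, Rabs_pos_eq by lra.
    assert (K := Cmod_ge_0 t). nra. }
  apply Cdiff_div.
  - apply (Cdiff_comp hyp (fun t => RtoC kappa ^ 2 * t ^ 2)).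
    + eexists. apply is_Cderive_hyp, Hk2.
    + apply Cdiff_mult; [apply Cdiff_const|apply Cdiff_pow, Cdiff_id].
  - apply (Cdiff_comp Csqrt (fun t => 1 - t ^ 2)); [apply Cdiff_Csqrt, Hre|].
    apply Cdiff_minus; [apply Cdiff_const|apply Cdiff_pow, Cdiff_id].
  - apply Csqrt_neq_0, Hre.
Qed.

Lemma Cint0_SInt (f : C -> C) (x : C) : Cint0 f x = SInt f 0 x.
Proof.
  unfold SInt. rewrite (CInt_ext _ (fun t => f (RtoC t * x))).
  - unfold Cint0. f_equal. ring.
  - lra.
  - intros t _. f_equal. unfold seg. ring.
Qed.

(** The cosine from the chain rule cancels the square root in the integrand; Re cos > 0 ensures that
    the principal root of 1 - sin^2 is cos itself. *)
Lemma is_Cderive_u_of_phi (kappa : R) (z : C) : (0 < kappa < 1)%R ->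
  (Cmod (Csin z) < 1)%R -> (0 < Re (Ccos z))%R ->
  is_Cderive (u_of_phi kappa) z (hyp ((RtoC kappa * Csin z) ^ 2)).
Proof.
  intros Hk Hs Hc.
  assert (Hd : forall t, (Cmod t < 1)%R -> Cdiff (u_integrand kappa) t)
    by (intros; apply Cdiff_u_integrand; assumption).
  assert (D : is_Cderive (Cint0 (u_integrand kappa)) (Csin z) (u_integrand kappa (Csin z))).
  { apply is_Cderive_ext_loc with (f := SInt (u_integrand kappa) 0) (e := 1%R); [lra| |].
    - intros w _. symmetry. apply Cint0_SInt.
    - apply is_Cderive_SInt with 1%R; try assumption.
      + intros t Ht. apply Cdiff_Ccont, Hd, Ht.
      + intros t Ht _. apply Hd, Ht.
      + rewrite Cmod_0; lra. }
  eapply is_Cderive_eq.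
  - exact (is_Cderive_comp (Cint0 (u_integrand kappa)) Csin z _ _ D (is_Cderive_Csin z)).
  - unfold u_integrand. rewrite (Csqrt_unique (1 - Csin z ^ 2) (Ccos z)).
    + rewrite hyp2F1_Cpseries. fold (hyp (RtoC kappa ^ 2 * Csin z ^ 2)).
      replace ((RtoC kappa * Csin z) ^ 2) with (RtoC kappa ^ 2 * Csin z ^ 2) by ring.
      field. intro E. rewrite E, re_RtoC in Hc. lra.
    + rewrite <- (Csin2_Ccos2 z). ring.
    + exact Hc.
Qed.

Lemma u_of_phi_0 (kappa : R) : u_of_phi kappa 0 = 0.
Proof. unfold u_of_phi. rewrite Csin_0. unfold Cint0. ring. Qed.

(** * Local inversion *)

(** Makes f - id a contraction of ratio 1/2, so that the inverse function theorem comes with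
    explicit radii. *)
Definition near_identity (r : R) (f : C -> C) : Prop :=
  f 0 = 0 /\ forall z, (Cmod z < r)%R -> exists d, is_Cderive f z d /\ (Cmod (d - 1) <= 1 / 2)%R.

Lemma near_identity_contract (r : R) (f : C -> C) (z w : C) : near_identity r f ->
  (Cmod z < r)%R -> (Cmod w < r)%R -> (Cmod (f z - f w - (z - w)) <= 1 / 2 * Cmod (z - w))%R.
Proof.
  intros [_ Hf] Hz Hw.
  replace (f z - f w - (z - w)) with ((f z - z) - (f w - w)) by ring.
  apply (Cmod_le_of_derive (fun z => f z - z) w z). intros t Ht.
  destruct (Hf (seg w z t)) as [d [Hd Hd1]]; [apply Cmod_seg_lt; assumption|].
  exists (d - 1). split; [|exact Hd1]. apply is_Cderive_minus; [exact Hd|apply is_Cderive_id].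
Qed.

Lemma near_identity_expand (r : R) (f : C -> C) (z w : C) : near_identity r f ->
  (Cmod z < r)%R -> (Cmod w < r)%R -> (Cmod (z - w) <= 2 * Cmod (f z - f w))%R.
Proof.
  intros Hf Hz Hw. assert (K := near_identity_contract r f z w Hf Hz Hw).
  assert (T := Cmod_triangle_inv (z - w) (f z - f w)).
  rewrite (Cmod_minus_sym (z - w)) in T. lra.
Qed.

Lemma near_identity_le (r : R) (f : C -> C) (z : C) : near_identity r f ->
  (Cmod z < r)%R -> (Cmod z <= 2 * Cmod (f z))%R /\ (Cmod (f z) <= 3 / 2 * Cmod z)%R.
Proof.
  intros Hf Hz. assert (H0 : (Cmod 0 < r)%R) by (rewrite Cmod_0; assert (K := Cmod_ge_0 z); lra).
  assert (K1 := near_identity_expand r f z 0 Hf Hz H0).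
  assert (K2 := near_identity_contract r f z 0 Hf Hz H0).
  destruct Hf as [E _]. rewrite E in K1, K2.
  replace (z - 0) with z in * by ring. replace (f z - 0) with (f z) in * by ring.
  assert (T := Cmod_triangle_inv (f z) z). lra.
Qed.

(** Newton's iteration with slope frozen at 1, started at 0. Its steps are at most |y| 2^(-n), so
    the iterates stay below 2 |y| < r. *)
Lemma near_identity_surj (r : R) (f : C -> C) (y : C) : near_identity r f -> (Cmod y < r / 2)%R ->
  exists z, (Cmod z < r)%R /\ f z = y.
Proof.
  intros Hf Hy. assert (My := Cmod_ge_0 y).
  set (x := fix x n := match n with O => RtoC 0 | S m => x m + (y - f (x m)) end).
  assert (Hx : forall n, (Cmod (x n) <= 2 * Cmod y * (1 - (1 / 2) ^ n))%R /\
     (Cmod (x (S n) - x n) <= Cmod y * (1 / 2) ^ n)%R).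
  { induction n as [|n [IH1 IH2]].
    - simpl. rewrite (proj1 Hf), Cmod_0. replace (0 + (y - 0) - 0) with y by ring. lra.
    - assert (Hp : (0 < (1 / 2) ^ n)%R) by (apply pow_lt; lra).
      assert (B1 : (Cmod (x (S n)) <= 2 * Cmod y * (1 - (1 / 2) ^ S n))%R).
      { assert (T := Cmod_triangle_inv (x (S n)) (x n)). simpl pow. lra. }
      split; [exact B1|].
      assert (Hp1 : (0 < (1 / 2) ^ S n)%R) by (apply pow_lt; lra).
      assert (K := near_identity_contract r f (x (S n)) (x n) Hf).
      replace (x (S (S n)) - x (S n)) with (- (f (x (S n)) - f (x n) - (x (S n) - x n))).
      + rewrite Cmod_opp. eapply Rle_trans; [apply K; nra|]. simpl pow. lra.
      + simpl. ring. }
  destruct (geometric_limit x (Cmod y) (1 / 2)) as [z Hz]; [lra|intro n; apply Hx|].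
  assert (Mz : (Cmod z <= 2 * Cmod y)%R).
  { specialize (Hz O). simpl in Hz. replace (z - 0) with z in Hz by ring. lra. }
  exists z. split; [lra|].
  (* In units of |y| 2^(-n) the three terms of the decomposition below are at most 1, 2 and 1. *)
  apply (eq_of_geometric _ _ (4 * Cmod y) (1 / 2) ltac:(lra)). intro n.
  specialize (Hz n). destruct (Hx n) as [X1 X2].
  assert (Hp : (0 < (1 / 2) ^ n)%R) by (apply pow_lt; lra).
  assert (K := near_identity_contract r f z (x n) Hf ltac:(lra) ltac:(nra)).
  replace (f z - y) with ((f z - f (x n) - (z - x n)) + (z - x n) - (x (S n) - x n))
    by (simpl; ring).
  unfold Cminus at 1. eapply Rle_trans; [apply Cmod_triangle|]. rewrite Cmod_opp.
  assert (T := Cmod_triangle (f z - f (x n) - (z - x n)) (z - x n)). lra.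
Qed.

Lemma near_identity_inverse (r : R) (f : C -> C) : (0 < r)%R -> near_identity r f ->
  exists h : C -> C, h 0 = 0 /\ forall y, (Cmod y < r / 2)%R -> Cdiff h y /\ f (h y) = y /\ (Cmod (h y) < r)%R.
Proof.
  intros Hr Hf.
  destruct (functional_choice (fun y z => (Cmod y < r / 2)%R -> (Cmod z < r)%R /\ f z = y))
    as [h Hh].
  { intro y. destruct (Rlt_dec (Cmod y) (r / 2)) as [L|L].
    - destruct (near_identity_surj r f y Hf L) as [z Hz]. exists z; auto.
    - exists (RtoC 0). intro; contradiction. }
  exists h. split.
  - destruct (Hh 0) as [H1 H2]; [rewrite Cmod_0; lra|].
    destruct (near_identity_le r f (h 0) Hf H1) as [K _]. rewrite H2, Cmod_0 in K.
    apply Cmod_eq_0. assert (M := Cmod_ge_0 (h 0)). lra.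
  - intros y Hy. destruct (Hh y Hy) as [H1 H2]. split; [|split; assumption].
    destruct Hf as [Hf0 Hf1]. destruct (Hf1 (h y) H1) as [d [Hd Hd1]].
    assert (Hf : near_identity r f) by (split; assumption).
    assert (Md : (1 / 2 <= Cmod d)%R).
    { assert (T := Cmod_triangle_inv 1 d). rewrite Cmod_1, (Cmod_minus_sym 1) in T. lra. }
    assert (Hd0 : d <> 0) by (apply Cmod_gt_0; lra).
    exists (/ d). apply is_Cderive_iff. intros eps Heps.
    (* One factor 2 is lost because [h] is 2-Lipschitz, another in dividing by [d], whose modulus is
       at least 1/2. *)
    destruct (proj1 (is_Cderive_iff f (h y) d) Hd (eps / 4)%R ltac:(lra)) as [del [Hdel K]].
    exists (Rmin (del / 2) (r / 2 - Cmod y)). split; [apply Rmin_pos; lra|].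
    intros w Hw.
    assert (W1 := Rlt_le_trans _ _ _ Hw (Rmin_l _ _)).
    assert (W2 := Rlt_le_trans _ _ _ Hw (Rmin_r _ _)).
    assert (Hwr : (Cmod w < r / 2)%R) by (assert (T := Cmod_triangle_inv w y); lra).
    destruct (Hh w Hwr) as [V1 V2].
    assert (L := near_identity_expand r f (h w) (h y) Hf V1 H1). rewrite V2, H2 in L.
    specialize (K (h w) ltac:(lra)). rewrite V2, H2 in K.
    replace (h w - h y - / d * (w - y)) with (- (w - y - d * (h w - h y)) / d)
      by (field; exact Hd0).
    rewrite Cmod_div, Cmod_opp by exact Hd0.
    apply (proj2 (Rle_div_l _ _ _ (proj1 (Cmod_gt_0 _) Hd0))).
    assert (M := Cmod_ge_0 (w - y)).
    assert (Q : (eps * Cmod (w - y) * (1 / 2) <= eps * Cmod (w - y) * Cmod d)%R).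
    { apply Rmult_le_compat_l; [apply Rmult_le_pos; lra|exact Md]. }
    assert (Q2 : (eps / 4 * Cmod (h w - h y) <= eps / 4 * (2 * Cmod (w - y)))%R)
      by (apply Rmult_le_compat_l; lra).
    lra.
Qed.

(* A continuous function cannot jump over the annulus [a <= |z| < b]. *)
Lemma stays_small (h : C -> C) (r a b : R) : (0 < a)%R -> (a < b)%R ->
  (forall u, (Cmod u < r)%R -> Ccont h u) -> h 0 = 0 ->
  (forall u, (Cmod u < r)%R -> (Cmod (h u) < b)%R -> (Cmod (h u) < a)%R) ->
  forall u, (Cmod u < r)%R -> (Cmod (h u) < a)%R.
Proof.
  intros Ha Hab Hc H0 Hgap u Hu. assert (Mu := Cmod_ge_0 u).
  assert (Hin : forall t, (0 <= t <= 1)%R -> (Cmod (RtoC t * u) < r)%R).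
  { intros t Ht. rewrite Cmod_mult, Cmod_R, Rabs_pos_eq by lra. nra. }
  assert (K : (Cmod (h (RtoC 0 * u)%C) < a)%R -> (Cmod (h (RtoC 1 * u)%C) < a)%R).
  { apply (interval_induction (fun s t => (Cmod (h (RtoC s * u)%C) < a)%R ->
      (Cmod (h (RtoC t * u)%C) < a)%R)).
    - tauto.
    - intros t Ht. set (x := Cmod (h (RtoC t * u))).
      assert (He : exists e, (0 < e)%R /\ (forall y, (Rabs (y - x) < e)%R -> (y < a)%R) \/
         (0 < e)%R /\ (forall y, (Rabs (y - x) < e)%R -> (a <= y)%R)).
      { destruct (Rlt_dec x b) as [L|L].
        - assert (La : (x < a)%R) by (apply Hgap; [apply Hin; exact Ht|exact L]).
          exists (a - x)%R. left. split; [lra|]. intros y Hy. apply Rabs_def2 in Hy. lra.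
        - exists (b - a)%R. right. split; [lra|]. intros y Hy. apply Rabs_def2 in Hy. lra. }
      assert (Hcont : forall e, (0 < e)%R -> exists del, (0 < del)%R /\
         forall s, (Rabs (s - t) < del)%R -> (Rabs (Cmod (h (RtoC s * u)%C) - x) < e)%R).
      { intros e He'. destruct (Hc _ (Hin t Ht) e He') as [d [Hd Kd]].
        exists (d / (Cmod u + 1))%R. split; [apply Rdiv_lt_0_compat; lra|].
        intros s Hs. assert (Q := Kd _ (Cmod_scal_close s t u d Hd Hs)).
        unfold x. assert (T1 := Cmod_triangle_inv (h (RtoC s * u)) (h (RtoC t * u))).
        assert (T2 := Cmod_triangle_inv (h (RtoC t * u)) (h (RtoC s * u))).
        rewrite Cmod_minus_sym in T2. apply Rabs_def1; lra. }
      destruct He as [e [[He Hy]|[He Hy]]]; destruct (Hcont e He) as [del [Hd Kd]];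
        exists del; (split; [exact Hd|]); intros s s' Hs Hs' L1 L2 Hlow.
      + apply Hy, Kd. apply Rabs_def1; lra.
      + exfalso. assert (Q := Hy _ (Kd s ltac:(apply Rabs_def1; lra))). lra. }
  replace (RtoC 1 * u) with u in K by ring. apply K.
  replace (RtoC 0 * u) with (RtoC 0) by ring. rewrite H0, Cmod_0. exact Ha.
Qed.

Lemma elliptic_sqr (E : C -> C) (P : C -> Prop) : elliptic E P -> elliptic (fun z => E z ^ 2) P.
Proof.
  intros [[H1 [H2 H3]] [w1 [w2 [Hw Hper]]]]. split.
  - split; [exact H1|]. split.
    + intros z Hz. apply Cdiff_pow, H2, Hz.
    + intros p Hp M. destruct (H3 p Hp (Rmax 1 M)) as [del [Hd K]].
      exists del; split; [exact Hd|]. intros w Hw'. specialize (K w Hw').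
      assert (L1 := Rmax_l 1 M). assert (L2 := Rmax_r 1 M).
      rewrite Cmod_pow. simpl. nra.
  - exists w1, w2. split; [exact Hw|]. intros z. destruct (Hper z) as [P1 [P2 P3]].
    split; [exact P1|]. split; [exact P2|]. intros Hz. destruct (P3 Hz) as [E1 E2].
    rewrite E1, E2. auto.
Qed.

(** * The functions phi and psi *)

(** In order: the integrand is differentiable at sin z; cos has positive real part and sin is near
    the identity; the denominator cos (2z/3) is nonzero; the derivative of [u_of_phi] is close to
    1. *)
Definition good_point (kappa : R) (z : C) : Prop :=
  (Cmod (Csin z) < 1)%R /\ (Cmod (Ccos z - 1) < 1 / 2)%R /\
  (Cmod (Ccos (2 / 3 * z) - 1) < 1 / 2)%R /\
  (Cmod (hyp ((RtoC kappa * Csin z) ^ 2) - 1) < 1 / 2)%R.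

Lemma near0_good_point (kappa : R) : near0 (good_point kappa).
Proof.
  assert (Z : forall c : C, c * 0 = 0) by (intro; ring).
  assert (H1 := near0_Ccont Csin 1 (Cdiff_Ccont _ _ (Cdiff_Csin 0)) ltac:(lra)).
  assert (H2 := near0_Ccont Ccos (1 / 2) (Cdiff_Ccont _ _ (Cdiff_Ccos 0)) ltac:(lra)).
  assert (H3 := near0_Ccont (fun z => Ccos (2 / 3 * z)) (1 / 2)
    (is_Cderive_Ccont _ _ _ (is_Cderive_cos_lin (2 / 3) 0)) ltac:(lra)).
  assert (H4 : near0 (fun z => Cmod (hyp ((RtoC kappa * Csin z) ^ 2)
     - hyp ((RtoC kappa * Csin 0) ^ 2)) < 1 / 2)%R).
  { apply (near0_Ccont (fun z => hyp ((RtoC kappa * Csin z) ^ 2))); [|lra].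
    apply Cdiff_Ccont. apply (Cdiff_comp hyp (fun z => (RtoC kappa * Csin z) ^ 2)).
    - eexists. apply is_Cderive_hyp. rewrite Csin_0, Z. simpl. rewrite Cmult_0_l, Cmod_0. lra.
    - apply (Cdiff_pow (fun z => RtoC kappa * Csin z)), Cdiff_mult;
        [apply Cdiff_const|apply Cdiff_Csin]. }
  destruct (near0_and _ _ (near0_and _ _ H1 H2) (near0_and _ _ H3 H4)) as [r [Hr K]].
  exists r. split; [exact Hr|]. intros z Hz. destruct (K z Hz) as [[K1 K2] [K3 K4]].
  cbv beta in *. rewrite Csin_0, Z in K4. rewrite Csin_0 in K1. rewrite Ccos_0 in K2.
  rewrite Z, Ccos_0 in K3.
  replace (Csin z - 0) with (Csin z) in K1 by ring.
  replace (0 ^ 2) with (RtoC 0) in K4 by (simpl; ring). rewrite hyp_0 in K4.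
  repeat split; assumption.
Qed.

Lemma neq_0_of_close_1 (w : C) : (Cmod (w - 1) < 1 / 2)%R -> w <> 0 /\ (0 < Re w)%R.
Proof.
  intros H. assert (Hre : (0 < Re w)%R).
  { assert (K := Re_le_Cmod (1 - w)). rewrite Cmod_minus_sym in K.
    change (Re (1 - w)) with (1 - Re w)%R in K. lra. }
  split; [|exact Hre]. intro E. rewrite E, re_RtoC in Hre. lra.
Qed.

Lemma near_identity_Csin (kappa r : R) :
  (forall z, (Cmod z < r)%R -> good_point kappa z) -> near_identity r Csin.
Proof.
  intros H. split; [apply Csin_0|]. intros z Hz. exists (Ccos z).
  split; [apply is_Cderive_Csin|]. destruct (H z Hz) as [_ [K _]]. lra.
Qed.

Lemma near_identity_u_of_phi (kappa r : R) : (0 < kappa < 1)%R ->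
  (forall z, (Cmod z < r)%R -> good_point kappa z) -> near_identity r (u_of_phi kappa).
Proof.
  intros Hk H. split; [apply u_of_phi_0|]. intros z Hz.
  destruct (H z Hz) as [K1 [K2 [_ K4]]]. destruct (neq_0_of_close_1 _ K2) as [_ Hre].
  exists (hyp ((RtoC kappa * Csin z) ^ 2)).
  split; [apply is_Cderive_u_of_phi; assumption|lra].
Qed.

Lemma Cmod_kappa_Csin_le (kappa r : R) (z : C) : (0 < kappa < 1)%R ->
  near_identity r Csin -> (Cmod z < r)%R -> (Cmod (RtoC kappa * Csin z) <= 3 / 2 * Cmod z)%R.
Proof.
  intros Hk Hs Hz. destruct (near_identity_le r Csin z Hs Hz) as [_ K].
  rewrite Cmod_mult, Cmod_R, Rabs_pos_eq by lra. assert (M := Cmod_ge_0 (Csin z)). nra.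
Qed.

Lemma setting_exists (kappa r : R) : (0 < kappa < 1)%R -> (0 < r)%R ->
  (forall z, (Cmod z < r)%R -> good_point kappa z) ->
  exists phi psi, setting kappa (r / 12) phi psi.
Proof.
  intros Hk Hr H.
  assert (Hsin := near_identity_Csin kappa r H).
  assert (Hu := near_identity_u_of_phi kappa r Hk H).
  destruct (near_identity_inverse r _ Hr Hsin) as [asin [A0 A]].
  destruct (near_identity_inverse r _ Hr Hu) as [phi [P0 P]].
  exists phi, (fun u => asin (RtoC kappa * Csin (phi u))).
  split; [exact P0|]. split.
  { rewrite P0, Csin_0. replace (RtoC kappa * 0) with (RtoC 0) by ring. exact A0. }
  intros u Hu'. destruct (P u ltac:(lra)) as [D1 [E1 B1]].
  assert (B2 : (Cmod (RtoC kappa * Csin (phi u)) < r / 2)%R).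
  { assert (K1 := Cmod_kappa_Csin_le kappa r (phi u) Hk Hsin B1).
    destruct (near_identity_le r _ (phi u) Hu B1) as [K2 _]. rewrite E1 in K2. lra. }
  destruct (A _ B2) as [D2 [E2 _]].
  repeat split; try assumption.
  apply (Cdiff_comp asin (fun u => RtoC kappa * Csin (phi u))); [exact D2|].
  apply Cdiff_mult; [apply Cdiff_const|]. apply (Cdiff_comp Csin phi); [apply Cdiff_Csin|exact D1].
Qed.

(** A priori phi and psi could take distant values solving the same equations. As long as |phi u| <
    r, injectivity near 0 gives |phi u| <= 2 |u|, and similarly |psi u| <= 6 |u|; [stays_small]
    turns these conditional estimates into actual ones. *)
Lemma setting_bounds (kappa r : R) (phi psi : C -> C) : (0 < kappa < 1)%R -> (0 < r)%R ->
  (forall z, (Cmod z < r)%R -> good_point kappa z) -> setting kappa (r / 12) phi psi ->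
  forall u, (Cmod u < r / 12)%R -> (Cmod (phi u) < r / 2)%R /\ (Cmod (psi u) < r / 2)%R.
Proof.
  intros Hk Hr H [P0 [Q0 Hset]].
  assert (Hsin := near_identity_Csin kappa r H).
  assert (Hu := near_identity_u_of_phi kappa r Hk H).
  assert (Bphi : forall u, (Cmod u < r / 12)%R -> (Cmod (phi u) < r)%R ->
     (Cmod (phi u) <= 2 * Cmod u)%R).
  { intros u Hu1 Hu2. destruct (Hset u Hu1) as [_ [E _]].
    destruct (near_identity_le r _ (phi u) Hu Hu2) as [K _]. rewrite E in K. exact K. }
  assert (Sphi : forall u, (Cmod u < r / 12)%R -> (Cmod (phi u) < r / 2)%R).
  { apply stays_small with r; try lra; try assumption.
    - intros u Hu1. apply Cdiff_Ccont, Hset, Hu1.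
    - intros u Hu1 Hu2. assert (K := Bphi u Hu1 Hu2). lra. }
  intros u Hu1. split; [apply Sphi, Hu1|]. revert u Hu1.
  apply stays_small with r; try lra; try assumption.
  - intros u Hu1. apply Cdiff_Ccont, Hset, Hu1.
  - intros u Hu1 Hu2. destruct (Hset u Hu1) as [_ [_ [_ E]]].
    assert (S := Sphi u Hu1). assert (K1 := Bphi u Hu1 ltac:(lra)).
    assert (K2 := Cmod_kappa_Csin_le kappa r (phi u) Hk Hsin ltac:(lra)).
    destruct (near_identity_le r _ (psi u) Hsin Hu2) as [K3 _]. rewrite E in K3. lra.
Qed.

(** Differentiating the identity u(phi(u)) = u gives F(sin^2 psi) phi' = 1, and [hyp_sin2] evaluates
    F. *)
Lemma setting_derive (kappa r : R) (phi psi : C -> C) (u : C) : (0 < kappa < 1)%R -> (0 < r)%R ->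
  (forall z, (Cmod z < r)%R -> good_point kappa z) -> setting kappa (r / 12) phi psi ->
  (Cmod u < r / 12)%R ->
  exists d, is_Cderive phi u d /\ d * Ccos (2 / 3 * psi u) = Ccos (psi u).
Proof.
  intros Hk Hr H Hset Hu. destruct (setting_bounds kappa r phi psi Hk Hr H Hset u Hu) as [B1 B2].
  destruct Hset as [_ [_ Hset]]. destruct (Hset u Hu) as [[d Hd] [_ [_ E]]].
  exists d. split; [exact Hd|].
  destruct (H (phi u) ltac:(lra)) as [G1 [G2 _]]. destruct (neq_0_of_close_1 _ G2) as [_ Hre].
  assert (D := is_Cderive_comp _ _ _ _ _ (is_Cderive_u_of_phi kappa (phi u) Hk G1 Hre) Hd).
  assert (D1 : is_Cderive (fun v => u_of_phi kappa (phi v)) u 1).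
  { apply is_Cderive_ext_loc with (f := fun v => v) (e := (r / 12 - Cmod u)%R); [lra| |apply is_Cderive_id].
    intros w Hw. symmetry. apply Hset. assert (T := Cmod_triangle_inv w u). lra. }
  assert (E1 := is_Cderive_unique _ _ _ _ D D1). rewrite <- E in E1.
  assert (E2 := hyp_sin2 r (psi u) (fun w Hw => proj1 (H w Hw)) ltac:(lra)).
  rewrite <- E2. transitivity (Ccos (psi u) * (hyp (Csin (psi u) ^ 2) * d)); [ring|].
  rewrite E1. ring.
Qed.

Lemma germ_of_ode (k : C) (T g : C -> C) (E : C -> C) (P : C -> Prop) (rho : R) : (0 < rho)%R ->
  (forall u, (Cmod u < rho)%R -> ~ P u /\ E u = T u) -> holo_disc 0 rho g ->
  (forall u, (0 < Cmod u < rho)%R -> exists d, is_Cderive T u d /\ jquart k (T u) <> 0 /\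
     d ^ 2 = g u * jquart k (T u) /\
     (4 - 3 * g u) ^ 2 * (1 + T u) ^ 2 = g u ^ 3 * (1 + (1 - 2 * k) * T u) ^ 2) ->
  germ k E P 0 rho g.
Proof.
  intros Hrho HE Hg HT. split; [exact Hrho|]. split; [exact Hg|].
  intros u Hu. replace (u - 0) with u in Hu by ring.
  destruct (HE u ltac:(lra)) as [HP Eu]. destruct (HT u Hu) as [d [Hd [Q [H1 H2]]]].
  rewrite Eu. replace (C_derive E u) with d; [repeat split; assumption|].
  symmetry. apply C_derive_eq.
  apply is_Cderive_ext_loc with (f := T) (e := (rho - Cmod u)%R); [lra| |exact Hd].
  intros w Hw. symmetry. apply HE. assert (T' := Cmod_triangle_inv w u). lra.
Qed.

(** * Algebra of the differential equation and of the cubic relation *)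

Lemma jquart_tan2 (k s c : C) : c <> 0 -> s ^ 2 + c ^ 2 = 1 ->
  c ^ 4 * jquart k (s ^ 2 / c ^ 2) = 4 * (s ^ 2 / c ^ 2) * (1 - k * s ^ 2).
Proof.
  intros Hc E. unfold jquart.
  transitivity (4 * (s ^ 2 / c ^ 2) * (s ^ 2 + c ^ 2) * ((s ^ 2 + c ^ 2) - k * s ^ 2)).
  - field. exact Hc.
  - rewrite E. ring.
Qed.

Lemma tan2_derive_sqr (s c d x : C) : c <> 0 -> s ^ 2 + c ^ 2 = 1 ->
  x ^ 2 * ((2 * s * (c * d) * c ^ 2 - s ^ 2 * (2 * c * (- s * d))) / (c ^ 2) ^ 2) ^ 2 * c ^ 4
  = 4 * (s ^ 2 / c ^ 2) * (d * x) ^ 2.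
Proof.
  intros Hc E.
  transitivity (4 * (s ^ 2 / c ^ 2) * (d * x) ^ 2 * (s ^ 2 + c ^ 2) ^ 2).
  - field. exact Hc.
  - rewrite E. ring.
Qed.

(** Here x = cos (2 psi / 3), and the hypothesis equates two expressions of cos 2 psi. Both sides
    come out as (4x^3 - 3x)^2 / (x^6 c^4). *)
Lemma cubic_relation (k s c x : C) : c <> 0 -> x <> 0 -> s ^ 2 + c ^ 2 = 1 ->
  4 * x ^ 3 - 3 * x = 1 - 2 * (k * s ^ 2) ->
  (4 - 3 * / x ^ 2) ^ 2 * (1 + s ^ 2 / c ^ 2) ^ 2
  = (/ x ^ 2) ^ 3 * (1 + (1 - 2 * k) * (s ^ 2 / c ^ 2)) ^ 2.
Proof.
  intros Hc Hx E E3.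
  assert (H1 : 1 + s ^ 2 / c ^ 2 = / c ^ 2).
  { transitivity ((s ^ 2 + c ^ 2) / c ^ 2); [field; exact Hc|rewrite E; field; exact Hc]. }
  assert (H2 : 1 + (1 - 2 * k) * (s ^ 2 / c ^ 2) = (4 * x ^ 3 - 3 * x) / c ^ 2).
  { rewrite E3. transitivity (((s ^ 2 + c ^ 2) - 2 * (k * s ^ 2)) / c ^ 2).
    - field. exact Hc.
    - rewrite E. reflexivity. }
  rewrite H1, H2. field. split; assumption.
Qed.

Theorem theorem12 (kappa : R) (hk : (0 < kappa < 1)%R) :
  let lambda := sqrt (1 - kappa ^ 2) in
  exists r : R, (0 < r)%R /\
    (exists phi psi : C -> C, setting kappa r phi psi) /\
    forall phi psi : C -> C, setting kappa r phi psi ->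
      let s := fun u => Csin (phi u) in
      let c := fun u => Ccos (phi u) in
      let nabla := fun u => Ccos (2 / 3 * psi u) ^ 2 in
      let T := fun u => s u ^ 2 / c u ^ 2 in
      let t := fun u => s u / c u in
      (forall u : C, (Cmod u < r)%R ->
         exists dT : C, @is_derive C_AbsRing C_NormedModule T u dT /\
           nabla u * dT ^ 2
             = 4 * T u * (1 + T u) * (1 + RtoC lambda ^ 2 * T u)) /\
      ~ extends_to_elliptic r T /\ ~ extends_to_elliptic r t.
Proof.
  intros lambda. destruct (near0_good_point kappa) as [r [Hr H]].
  (* With |phi u| <= 2 |u|, |sin z| <= 3/2 |z| and |psi| <= 2 |sin psi|, the radius r/12 gives |psi
     u| <= 6 |u| < r/2. *)
  exists (r / 12)%R. split; [lra|]. split; [apply setting_exists; assumption|].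
  intros phi psi Hset s c nabla T t.
  set (k := RtoC kappa ^ 2).
  assert (El : RtoC lambda ^ 2 = 1 - k).
  { unfold lambda, k. rewrite <- !RtoC_pow, <- RtoC_minus. f_equal.
    rewrite pow2_sqrt; [reflexivity|]. simpl. nra. }
  assert (Hsin := near_identity_Csin kappa r H).
  assert (Hu := near_identity_u_of_phi kappa r hk H).
  assert (Facts : forall u, (Cmod u < r / 12)%R ->
    c u <> 0 /\ Ccos (psi u) <> 0 /\ Ccos (2 / 3 * psi u) <> 0 /\
    s u ^ 2 + c u ^ 2 = 1 /\ Ccos (psi u) ^ 2 = 1 - k * s u ^ 2).
  { intros u Hu'. destruct (setting_bounds kappa r phi psi hk Hr H Hset u Hu') as [B1 B2].
    destruct (H (phi u) ltac:(lra)) as [_ [G2 _]].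
    destruct (H (psi u) ltac:(lra)) as [_ [G3 [G4 _]]].
    split; [apply (neq_0_of_close_1 _ G2)|]. split; [apply (neq_0_of_close_1 _ G3)|].
    split; [apply (neq_0_of_close_1 _ G4)|]. split; [apply Csin2_Ccos2|].
    destruct (proj2 (proj2 Hset) u Hu') as [_ [_ [_ E]]].
    transitivity (1 - Csin (psi u) ^ 2); [rewrite <- (Csin2_Ccos2 (psi u)); ring|].
    rewrite E. unfold k, s. ring. }
  assert (Ode : forall u, (Cmod u < r / 12)%R -> exists dT, is_Cderive T u dT /\
     nabla u * dT ^ 2 = jquart k (T u) /\ c u ^ 4 * jquart k (T u) = 4 * (s u ^ 2 / c u ^ 2) * Ccos (psi u) ^ 2).
  { intros u Hu'. destruct (Facts u Hu') as [F1 [F2 [F3 [F4 F5]]]].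
    destruct (setting_derive kappa r phi psi u hk Hr H Hset Hu') as [d [Hd Ed]].
    assert (Ds := is_Cderive_comp _ _ _ _ _ (is_Cderive_Csin (phi u)) Hd).
    assert (Dc := is_Cderive_comp _ _ _ _ _ (is_Cderive_Ccos (phi u)) Hd).
    assert (Ds2 := is_Cderive_sqr _ _ _ Ds). assert (Dc2 := is_Cderive_sqr _ _ _ Dc).
    assert (D := is_Cderive_div _ _ _ _ _ Ds2 Dc2 (Cpow_nz _ 2 F1)).
    assert (Ej : c u ^ 4 * jquart k (T u) = 4 * (s u ^ 2 / c u ^ 2) * Ccos (psi u) ^ 2).
    { rewrite F5. exact (jquart_tan2 k (s u) (c u) F1 F4). }
    eexists. split; [exact D|]. split; [|exact Ej]. cbv beta.
    apply Cmult_cancel_r with (c u ^ 4); [apply Cpow_nz, F1|].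
    rewrite (Cmult_comm (jquart k (T u))), Ej, <- Ed.
    exact (tan2_derive_sqr (s u) (c u) d (Ccos (2 / 3 * psi u)) F1 F4). }
  assert (NotT : ~ extends_to_elliptic (r / 12) T).
  { intros [E [P [rho [Hell [[Hrho Hrr] HE]]]]].
    apply (elliptic_germ_absurd k E P rho (fun u => / nabla u)).
    - apply Cpow_nz, RtoC_neq_0. lra.
    - exact Hell.
    - apply germ_of_ode with T; [exact Hrho|exact HE| |].
      + intros u Hu'. replace (u - 0) with u in Hu' by ring.
        apply (Cdiff_comp Cinv nabla).
        * apply Cdiff_inv_id. apply Cpow_nz. apply Facts. lra.
        * apply (Cdiff_pow (fun u => Ccos (2 / 3 * psi u))).
          apply (Cdiff_comp Ccos (fun u => 2 / 3 * psi u)); [apply Cdiff_Ccos|].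
          apply Cdiff_mult; [apply Cdiff_const|]. apply Hset. lra.
      + intros u Hu'. destruct (Ode u ltac:(lra)) as [dT [D1 [D2 D3]]].
        destruct (Facts u ltac:(lra)) as [F1 [F2 [F3 [F4 F5]]]].
        exists dT. split; [exact D1|].
        (* Near 0 the sine vanishes only at 0; phi u = 0 would give u = [u_of_phi kappa 0] = 0. *)
        assert (Hs : s u <> 0).
        { intro E0. destruct (setting_bounds kappa r phi psi hk Hr H Hset u ltac:(lra)) as [B1 _].
          destruct (near_identity_le r Csin (phi u) Hsin ltac:(lra)) as [K _].
          unfold s in E0. rewrite E0, Cmod_0 in K.
          destruct (proj2 (proj2 Hset) u ltac:(lra)) as [_ [E1 _]].
          assert (K2 := Cmod_ge_0 (phi u)).
          assert (E2 : phi u = 0) by (apply Cmod_eq_0; lra).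
          rewrite E2, u_of_phi_0 in E1. rewrite <- E1, Cmod_0 in Hu'. lra. }
        assert (Hnab : nabla u <> 0) by (apply Cpow_nz, F3).
        split; [|split].
        * intro Z. rewrite Z in D3.
          assert (Z2 : 4 * (s u ^ 2 / c u ^ 2) * Ccos (psi u) ^ 2 <> 0).
          { apply Cmult_neq_0; [apply Cmult_neq_0|apply Cpow_nz, F2].
            - apply RtoC_neq_0. lra.
            - intro Z3. apply (Cpow_nz (s u) 2 Hs).
              transitivity (s u ^ 2 / c u ^ 2 * c u ^ 2); [field; exact F1|rewrite Z3; ring]. }
          apply Z2. rewrite <- D3. ring.
        * rewrite <- D2. field. exact Hnab.
        * apply (cubic_relation k (s u) (c u) (Ccos (2 / 3 * psi u)) F1 F3 F4).
          (* Three times 2 psi / 3 is 2 psi: the triple angle on the left meets the double angle on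
             the right. *)
          rewrite <- Ccos_3. replace (3 * (2 / 3 * psi u)) with (2 * psi u) by field.
          rewrite Ccos_2.
          transitivity (1 - 2 * (Csin (psi u) ^ 2 + Ccos (psi u) ^ 2 - Ccos (psi u) ^ 2)); [ring|].
          rewrite Csin2_Ccos2, F5. ring.
    - unfold nabla. rewrite (proj1 (proj2 Hset)), Cmult_0_r, Ccos_0. field. }
  split; [|split].
  - intros u Hu'. destruct (Ode u Hu') as [dT [D1 [D2 _]]]. exists dT. split; [exact D1|].
    rewrite El. exact D2.
  - exact NotT.
  - intros [E [P [rho [Hell [Hrho HE]]]]]. apply NotT.
    exists (fun u => E u ^ 2), P, rho. split; [apply elliptic_sqr, Hell|]. split; [exact Hrho|].
    intros u Hu'. destruct (HE u Hu') as [HP EE]. split; [exact HP|].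
    rewrite EE. destruct (Facts u ltac:(lra)) as [F1 _]. unfold T, t. field. exact F1.
Qed.
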